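(* Let $x:\Sigma^2\to\mathbb{R}^3$ be a channel linear Weingarten surface. Then either $x$ is tubular (a tube about a space curve, developable, or totally umbilic), or $x$ is a parallel surface of a surface of revolution that is minimal ($H=0$) or has constant Gauss curvature $K\neq0$.
   Context: Surfaces are smooth, connected, immersed surfaces $x:\Sigma^2\to\mathbb{R}^3$ in Euclidean 3-space with unit normal field $n$. The principal curvatures $\kappa_1,\kappa_2$ are the eigenvalues of the shape operator, with sign convention $\mathrm{II}=-\langle dx,dn\rangle$; $K=\kappa_1\kappa_2$ is the Gauss curvature and $H=\tfrac12(\kappa_1+\kappa_2)$ the mean curvature. A surface is linear Weingarten if there are real constants $a,b,c$, not all zero, with $aK+2bH+c=0$ on $\Sigma^2$. The discriminant of this condition is $\Delta:=b^2-ac$. If $\Delta=0$, the condition factorizes as $0=(a\kappa_1+b)(a\kappa_2+b)$, so that one principal curvature is constant, $\kappa_i\equiv-\tfrac{b}{a}$. A linear Weingarten surface is called tubular if it satisfies such a condition with $\Delta=0$ (it is then developable or a tube of constant radius about a curve) or if it is totally umbilic. A channel surface is a surface with a family of circular curvature lines, i.e. one of the families of curvature lines foliating the surface consists of (arcs of) circles; families containing straight lines, as on developable surfaces, are excluded unless the surface is tubular. The parallel surfaces of $x$ are $x^t=x+t\,n$, $t\in\mathbb{R}$ constant. Parallel surfaces may have singularities; curvature properties of a parallel surface are understood where it is immersed. A surface of revolution is a (part of a) surface generated by rotating a profile curve about a fixed axis. *)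

(* Defs.v *)
From HB Require Import structures.
From mathcomp Require Import all_boot all_order all_algebra.
From mathcomp Require Import all_classical all_reals all_analysis.
Set Implicit Arguments.
Unset Strict Implicit.
Unset Printing Implicit Defensive.
Import Order.TTheory GRing.Theory Num.Theory.
Import numFieldNormedType.Exports.
Local Open Scope classical_set_scope.
Local Open Scope ring_scope.

(* C^k on an open set: Frechet differentiable there, with every directional
   derivative (in a fixed direction) of class C^(k-1) *)
Fixpoint Ck_on (R : realType) (V W : normedModType R) (k : nat) (U : set V)
    (f : V -> W) : Prop :=
  match k with
  | 0%N => forall p, U p -> {for p, continuous f}
  | k'.+1 => (forall p, U p -> differentiable f p) /\
             (forall v : V, Ck_on k' U ('D_v f))
  end.

Definition smooth_on (R : realType) (V W : normedModType R) (U : set V)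
  (f : V -> W) : Prop := forall k : nat, Ck_on k U f.

Definition open_interval (R : realType) (J : set R) : Prop :=
  open J /\ is_interval J.

(* The values of [cmap] off [cdom] and of [cinv] off [cimg] are irrelevant. *)
Record chart (R : realType) (T : topologicalType) := Chart {
  cdom : set T;
  cimg : set 'rV[R]_2;
  cmap : T -> 'rV[R]_2;
  cinv : 'rV[R]_2 -> T;
  cdom_open : open cdom;
  cimg_open : open cimg;
  cmap_img : forall p, cdom p -> cimg (cmap p);
  cinv_dom : forall q, cimg q -> cdom (cinv q);
  cmapK : forall p, cdom p -> cinv (cmap p) = p;
  cinvK : forall q, cimg q -> cmap (cinv q) = q;
  cmap_continuous : forall p, cdom p -> {for p, continuous cmap};
  cinv_continuous : forall q, cimg q -> {for q, continuous cinv} }.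

Definition compatible (R : realType) (T : topologicalType) (c d : chart R T) :=
  smooth_on (cimg c `&` cinv c @^-1` cdom d) (cmap d \o cinv c) /\
  smooth_on (cimg d `&` cinv d @^-1` cdom c) (cmap c \o cinv d).

Record smooth_surface (R : realType) := SmoothSurface {
  carrier :> topologicalType;
  atlas : set (chart R carrier);
  atlas_cover : forall p, exists2 c, atlas c & cdom c p;
  atlas_compatible : forall c d, atlas c -> atlas d -> compatible c d;
  surface_hausdorff : hausdorff_space carrier;
  surface_second_countable : @second_countable carrier;
  surface_connected : connected [set: carrier] }.

(* charts of the maximal atlas, i.e. arbitrary smooth local coordinates *)
Definition coordinates (R : realType) (S : smooth_surface R) (d : chart R S) :=
  forall c, atlas c -> compatible c d.

Definition smooth_map (R : realType) (S : smooth_surface R)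
    (W : normedModType R) (f : S -> W) : Prop :=
  forall c, atlas c -> smooth_on (cimg c) (f \o cinv c).

Definition dot (R : realType) (m : nat) (u v : 'rV[R]_m) : R :=
  (u *m v^T) 0 0.

(* Local differential geometry of a parametrization x with normal field n.
   The rows of the 2 x 3 matrix 'J x q are the partial derivatives of x, and
   tangent vectors in coordinates are row vectors, on which matrices act from
   the right. *)
Section LocalGeometry.
Variables (R : realType) (x n : 'rV[R]_2 -> 'rV[R]_3).

Definition immersion_at (q : 'rV[R]_2) : Prop := row_free ('J x q).

Definition first_form (q : 'rV[R]_2) : 'M[R]_2 := 'J x q *m ('J x q)^T.

Definition second_form (q : 'rV[R]_2) : 'M[R]_2 := - ('J n q *m ('J x q)^T).

Definition shape (q : 'rV[R]_2) : 'M[R]_2 :=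
  second_form q *m invmx (first_form q).

(* the eigenvalues of the shape operator, listed with multiplicity in some
   order (both exist when x is an immersion at q with unit normal n) *)
Definition principal_curvatures (q : 'rV[R]_2) : R * R :=
  xget (0, 0) [set k : R * R |
    char_poly (shape q) = ('X - k.1%:P) * ('X - k.2%:P)].

Definition kappa1 (q : 'rV[R]_2) : R := (principal_curvatures q).1.
Definition kappa2 (q : 'rV[R]_2) : R := (principal_curvatures q).2.
Definition gauss_curvature (q : 'rV[R]_2) : R := kappa1 q * kappa2 q.
Definition mean_curvature (q : 'rV[R]_2) : R := (kappa1 q + kappa2 q) / 2.

Definition principal_direction (q v : 'rV[R]_2) : Prop :=
  v != 0 /\ exists k : R, v *m shape q = k *: v.

End LocalGeometry.

Section Surfaces.
Variables (R : realType) (S : smooth_surface R).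
Implicit Types (x y n : S -> 'rV[R]_3).

(* a smooth, possibly singular, map with a smooth unit normal field *)
Definition front x n : Prop :=
  [/\ smooth_map x, smooth_map n, (forall p, dot (n p) (n p) = 1) &
      forall c, atlas c -> forall q, cimg c q -> forall v : 'rV[R]_2,
        dot ('D_v (x \o cinv c) q) (n (cinv c q)) = 0].

Definition immersed_at x (p : S) : Prop :=
  forall c, atlas c -> cdom c p -> immersion_at (x \o cinv c) (cmap c p).

Definition immersed_surface x n : Prop :=
  front x n /\ forall p, immersed_at x p.

Definition discriminant (a b c : R) : R := b ^+ 2 - a * c.

Definition linear_weingarten_with x n (a b c : R) : Prop :=
  ~ [/\ a = 0, b = 0 & c = 0] /\
  forall d, atlas d -> forall q, cimg d q ->
    a * gauss_curvature (x \o cinv d) (n \o cinv d) q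
    + 2 * b * mean_curvature (x \o cinv d) (n \o cinv d) q + c = 0.

Definition linear_weingarten x n : Prop :=
  exists a b c : R, linear_weingarten_with x n a b c.

Definition totally_umbilic x n : Prop :=
  forall d, atlas d -> forall q, cimg d q ->
    kappa1 (x \o cinv d) (n \o cinv d) q
    = kappa2 (x \o cinv d) (n \o cinv d) q.

Definition tubular x n : Prop :=
  (exists a b c : R,
     linear_weingarten_with x n a b c /\ discriminant a b c = 0)
  \/ totally_umbilic x n.

Definition in_circle (A : set 'rV[R]_3) : Prop :=
  exists (o m : 'rV[R]_3) (rho : R), [/\ m != 0, 0 < rho &
    forall z, A z -> dot (z - o) (z - o) = rho ^+ 2 /\ dot (z - o) m = 0].

Definition in_line (A : set 'rV[R]_3) : Prop :=
  exists (o e : 'rV[R]_3), e != 0 /\ forall z, A z -> exists a : R, z = o + a *: e.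

Definition dir2 : 'rV[R]_2 := delta_mx 0 1.

(* coordinates (u, v) onto an open box, whose v-lines are the plaques *)
Definition box_chart (d : chart R S) : Prop :=
  exists I J : set R, [/\ open_interval I, open_interval J &
    cimg d = [set q : 'rV[R]_2 | I (q 0 0) /\ J (q 0 1)]].

Definition plaque (d : chart R S) (q : 'rV[R]_2) : set S :=
  cinv d @` [set q' | cimg d q' /\ q' 0 0 = q 0 0].

(* A one-dimensional foliation, given by a foliated atlas: the coordinate
   changes (u, v) |-> (u', v') satisfy d u' / d v = 0. *)
Definition foliation (F : set (chart R S)) : Prop :=
  [/\ forall d, F d -> coordinates d /\ box_chart d,
      forall p, exists2 d, F d & cdom d p &
      forall d d', F d -> F d' -> forall q, cimg d q -> cdom d' (cinv d q) ->
        ('D_dir2 (cmap d' \o cinv d) q : 'rV[R]_2) 0 0 = 0].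

Definition curvature_line_foliation x n (F : set (chart R S)) : Prop :=
  foliation F /\
  forall d, F d -> forall q, cimg d q ->
    principal_direction (x \o cinv d) (n \o cinv d) q dir2.

Definition channel x n : Prop :=
  exists F : set (chart R S), [/\ curvature_line_foliation x n F,
    forall d, F d -> forall q, cimg d q ->
      in_circle (x @` plaque d q) \/ in_line (x @` plaque d q) &
    (exists d q, [/\ F d, cimg d q & in_line (x @` plaque d q)]) ->
      tubular x n].

(* the point (r cos v, r sin v, h), for the axis of rotation R e_3 *)
Definition rotate (r h v : R) : 'rV[R]_3 :=
  \row_(j < 3) [:: r * cos v; r * sin v; h]`_j.

(* (Part of) a surface of revolution: up to the rigid motion z |-> o + z Q,
   it is parametrized near every point by rotating one and the same profile
   curve (r, h).  The profile curve may be singular and may meet the axis. *)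
Definition surface_of_revolution y : Prop :=
  exists (o : 'rV[R]_3) (Q : 'M[R]_3) (J : set R) (r h : R -> R),
  [/\ Q *m Q^T = 1%:M, open_interval J,
      smooth_on (V := R^o) (W := R^o) J r, smooth_on (V := R^o) (W := R^o) J h &
      forall p : S, exists d : chart R S, [/\ coordinates d, cdom d p &
        forall q, cimg d q -> J (q 0 0) /\
          y (cinv d q) = o + rotate (r (q 0 0)) (h (q 0 0)) (q 0 1) *m Q]].

Definition parallel_surface y n (t : R) : S -> 'rV[R]_3 :=
  fun p => y p + t *: n p.

(* The parallel surface may be singular, but not on an open set; curvature
   conditions are imposed at its immersed points only. *)
Definition generically_immersed y : Prop := dense [set p | immersed_at y p].

Definition minimal y n : Prop :=
  forall d, atlas d -> forall q, cimg d q -> immersion_at (y \o cinv d) q ->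
    mean_curvature (y \o cinv d) (n \o cinv d) q = 0.

Definition constant_gauss_curvature y n (K : R) : Prop :=
  forall d, atlas d -> forall q, cimg d q -> immersion_at (y \o cinv d) q ->
    gauss_curvature (y \o cinv d) (n \o cinv d) q = K.

End Surfaces.

(* Main.v *)
Require Import Defs.
From HB Require Import structures.
From mathcomp Require Import all_boot all_order all_algebra.
From mathcomp Require Import all_classical all_reals all_analysis.
From mathcomp Require Import ring lra.
Set Implicit Arguments.
Unset Strict Implicit.
Unset Printing Implicit Defensive.
Import Order.TTheory GRing.Theory Num.Theory.
Import numFieldNormedType.Exports.
Local Open Scope classical_set_scope.
Local Open Scope ring_scope.

(** Let x be a channel linear Weingarten surface that is not tubular. Then
    b^2 - a c <> 0 and the leaves of the foliation are circles. The proof shows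
    that all these circles have one axis, and then picks the right parallel
    surface.

    Local part. In a foliated chart (u, v) let k be the curvature along the
    circles and k1 the other one. A planar curvature line meets its plane at a
    constant angle (Joachimsthal), and for circles this makes k constant along
    the leaf ([circle_frame], [k_vconst]). The relation
    a k k1 + b (k + k1) + c = 0 can be solved for k1, because a k + b = 0 would
    force b^2 = a c; so k1 is constant along the leaves as well. This is the use
    of the Weingarten hypothesis: on a general channel surface k1 varies along
    the circles. From here on everything depends on u alone. Let X be the part
    of x_u orthogonal to the circles. The Codazzi equation becomes
    (k1 - k) X_v = k_u x_v, and a Gronwall estimate shows that one umbilic makes
    the whole chart umbilic ([umbilic_propagates]). Without umbilics, X_v = nu x_v
    with nu = k_u / (k1 - k), and by the Gauss equation the vector
    A = k X + nu n, which is constant along each circle, satisfies A_u = rate A,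
    while the centre of the circle moves in the direction of A. Hence the
    circles of a chart have a common axis ([axis_exists]), and every surface
    x - t n is rotational about it ([rotational_form]).

    Global part. A property that spreads over foliated charts holds everywhere
    on a connected surface ([leafwise_global]). This applies to umbilics and, as
    an axis is determined by any open piece ([axis_rigid]), to the axis.

    Profile curve. A surface of revolution has one profile curve, which may be
    singular. Around each point there is a local one ([rotation_charts]);
    countably many of them suffice, and they are placed side by side on the real
    line and joined by bump functions ([concatenation],
    [revolution_from_profiles]).

    Choice of t. For c = 0 and t = a / (2 b) the surface x - t n is minimal. For
    c <> 0 and t = b / c it has Gauss curvature c^2 / (b^2 - a c) and is singular
    exactly where k k1 = 0. This cannot happen on an open set: if k k1 = 0 there,
    a Gronwall estimate gives k k1 = 0 everywhere, and x is developable
    ([flat_propagates], [nowhere_flat]). *)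

(** * Calculus of maps of class C^k *)

Section CkCalculus.
Variable R : realType.
Implicit Types V W Z : normedModType R.

Lemma open_near V (U : set V) p : open U -> U p -> \forall q \near p, U q.
Proof. by move=> oU Up; apply: open_nbhs_nbhs. Qed.

Lemma eq_on_near V (T : Type) (U : set V) (f g : V -> T) p : open U -> U p ->
  (forall q, U q -> f q = g q) -> \forall q \near p, f q = g q.
Proof. by move=> oU Up fg; apply: filterS (open_near oU Up). Qed.

Lemma eq_on_derive V W (U : set V) (f g : V -> W) v p : open U -> U p ->
  (forall q, U q -> f q = g q) -> 'D_v f p = 'D_v g p.
Proof. by move=> oU Up fg; apply: near_eq_derive; exact: eq_on_near fg. Qed.

Lemma is_diff_eps V W (f : V -> W) p (L : {linear V -> W}) : continuous L ->
  (forall e, 0 < e -> \forall h \near (0 : V), `|f (h + p) - f p - L h| <= e * `|h|) ->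
  differentiable f p /\ 'd f p = L :> (V -> W).
Proof.
move=> cL fL.
have E : f \o shift p = cst (f p) + L +o_ (0 : V) id.
  apply/eqaddoP => e /fL; apply: filterS => h.
  by rewrite /= opprD addrA.
have dE : 'd f p = L :> (V -> W) by exact: diff_unique.
by split => //; apply/diff_locallyP; rewrite dE.
Qed.

Lemma diff_eps V W (f : V -> W) p : differentiable f p ->
  (forall e, 0 < e -> \forall h \near (0 : V), `|f (h + p) - f p - 'd f p h| <= e * `|h|).
Proof.
move=> /diff_locally/eqaddoP fL e /fL; apply: filterS => h.
by rewrite /= opprD addrA.
Qed.

Lemma near_eq_differentiable V W (f g : V -> W) p :
  (\forall q \near p, f q = g q) -> differentiable f p -> differentiable g p.
Proof.
move=> fg df; apply: (proj1 (is_diff_eps (L := 'd f p) _ _)); first exact: diff_continuous.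
move=> e e0.
have fgp : f p = g p by exact: nbhs_singleton fg.
have fg0 : \forall h \near (0 : V), f (h + p) = g (h + p).
  move: fg; rewrite (near_shift 0) /= subr0; exact.
by near do rewrite -(near fg0) // -fgp; exact: (diff_eps df e0).
Unshelve. all: by end_near. Qed.

Lemma Ck_onS V W k (U : set V) (f : V -> W) : Ck_on k.+1 U f -> Ck_on k U f.
Proof.
elim: k f => [|k IH] f [df Df]; first by move=> p Up; exact/differentiable_continuous/df.
by split=> // v; apply: IH; exact: Df.
Qed.

Lemma eq_Ck_on V W k (U : set V) (f g : V -> W) : open U ->
  (forall p, U p -> f p = g p) -> Ck_on k U f -> Ck_on k U g.
Proof.
move=> oU; elim: k f g => [|k IH] f g fg.
  move=> cf p Up; rewrite /prop_for /continuous_at -(fg _ Up).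
  by apply: cvg_trans (cf p Up); apply: near_eq_cvg; exact: eq_on_near fg.
move=> [df Df]; split=> [p Up|v].
  by apply: near_eq_differentiable (df p Up); exact: eq_on_near fg.
by apply: IH (Df v) => p Up; exact: eq_on_derive fg.
Qed.

Lemma Ck_on_subset V W k (U U' : set V) (f : V -> W) :
  U `<=` U' -> Ck_on k U' f -> Ck_on k U f.
Proof.
move=> UU'; elim: k f => [|k IH] f; first by move=> cf p /UU'; exact: cf.
by move=> [df Df]; split=> [p /UU'|v]; [exact: df|exact: IH (Df v)].
Qed.

Lemma Ck_on_local V W k (U : set V) (f : V -> W) :
  (forall p, U p -> exists2 U' : set V, U' p & Ck_on k U' f) -> Ck_on k U f.
Proof.
elim: k f => [|k IH] f lf; first by move=> p /lf[U' U'p] /= cf; exact: cf.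
split=> [p /lf[U' U'p [df _]]|v]; first exact: df.
by apply: IH => p /lf[U' U'p [_ /(_ v)]]; exists U'.
Qed.

Lemma Ck_on_cst V W k (U : set V) (c : W) : Ck_on k U (fun=> c).
Proof.
elim: k c => [|k IH] c; first by move=> p _; exact: cvg_cst.
split=> [p _|v]; first exact: differentiable_cst.
by rewrite (_ : 'D_v _ = fun=> 0) //; apply/funext => p; rewrite derive_cst.
Qed.

Lemma Ck_onD V W k (U : set V) (f g : V -> W) : open U ->
  Ck_on k U f -> Ck_on k U g -> Ck_on k U (fun p => f p + g p).
Proof.
move=> oU; elim: k f g => [|k IH] f g.
  by move=> cf cg p Up; apply: cvgD; [exact: cf|exact: cg].
move=> [df Df] [dg Dg]; split=> [p Up|v].
  by apply: differentiableD; [exact: df|exact: dg].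
apply: (eq_Ck_on oU _ (IH _ _ (Df v) (Dg v))) => p Up /=.
by rewrite deriveD //; apply: diff_derivable; [exact: df|exact: dg].
Qed.

Lemma Ck_on_sum V W k (U : set V) (I : finType) (f : I -> V -> W) : open U ->
  (forall i, Ck_on k U (f i)) -> Ck_on k U (fun p => \sum_i f i p).
Proof.
move=> oU fk; elim: (index_enum I) => [|i s IH].
  by apply: eq_Ck_on (Ck_on_cst k U 0) => // p _; rewrite big_nil.
apply: eq_Ck_on (Ck_onD oU (fk i) IH) => // p _.
by rewrite big_cons.
Qed.

Lemma Ck_onM V k (U : set V) (f g : V -> R) : open U ->
  Ck_on k U f -> Ck_on k U g -> Ck_on k U (fun p => f p * g p).
Proof.
move=> oU; elim: k f g => [|k IH] f g.
  by move=> cf cg p Up; apply: cvgM; [exact: cf|exact: cg].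
move=> Sf Sg; have [df Df] := Sf; have [dg Dg] := Sg; split=> [p Up|v].
  by apply: differentiableM; [exact: df|exact: dg].
apply: (eq_Ck_on oU _ (Ck_onD oU (IH _ _ (Ck_onS Sf) (Dg v)) (IH _ _ (Ck_onS Sg) (Df v)))).
move=> p Up /=; rewrite [RHS]deriveM //; apply: diff_derivable; [exact: df|exact: dg].
Qed.

Lemma Ck_onZl V W k (U : set V) (f : V -> R) (w : W) : open U ->
  Ck_on k U f -> Ck_on k U (fun p => f p *: w).
Proof.
move=> oU; elim: k f => [|k IH] f.
  by move=> cf p Up; apply: cvgZl; exact: cf.
move=> [df Df]; split=> [p Up|v].
  by apply: differentiableZl; exact: df.
apply: (eq_Ck_on oU _ (IH _ (Df v))) => p Up /=.
by rewrite [RHS]deriveE ?diffZl ?deriveE //; [exact: df|exact: df|exact/differentiableZl/df].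
Qed.

Lemma differentiable_entry V m n (f : V -> 'M[R]_(m, n)) i j p :
  differentiable f p -> differentiable (fun q => f q i j) p.
Proof.
by move=> df; apply: differentiable_comp df (differentiable_coord _ _ _).
Qed.

Lemma derive_entry V m n (f : V -> 'M[R]_(m, n)) i j p v :
  differentiable f p -> 'D_v (fun q => f q i j) p = ('D_v f p) i j.
Proof. by move=> df; rewrite derive_mx ?mxE //; exact: diff_derivable. Qed.

Lemma Ck_on_entry V m n k (U : set V) (f : V -> 'M[R]_(m, n)) i j : open U ->
  Ck_on k U f -> Ck_on k U (fun q => f q i j).
Proof.
move=> oU; elim: k f => [|k IH] f.
  move=> cf p Up; apply: (@continuous_comp _ _ _ f (fun M : 'M[R]_(m, n) => M i j)).
    exact: cf.
  exact: coord_continuous.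
move=> [df Df]; split=> [p Up|v]; first exact/differentiable_entry/df.
apply: (eq_Ck_on oU _ (IH _ (Df v))) => p Up /=.
by rewrite derive_entry //; exact: df.
Qed.

Lemma Ck_on_mx V m n k (U : set V) (f : V -> 'M[R]_(m, n)) : open U ->
  (forall i j, Ck_on k U (fun q => f q i j)) -> Ck_on k U f.
Proof.
move=> oU fk; apply: (eq_Ck_on oU (f := fun p => \sum_i \sum_j f p i j *: delta_mx i j)).
  by move=> p _; rewrite -matrix_sum_delta.
apply: (Ck_on_sum oU) => i; apply: (Ck_on_sum oU) => j.
by apply: (Ck_onZl _ oU).
Qed.

Lemma Ck_onV V k (U : set V) (f : V -> R) : open U -> (forall p, U p -> f p != 0) ->
  Ck_on k U f -> Ck_on k U (fun p => (f p)^-1).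
Proof.
move=> oU f0; elim: k => [|k IH].
  by move=> cf p Up; apply: cvgV; [exact: f0|exact: cf].
move=> Sf; have [df Df] := Sf; split=> [p Up|v].
  by apply: differentiableV; [exact: df|exact: f0].
have S1 := IH (Ck_onS Sf).
have S2 : Ck_on k U (fun p => -1 * ((f p)^-1 * (f p)^-1 * 'D_v f p)).
  exact: Ck_onM oU (Ck_on_cst k U (-1 : R)) (Ck_onM oU (Ck_onM oU S1 S1) (Df v)).
apply: (eq_Ck_on oU _ S2).
move=> p Up /=; rewrite [RHS]deriveV ?f0 //; last by apply: diff_derivable; exact: df.
by rewrite /GRing.scale /= mulN1r -mulNr -exprVn expr2.
Qed.

Lemma derive_comp V W Z (f : V -> W) (g : W -> Z) p v :
  differentiable f p -> differentiable g (f p) ->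
  'D_v (g \o f) p = 'D_('D_v f p) g (f p).
Proof.
move=> df dg; rewrite deriveE; last exact: differentiable_comp.
by rewrite diff_comp //= (@deriveE _ _ _ g _ _ dg) (@deriveE _ _ _ f _ _ df).
Qed.

Lemma derive_sum_dir V W (I : finType) (g : V -> W) p (c : I -> R) (e : I -> V) :
  differentiable g p -> 'D_(\sum_i c i *: e i) g p = \sum_i c i *: 'D_(e i) g p.
Proof.
move=> dg; rewrite deriveE // linear_sum; apply: eq_bigr => i _.
by rewrite linearZ /= deriveE.
Qed.

(** The derivative of g o f in direction v is the derivative of g in the
    direction D_v f, which varies with the point. Expanding that direction in a
    basis e turns it into a combination of derivatives in fixed directions, to
    which induction on k applies. The coordinate functions c are abstract so that
    one proof serves vector-valued and real-valued f. *)
Lemma Ck_on_comp_basis V W Z (I : finType) (e : I -> W) (c : I -> W -> R)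
    k (U : set V) (U' : set W) (f : V -> W) (g : W -> Z) : open U ->
  (forall w, w = \sum_i c i w *: e i) ->
  (forall i l h, Ck_on l U h -> Ck_on l U (fun p => c i (h p))) ->
  (forall l (a : V -> R) (h : V -> Z), Ck_on l U a -> Ck_on l U h -> Ck_on l U (fun p => a p *: h p)) ->
  (forall p, U p -> U' (f p)) ->
  Ck_on k U f -> Ck_on k U' g -> Ck_on k U (fun p => g (f p)).
Proof.
move=> oU we cS Zs fU; elim: k g => [|k IH] g.
  move=> cf cg p Up; apply: continuous_comp; [exact: cf|exact/cg/fU].
move=> Sf [dg Dg]; have [df Df] := Sf; split=> [p Up|v].
  by apply: differentiable_comp; [exact: df|exact/dg/fU].
apply: (eq_Ck_on oU (f := fun p => \sum_i c i ('D_v f p) *: 'D_(e i) g (f p))).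
  move=> p Up; rewrite -derive_sum_dir -?we; last exact/dg/fU.
  by rewrite -derive_comp //; [exact/df|exact/dg/fU].
apply: (Ck_on_sum oU) => i; apply: Zs; first exact/cS/Df.
exact: IH (Ck_onS Sf) (Dg _).
Qed.

End CkCalculus.

(** * The mean value theorem and the symmetry of second derivatives *)

Section SmoothCalculus.
Variable R : realType.
Implicit Types V W Z : normedModType R.

Lemma differentiable_line V W (f : V -> W) q v (s : R) :
  differentiable f (q + s *: v) -> differentiable (fun t : R => f (q + t *: v)) s /\
  'D_1 (fun t : R => f (q + t *: v)) s = 'D_v f (q + s *: v).
Proof.
move=> df; pose a (t : R) := q + t *: v.
have da : differentiable a s by apply: differentiableD => //; exact: differentiableZl.
split; first by apply: (@differentiable_comp _ _ _ _ a f).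
have -> : 'D_1 (fun t : R => f (q + t *: v)) s = 'D_('D_1 a s) f (a s).
  exact: (@derive_comp R R V W a f s 1 da df).
congr (derive _ _ _).
rewrite /a deriveD; last 2 first.
- exact: derivable_cst.
- by apply: diff_derivable; exact: (@differentiableZl _ _ _ id).
rewrite derive_cst add0r deriveE; last exact: (@differentiableZl _ _ _ id).
rewrite (@diffZl _ _ _ id) //= (_ : 'd id s = id :> (R -> R)) ?scale1r //.
exact: diff_val.
Qed.


Lemma is_derive_line V W (f : V -> W) q v (s : R) : differentiable f (q + s *: v) ->
  is_derive s 1 (fun t : R => f (q + t *: v)) ('D_v f (q + s *: v)).
Proof.
move=> df; have [d1 d2] := differentiable_line df.
by apply: DeriveDef => //; exact: diff_derivable.
Qed.

Lemma MVT_line V (f : V -> R) q v (h : R) : 0 < h ->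
  (forall s, 0 <= s <= h -> differentiable f (q + s *: v)) ->
  exists2 c, 0 < c < h & f (q + h *: v) - f q = 'D_v f (q + c *: v) * h.
Proof.
move=> h0 df.
have H1 x : x \in `]0, h[%R -> is_derive x 1 (fun t => f (q + t *: v)) ('D_v f (q + x *: v)).
  by rewrite in_itv /= => /andP[x0 xh]; apply/is_derive_line/df; rewrite !ltW.
have H2 : {within `[0, h], continuous (fun t => f (q + t *: v))}.
  apply: derivable_within_continuous => x; rewrite in_itv /= => xh.
  by have [] := is_derive_line (df x xh).
have [c ci] := MVT h0 H1 H2.
by rewrite scale0r addr0 subr0 => ->; exists c => //; rewrite in_itv in ci.
Qed.

(** The mean value theorem in direction v and then in direction w expresses a
    second difference of f over a parallelogram by a mixed derivative. *)
Lemma mixed_MVT V (f : V -> R) p v w (h : R) : 0 < h ->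
  (forall s t, 0 <= s <= h -> 0 <= t <= h -> differentiable f (p + s *: v + t *: w)) ->
  (forall s t, 0 <= s <= h -> 0 <= t <= h -> differentiable ('D_v f) (p + s *: v + t *: w)) ->
  exists s t, [/\ 0 <= s <= h, 0 <= t <= h &
   f (p + h *: v + h *: w) - f (p + h *: v) - f (p + h *: w) + f p =
   'D_w ('D_v f) (p + s *: v + t *: w) * h ^+ 2].
Proof.
move=> h0 df dDf.
have hh : 0 <= h <= h by rewrite lexx ltW.
have h00 : 0 <= (0 : R) <= h by rewrite lexx ltW.
pose g q := f (q + h *: w) - f q.
have dfw q : differentiable f (q + h *: w) -> differentiable (fun q => f (q + h *: w)) q /\
    'D_v (fun q => f (q + h *: w)) q = 'D_v f (q + h *: w).
  move=> d1; have da : differentiable (fun q => q + h *: w) q by apply: differentiableD.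
  split; first exact: (@differentiable_comp _ _ _ _ (fun q => q + h *: w) f).
  have -> : 'D_v (fun q => f (q + h *: w)) q = 'D_('D_v (fun q => q + h *: w) q) f (q + h *: w).
    exact: (@derive_comp R V V R (fun q => q + h *: w) f q v da d1).
  congr (derive _ _ _); rewrite deriveD ?derive_cst ?addr0 ?derive_id //.
have [s /andP[s0 sh]] : exists2 s, 0 < s < h & g (p + h *: v) - g p = 'D_v g (p + s *: v) * h.
  apply: MVT_line => // s sh; apply: differentiableB.
    by apply: (proj1 (dfw _ _)); exact: df.
  by have := df s 0 sh h00; rewrite scale0r addr0.
have sh' : 0 <= s <= h by rewrite !ltW.
rewrite (_ : 'D_v g _ = 'D_v f (p + s *: v + h *: w) - 'D_v f (p + s *: v)); last first.
  have [d1 d2] := dfw (p + s *: v) (df _ _ sh' hh).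
  rewrite [LHS]deriveB ?d2 //; apply: diff_derivable => //.
  by have := df s 0 sh' h00; rewrite scale0r addr0.
have [t /andP[t0 th] ->] : exists2 t, 0 < t < h &
    'D_v f (p + s *: v + h *: w) - 'D_v f (p + s *: v) = 'D_w ('D_v f) (p + s *: v + t *: w) * h.
  apply: (MVT_line h0 (f := 'D_v f) (q := p + s *: v) (v := w)) => t th; exact: dDf sh' th.
move=> E; exists s, t; split=> //; first by rewrite !ltW.
by rewrite expr2 mulrA -E /g; ring.
Qed.

Lemma le_dist_half (a b x e : R) : `|a - x| < e / 2 -> `|b - x| < e / 2 -> `|a - b| <= e.
Proof.
move=> ax bx; rewrite -(subrKA x) (le_trans (ler_normD _ _)) // (splitr e).
by rewrite lerD // ltW // distrC.
Qed.

(** The second difference of f over a small parallelogram is symmetric in v and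
    w, so the two mixed derivatives agree at two points close to p. *)
Lemma Schwarz_scalar V (U : set V) (f : V -> R) p v w : open U -> U p ->
  Ck_on 2 U f -> 'D_w ('D_v f) p = 'D_v ('D_w f) p.
Proof.
move=> oU Up [df Df].
have [dvf Dvf] := Df v; have [dwf Dwf] := Df w.
apply/eqP; rewrite -subr_eq0 -normr_le0; apply/ler_addgt0Pr => e e0; rewrite add0r.
have e20 : 0 < e / 2 by rewrite divr_gt0.
have c1 : \forall q \near p, `|'D_w ('D_v f) p - 'D_w ('D_v f) q| < e / 2.
  exact: (proj1 (cvgrPdist_lt _ _) (Dvf w _ Up) _ e20).
have c2 : \forall q \near p, `|'D_v ('D_w f) p - 'D_v ('D_w f) q| < e / 2.
  exact: (proj1 (cvgrPdist_lt _ _) (Dwf v _ Up) _ e20).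
have c12 := filterI (open_near oU Up) (filterI c1 c2).
have [r /= r0 rP] := proj1 (nbhs_ballP _ _) (c12 _ _).
pose M := `|v| + `|w| + 1; pose h := r / 2 / M.
have M0 : 0 < M by rewrite ltr_wpDl // addr_ge0.
have h0 : 0 < h by rewrite !divr_gt0.
have inr s t : 0 <= s <= h -> 0 <= t <= h -> ball p r (p + s *: v + t *: w).
  move=> /andP[s0 sh] /andP[t0 th]; rewrite -ball_normE /= -addrA opprD addrA subrr add0r normrN.
  apply: (le_lt_trans (ler_normD _ _)); rewrite !normrZ !ger0_norm //.
  apply: (@le_lt_trans _ _ (h * M)); last by rewrite /h divfK ?gt_eqF // ltr_pdivrMr // ltr_pMr // ltr1n.
  rewrite /M mulrDr mulr1 mulrDr -addrA lerD ?ler_wpM2r //.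
  by apply: ler_wpDr; [exact: ltW | rewrite ler_wpM2r].
have inU s t (sh : 0 <= s <= h) (th : 0 <= t <= h) : U (p + s *: v + t *: w) by have [] := rP _ (inr s t sh th).
have [s [t [sh th E1]]] := mixed_MVT h0 (fun s t sh th => df _ (inU s t sh th)) (fun s t sh th => dvf _ (inU s t sh th)).
have inr' s' t' : 0 <= s' <= h -> 0 <= t' <= h -> ball p r (p + s' *: w + t' *: v).
  by move=> ? ?; rewrite addrAC; apply: inr.
have inU' s' t' (sh' : 0 <= s' <= h) (th' : 0 <= t' <= h) : U (p + s' *: w + t' *: v) by have [] := rP _ (inr' s' t' sh' th').
have [s' [t' [sh' th' E2]]] := mixed_MVT h0 (fun s t sh th => df _ (inU' s t sh th)) (fun s t sh th => dwf _ (inU' s t sh th)).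
have h2 : h ^+ 2 != 0 by rewrite expf_neq0 // gt_eqF.
have E : 'D_w ('D_v f) (p + s *: v + t *: w) = 'D_v ('D_w f) (p + s' *: w + t' *: v).
  have D : f (p + h *: w + h *: v) - f (p + h *: w) - f (p + h *: v) + f p =
           f (p + h *: v + h *: w) - f (p + h *: v) - f (p + h *: w) + f p.
    by rewrite (addrAC p (h *: w)); congr (_ + _); exact: addrAC.
  exact: (mulIf h2 (etrans (esym E1) (etrans (esym D) E2))).
have [_ [A1 _]] := rP _ (inr s t sh th); have [_ [_ A2]] := rP _ (inr' s' t' sh' th').
by move: A1; rewrite E => A1; exact: le_dist_half A1 A2.
Qed.

End SmoothCalculus.

(** * Smooth maps *)

Section SmoothFunctions.
Variable R : realType.
Implicit Types V W Z : normedModType R.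

Lemma Ck_onZ V m n k (U : set V) (f : V -> R) (g : V -> 'M[R]_(m, n)) : open U ->
  Ck_on k U f -> Ck_on k U g -> Ck_on k U (fun p => f p *: g p).
Proof.
move=> oU sf sg; apply: (Ck_on_mx oU) => i j.
apply: (eq_Ck_on oU _ (Ck_onM oU sf (Ck_on_entry i j oU sg))) => p _.
by rewrite mxE.
Qed.

Lemma Ck_on_rV_comp V m n k (U : set V) (U' : set 'rV[R]_m) (f : V -> 'rV[R]_m)
    (g : 'rV[R]_m -> 'rV[R]_n) : open U -> (forall p, U p -> U' (f p)) ->
  Ck_on k U f -> Ck_on k U' g -> Ck_on k U (fun p => g (f p)).
Proof.
move=> oU; apply: (@Ck_on_comp_basis _ _ _ _ _ (fun i => delta_mx 0 i) (fun i w => w 0 i)) => //.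
- exact: row_sum_delta.
- by move=> i l h; exact: Ck_on_entry.
- by move=> l a h; exact: Ck_onZ.
Qed.

Lemma Ck_on_rV_comp_scalar V m k (U : set V) (U' : set 'rV[R]_m) (f : V -> 'rV[R]_m)
    (g : 'rV[R]_m -> R) : open U -> (forall p, U p -> U' (f p)) ->
  Ck_on k U f -> Ck_on k U' g -> Ck_on k U (fun p => g (f p)).
Proof.
move=> oU; apply: (@Ck_on_comp_basis _ _ _ _ _ (fun i => delta_mx 0 i) (fun i w => w 0 i)) => //.
- exact: row_sum_delta.
- by move=> i l h; exact: Ck_on_entry.
- by move=> l a h; exact: Ck_onM.
Qed.

Lemma Ck_on_real_comp V k (U : set V) (U' : set R) (f : V -> R)
    (g : R -> R) : open U -> (forall p, U p -> U' (f p)) ->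
  Ck_on k U f -> Ck_on k U' g -> Ck_on k U (fun p => g (f p)).
Proof.
move=> oU.
apply: (@Ck_on_comp_basis _ _ R R _ (fun i : 'I_1 => (1 : R)) (fun i w => w)) => //.
- by move=> w; rewrite big_ord1 /GRing.scale /= mulr1.
- by move=> l a h; exact: Ck_onM.
Qed.

(** Entrywise, this is the product rule for real functions. *)
Lemma is_derive_scale V m n (f : V -> R) (g : V -> 'M[R]_(m, n)) p v :
  differentiable f p -> differentiable g p ->
  'D_v (fun q => f q *: g q) p = 'D_v f p *: g p + f p *: 'D_v g p.
Proof.
move=> df dg; have dfg i j : differentiable (fun q => (f q *: g q) i j) p.
  rewrite (_ : (fun q => _) = f * (fun q => g q i j)).
    by apply: differentiableM => //; exact: differentiable_entry.
  by apply/funext => q; rewrite mxE.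
rewrite derive_mx; last by apply/derivable_mxP => i j; exact: diff_derivable.
apply/matrixP => i j; rewrite !mxE -derive_entry //.
rewrite (_ : (fun q => _) = f * (fun q => g q i j)); last by apply/funext => q; rewrite mxE.
rewrite deriveM; last 2 first.
- exact: diff_derivable.
- by apply: diff_derivable; exact: differentiable_entry.
by rewrite addrC; congr (_ + _); exact: mulrC.
Qed.

Lemma smooth_cst V W (U : set V) (c : W) : smooth_on U (fun=> c).
Proof. by move=> k; exact: Ck_on_cst. Qed.

Section OnOpen.
Variables (V : normedModType R) (U : set V).
Hypothesis oU : open U.

Lemma eq_smooth_on W (f g : V -> W) : (forall p, U p -> f p = g p) ->
  smooth_on U f -> smooth_on U g.
Proof. by move=> fg sf k; exact: eq_Ck_on (sf k). Qed.
Lemma smoothD W (f g : V -> W) : smooth_on U f -> smooth_on U g ->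
  smooth_on U (fun p => f p + g p).
Proof. by move=> sf sg k; exact: Ck_onD. Qed.
Lemma smoothM (f g : V -> R) : smooth_on U f -> smooth_on U g ->
  smooth_on U (fun p => f p * g p).
Proof. by move=> sf sg k; exact: Ck_onM. Qed.
Lemma smoothZ m n (f : V -> R) (g : V -> 'M[R]_(m, n)) : smooth_on U f -> smooth_on U g ->
  smooth_on U (fun p => f p *: g p).
Proof. by move=> sf sg k; exact: Ck_onZ. Qed.
Lemma smoothN (f : V -> R) : smooth_on U f -> smooth_on U (fun p => - f p).
Proof.
move=> sf; apply: (eq_smooth_on (f := fun p => -1 * f p)) => [p _|].
  by rewrite mulN1r.
by apply: smoothM => //; exact: smooth_cst.
Qed.
Lemma smoothNv m n (f : V -> 'M[R]_(m, n)) : smooth_on U f -> smooth_on U (fun p => - f p).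
Proof.
move=> sf; apply: (eq_smooth_on (f := fun p => -1 *: f p)) => [p _|].
  by rewrite scaleN1r.
by apply: smoothZ => //; exact: smooth_cst.
Qed.
Lemma smoothB (f g : V -> R) : smooth_on U f -> smooth_on U g ->
  smooth_on U (fun p => f p - g p).
Proof. by move=> sf sg; apply: smoothD => //; exact: smoothN. Qed.
Lemma smoothBv m n (f g : V -> 'M[R]_(m, n)) : smooth_on U f -> smooth_on U g ->
  smooth_on U (fun p => f p - g p).
Proof. by move=> sf sg; apply: smoothD => //; exact: smoothNv. Qed.
Lemma smoothV (f : V -> R) : (forall p, U p -> f p != 0) -> smooth_on U f ->
  smooth_on U (fun p => (f p)^-1).
Proof. by move=> f0 sf k; exact: Ck_onV. Qed.
Lemma smooth_div (f g : V -> R) : (forall p, U p -> g p != 0) -> smooth_on U f ->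
  smooth_on U g -> smooth_on U (fun p => f p / g p).
Proof. by move=> f0 sf sg; apply: smoothM => //; exact: smoothV. Qed.
Lemma smoothX (f : V -> R) i : smooth_on U f -> smooth_on U (fun p => f p ^+ i).
Proof.
move=> sf; elim: i => [|i IH]; first exact: smooth_cst.
by apply: eq_smooth_on (smoothM sf IH) => p _; rewrite exprS.
Qed.
Lemma smooth_sum W (I : finType) (f : I -> V -> W) :
  (forall i, smooth_on U (f i)) -> smooth_on U (fun p => \sum_i f i p).
Proof. by move=> sf k; apply: Ck_on_sum => // i; exact: sf. Qed.
Lemma smooth_prod (I : finType) (f : I -> V -> R) :
  (forall i, smooth_on U (f i)) -> smooth_on U (fun p => \prod_i f i p).
Proof.
move=> sf; elim: (index_enum I) => [|i s IH].
  by apply: eq_smooth_on (smooth_cst U (1 : R)) => // p _; rewrite big_nil.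
by apply: eq_smooth_on (smoothM (sf i) IH) => // p _; rewrite big_cons.
Qed.
Lemma smooth_entry m n (f : V -> 'M[R]_(m, n)) i j : smooth_on U f ->
  smooth_on U (fun p => f p i j).
Proof. by move=> sf k; exact: Ck_on_entry. Qed.
Lemma smooth_mx m n (f : V -> 'M[R]_(m, n)) :
  (forall i j, smooth_on U (fun p => f p i j)) -> smooth_on U f.
Proof. by move=> sf k; apply: Ck_on_mx => // i j; exact: sf. Qed.
Lemma smooth_dot m (f g : V -> 'rV[R]_m) : smooth_on U f -> smooth_on U g ->
  smooth_on U (fun p => dot (f p) (g p)).
Proof.
move=> sf sg; apply: (eq_smooth_on (f := fun p => \sum_j f p 0 j * g p 0 j)).
  by move=> p _; rewrite /dot mxE; apply: eq_bigr => j _; rewrite mxE.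
by apply: smooth_sum => j; apply: smoothM; exact: smooth_entry.
Qed.
Lemma smooth_mulmx m n r (f : V -> 'M[R]_(m, n)) (g : V -> 'M[R]_(n, r)) :
  smooth_on U f -> smooth_on U g -> smooth_on U (fun p => f p *m g p).
Proof.
move=> sf sg; apply: smooth_mx => i j.
apply: (eq_smooth_on (f := fun p => \sum_k f p i k * g p k j)).
  by move=> p _; rewrite mxE.
by apply: smooth_sum => k; apply: smoothM; exact: smooth_entry.
Qed.
Lemma smooth_det n (f : V -> 'M[R]_n) : smooth_on U f -> smooth_on U (fun p => \det (f p)).
Proof.
move=> sf; apply: smooth_sum => s; apply: smoothM; first exact: smooth_cst.
by apply: smooth_prod => i; exact: smooth_entry.
Qed.
Lemma smooth_invmx n (f : V -> 'M[R]_n) : (forall p, U p -> f p \in unitmx) ->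
  smooth_on U f -> smooth_on U (fun p => invmx (f p)).
Proof.
move=> fu sf; apply: (eq_smooth_on (f := fun p => (\det (f p))^-1 *: \adj (f p))).
  by move=> p Up; rewrite /invmx fu.
apply: smoothZ.
  apply: smoothV; last exact: smooth_det.
  by move=> p /fu; rewrite unitmxE unitfE.
apply: smooth_mx => i j.
apply: (eq_smooth_on (f := fun p => (-1) ^+ (j + i) * \det (row' j (col' i (f p))))).
  by move=> p _; rewrite mxE.
apply: smoothM; first exact: smooth_cst.
apply: smooth_det; apply: smooth_mx => k l.
apply: (eq_smooth_on (f := fun p => f p (lift j k) (lift i l))); last exact: smooth_entry.
by move=> p _; rewrite !mxE.
Qed.
Lemma smooth_derive W (f : V -> W) v : smooth_on U f -> smooth_on U ('D_v f).
Proof. by move=> sf k; have [_ /(_ v)] := sf k.+1. Qed.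
Lemma smooth_differentiable W (f : V -> W) p : smooth_on U f -> U p -> differentiable f p.
Proof. by move=> sf; have [+ _] := sf 1%N; exact. Qed.
Lemma smooth_derivable W (f : V -> W) p v : smooth_on U f -> U p -> derivable f p v.
Proof. by move=> sf Up; apply: diff_derivable; exact: smooth_differentiable. Qed.
Lemma smooth_continuous W (f : V -> W) p : smooth_on U f -> U p -> {for p, continuous f}.
Proof. by move=> sf Up; exact: sf 0%N _ Up. Qed.

Lemma deriveD_on W (f g : V -> W) p v : smooth_on U f -> smooth_on U g -> U p ->
  'D_v (fun q => f q + g q) p = 'D_v f p + 'D_v g p.
Proof. by move=> sf sg Up; rewrite [LHS]deriveD //; exact: smooth_derivable. Qed.
Lemma deriveB_on W (f g : V -> W) p v : smooth_on U f -> smooth_on U g -> U p ->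
  'D_v (fun q => f q - g q) p = 'D_v f p - 'D_v g p.
Proof. by move=> sf sg Up; rewrite [LHS]deriveB //; exact: smooth_derivable. Qed.
Lemma deriveN_on W (f : V -> W) p v : smooth_on U f -> U p ->
  'D_v (fun q => - f q) p = - 'D_v f p.
Proof. by move=> sf Up; rewrite [LHS]deriveN //; exact: smooth_derivable. Qed.
Lemma deriveM_on (f g : V -> R) p v : smooth_on U f -> smooth_on U g -> U p ->
  'D_v (fun q => f q * g q) p = 'D_v f p * g p + f p * 'D_v g p.
Proof.
move=> sf sg Up; rewrite [LHS]deriveM; [|exact: smooth_derivable..].
by rewrite addrC; congr (_ + _); exact: mulrC.
Qed.
Lemma deriveZ_on m n (f : V -> R) (g : V -> 'M[R]_(m, n)) p v :
  smooth_on U f -> smooth_on U g -> U p ->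
  'D_v (fun q => f q *: g q) p = 'D_v f p *: g p + f p *: 'D_v g p.
Proof. by move=> sf sg Up; apply: is_derive_scale; exact: smooth_differentiable. Qed.
Lemma deriveV_on (f : V -> R) p v : smooth_on U f -> f p != 0 -> U p ->
  'D_v (fun q => (f q)^-1) p = - (f p ^- 2 * 'D_v f p).
Proof.
by move=> sf f0 Up; rewrite [LHS]deriveV //; [rewrite scaleNr|exact: smooth_derivable].
Qed.
Lemma derive_dot_on m (f g : V -> 'rV[R]_m) p v :
  smooth_on U f -> smooth_on U g -> U p ->
  'D_v (fun q => dot (f q) (g q)) p = dot ('D_v f p) (g p) + dot (f p) ('D_v g p).
Proof.
move=> sf sg Up; have E q : dot (f q) (g q) = \sum_j f q 0 j * g q 0 j.
  by rewrite /dot mxE; apply: eq_bigr => j _; rewrite mxE.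
rewrite (_ : (fun q => _) = \sum_j (fun q => f q 0 j * g q 0 j)); last first.
  by apply/funext => q; rewrite E fct_sumE.
rewrite derive_sum; last first.
  by move=> j; apply: smooth_derivable Up; apply: smoothM; exact: smooth_entry.
rewrite /dot !mxE -big_split; apply: eq_bigr => j _ /=.
rewrite deriveM_on //; [|exact: smooth_entry..].
by rewrite !mxE !derive_entry //; exact: smooth_differentiable.
Qed.

Lemma Schwarz_real (f : V -> R) p v w : smooth_on U f -> U p ->
  'D_w ('D_v f) p = 'D_v ('D_w f) p.
Proof. by move=> sf Up; exact: Schwarz_scalar (sf 2). Qed.

Lemma Schwarz_mx m n (f : V -> 'M[R]_(m, n)) p v w : smooth_on U f -> U p ->
  'D_w ('D_v f) p = 'D_v ('D_w f) p.
Proof.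
move=> sf Up; apply/matrixP => i j.
have sd u q : U q -> 'D_u (fun q => f q i j) q = ('D_u f q) i j.
  by move=> Uq; apply: derive_entry; exact: smooth_differentiable.
have sdd u u' : ('D_u ('D_u' f) p) i j = 'D_u ('D_u' (fun q => f q i j)) p.
  rewrite (eq_on_derive u oU Up (sd u')) derive_entry //.
  by apply: smooth_differentiable Up; exact: smooth_derive.
apply: etrans (sdd w v) (etrans _ (esym (sdd v w))).
exact: (Schwarz_real v w (smooth_entry i j sf) Up).
Qed.

Lemma smooth_real_comp (U' : set R) (f : V -> R) (g : R -> R) :
  (forall p, U p -> U' (f p)) -> smooth_on U f -> smooth_on U' g ->
  smooth_on U (fun p => g (f p)).
Proof. by move=> fU sf sg k; exact: (Ck_on_real_comp oU fU (sf k) (sg k)). Qed.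
Lemma smooth_rV_comp m n (U' : set 'rV[R]_m) (f : V -> 'rV[R]_m) (g : 'rV[R]_m -> 'rV[R]_n) :
  (forall p, U p -> U' (f p)) -> smooth_on U f -> smooth_on U' g ->
  smooth_on U (fun p => g (f p)).
Proof. by move=> fU sf sg k; exact: (Ck_on_rV_comp oU fU (sf k) (sg k)). Qed.
Lemma smooth_rV_comp_real m (U' : set 'rV[R]_m) (f : V -> 'rV[R]_m) (g : 'rV[R]_m -> R) :
  (forall p, U p -> U' (f p)) -> smooth_on U f -> smooth_on U' g ->
  smooth_on U (fun p => g (f p)).
Proof. by move=> fU sf sg k; exact: (Ck_on_rV_comp_scalar oU fU (sf k) (sg k)). Qed.
End OnOpen.

Lemma smooth_on_subset V W (U U' : set V) (f : V -> W) :
  U `<=` U' -> smooth_on U' f -> smooth_on U f.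
Proof. by move=> UU' sf k; exact: (Ck_on_subset UU' (sf k)). Qed.

Lemma smooth_on_local V W (U : set V) (f : V -> W) :
  (forall p, U p -> exists2 U' : set V, U' p & smooth_on U' f) -> smooth_on U f.
Proof. by move=> lf k; apply: Ck_on_local => p /lf[U' U'p sf]; exists U'. Qed.

Lemma smooth_id m (U : set 'rV[R]_m) : smooth_on U id.
Proof.
move=> [|k]; first by move=> p _; exact: cvg_id.
split=> // v; rewrite (_ : 'D_v id = fun=> v); first exact: Ck_on_cst.
by apply/funext => p; rewrite derive_id.
Qed.

Lemma smooth_idR (U : set R) : smooth_on U id.
Proof.
move=> [|k]; first by move=> p _; exact: cvg_id.
split=> // v; rewrite (_ : 'D_v id = fun=> v); first exact: Ck_on_cst.
by apply/funext => p; rewrite derive_id.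
Qed.

End SmoothFunctions.

(** * Euclidean vectors and Gronwall's inequality *)

Section DotAlgebra.
Variables (R : realType) (m : nat).
Implicit Types u v w : 'rV[R]_m.

Lemma dotE u v : dot u v = \sum_j u 0 j * v 0 j.
Proof. by rewrite /dot mxE; apply: eq_bigr => j _; rewrite mxE. Qed.
Lemma dotC u v : dot u v = dot v u.
Proof. by rewrite !dotE; apply: eq_bigr => j _; rewrite mulrC. Qed.
Lemma dotDl u v w : dot (u + v) w = dot u w + dot v w.
Proof. by rewrite /dot mulmxDl mxE. Qed.
Lemma dotDr u v w : dot w (u + v) = dot w u + dot w v.
Proof. by rewrite dotC dotDl !(dotC w). Qed.
Lemma dotZl a u w : dot (a *: u) w = a * dot u w.
Proof. by rewrite /dot -scalemxAl mxE. Qed.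
Lemma dotZr a u w : dot w (a *: u) = a * dot w u.
Proof. by rewrite dotC dotZl dotC. Qed.
Lemma dotNl u w : dot (- u) w = - dot u w.
Proof. by rewrite -scaleN1r dotZl mulN1r. Qed.
Lemma dotNr u w : dot w (- u) = - dot w u.
Proof. by rewrite dotC dotNl dotC. Qed.
Lemma dot0l w : dot 0 w = 0.
Proof. by rewrite /dot mul0mx mxE. Qed.
Lemma dot0r w : dot w 0 = 0.
Proof. by rewrite dotC dot0l. Qed.
Lemma dot_ge0 u : 0 <= dot u u.
Proof. by rewrite dotE; apply: sumr_ge0 => j _; rewrite -expr2 sqr_ge0. Qed.
Lemma dot_eq0 u : (dot u u == 0) = (u == 0).
Proof.
apply/idP/eqP => [|->]; last by rewrite dot0l.
rewrite dotE psumr_eq0 => [/allP u0|j _]; last by rewrite -expr2 sqr_ge0.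
apply/rowP => j; rewrite mxE; apply/eqP.
by have := u0 j; rewrite mem_index_enum => /(_ isT); rewrite -expr2 sqrf_eq0.
Qed.
Lemma dot_gt0 u : u != 0 -> 0 < dot u u.
Proof. by move=> u0; rewrite lt_def dot_eq0 u0 dot_ge0. Qed.
Lemma dot_comb s t u v w : dot w (s *: u + t *: v) = s * dot w u + t * dot w v.
Proof. by rewrite dotDr !dotZr. Qed.
Lemma dot_comb2 s t u v : dot (s *: u + t *: v) (s *: u + t *: v) =
  s * s * dot u u + 2 * s * t * dot u v + t * t * dot v v.
Proof. by rewrite dot_comb !dotDl !dotZl (dotC v u); ring. Qed.
Lemma dot_comb3 t i s r u v z w : dot w (t *: u - i *: (s *: v - r *: z)) =
  t * dot w u - i * (s * dot w v - r * dot w z).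
Proof. by rewrite !(dotDr, dotNr, dotZr). Qed.
Definition dotD := (dotDl, dotDr, dotZl, dotZr, dotNl, dotNr, dot0l, dot0r).
End DotAlgebra.

(** The matrix with rows u, v, w is invertible, because its Gram matrix is
    diagonal with nonzero entries. *)
Lemma ortho3_eq0 (R : realType) (u v w z : 'rV[R]_3) :
  u != 0 -> v != 0 -> w != 0 -> dot u v = 0 -> dot u w = 0 -> dot v w = 0 ->
  dot z u = 0 -> dot z v = 0 -> dot z w = 0 -> z = 0.
Proof.
move=> u0 v0 w0 uv uw vw zu zv zw.
pose r (i : 'I_3) := [:: u; v; w]`_i.
pose M : 'M[R]_3 := \matrix_i r i.
have rd (i j : 'I_3) : dot (r i) (r j) = dot (r i) (r i) *+ (i == j).
  by case: i j => [[|[|[]]] // ?] [[|[|[]]] // ?]; rewrite /r /= ?mulr1n ?mulr0n // dotC.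
have MM : M *m M^T = diag_mx (\row_i dot (r i) (r i)).
  apply/matrixP => i j; rewrite !mxE -rd dotE; apply: eq_bigr => k _.
  by rewrite !mxE.
have Mu : M^T \in unitmx.
  rewrite unitmx_tr; have : M *m M^T \in unitmx.
    rewrite MM unitmxE det_diag unitfE; apply/prodf_neq0 => i _.
    by rewrite mxE dot_eq0; case: i => [[|[|[]]] // ?]; rewrite /r.
  by rewrite unitmx_mul => /andP[].
have zM : z *m M^T = 0.
  apply/rowP => i; rewrite !mxE; transitivity (dot z (r i)).
    by rewrite dotE; apply: eq_bigr => k _; rewrite !mxE.
  by case: i => [[|[|[]]] // ?]; rewrite /r.
by rewrite -[z](mulmxK Mu) zM mul0mx.
Qed.

Lemma ortho3_decomp (R : realType) (u v w z : 'rV[R]_3) :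
  u != 0 -> v != 0 -> w != 0 -> dot u v = 0 -> dot u w = 0 -> dot v w = 0 ->
  z = (dot z u / dot u u) *: u + (dot z v / dot v v) *: v + (dot z w / dot w w) *: w.
Proof.
move=> u0 v0 w0 uv uw vw; apply/eqP; rewrite -subr_eq0; apply/eqP.
have vu : dot v u = 0 by rewrite dotC.
have wu : dot w u = 0 by rewrite dotC.
have wv : dot w v = 0 by rewrite dotC.
apply: (ortho3_eq0 u0 v0 w0) => //; rewrite !dotD ?uv ?uw ?vw ?vu ?wu ?wv !mulr0 ?addr0 ?add0r.
- by rewrite divfK ?subrr // dot_eq0.
- by rewrite divfK ?subrr // dot_eq0.
- by rewrite divfK ?subrr // dot_eq0.
Qed.

Section Gronwall.
Variable R : realType.

Lemma continuous_within_itv (f : R -> R) (a b : R) :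
  (forall s, a <= s <= b -> {for s, continuous f}) -> {within `[a, b], continuous f}.
Proof.
move=> cf; apply: continuous_in_subspaceT => s; rewrite inE /= in_itv /=; exact: cf.
Qed.

(** If M is the maximum of m on the segment, E (q + s v) exp (- M s) is
    nonincreasing in s. *)
Lemma Gronwall_line (V : normedModType R) (E m : V -> R) q v (h : R) : 0 <= h ->
  (forall s, 0 <= s <= h -> [/\ differentiable E (q + s *: v),
     {for q + s *: v, continuous m}, 0 <= E (q + s *: v) &
     'D_v E (q + s *: v) <= m (q + s *: v) * E (q + s *: v)]) ->
  E q = 0 -> E (q + h *: v) = 0.
Proof.
rewrite le_eqVlt => /predU1P[<- _|h0 HE Eq0]; first by rewrite scale0r addr0.
have cm : {within `[0, h], continuous (fun s => m (q + s *: v))}.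
  apply: continuous_within_itv => s /HE[_ cm _ _].
  apply: (@continuous_comp R V R (fun s => q + s *: v) m) => //.
  by apply: cvgD; [exact: cvg_cst|apply: cvgZl; exact: cvg_id].
have [c _ cM] := EVT_max (ltW h0) cm.
set M := m (q + c *: v) in cM.
pose g s := E (q + s *: v) * expR (- M * s).
have dg s : 0 <= s <= h -> is_derive s 1 g ('D_v E (q + s *: v) * expR (- M * s)
   + E (q + s *: v) * (- M * expR (- M * s))).
  move=> sh; have [dE _ _ _] := HE s sh.
  have d1 := is_derive_line dE.
  have d2 : is_derive s 1 (fun s => expR (- M * s)) (- M * expR (- M * s)).
    have dl : is_derive s 1 (fun s : R => - M * s) (- M).
      by apply: is_derive_eq (is_deriveZ (- M) (is_derive_id s 1)) _; exact: mulr1.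
    by apply: is_derive_eq (is_derive1_comp (is_derive_expR _) dl) _; rewrite mulrC.
  apply: is_derive_eq (is_deriveM d1 d2) _.
  by rewrite addrC; congr (_ + _); exact: mulrC.
have cg : {within `[0, h], continuous g}.
  apply: derivable_within_continuous => s; rewrite in_itv /= => sh.
  by have [] := dg s sh.
have dg' s : s \in `]0, h[%R -> is_derive s 1 g ('D_v E (q + s *: v) * expR (- M * s)
   + E (q + s *: v) * (- M * expR (- M * s))).
  by rewrite in_itv /= => /andP[s0 sh]; apply: dg; rewrite !ltW.
have [d dI] := MVT h0 dg' cg.
rewrite {1 2}/g scale0r addr0 Eq0 mul0r !subr0.
have dh : 0 <= d <= h by move: dI; rewrite in_itv /= => /andP[? ?]; rewrite !ltW.
have [_ _ Ed DEd] := HE d dh.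
have hh : 0 <= h <= h by rewrite lexx ltW.
have [_ _ Eh _] := HE h hh.
have dM : m (q + d *: v) <= M by apply: cM; rewrite in_itv.
set e := expR (- M * d) => Eq.
have e0 : 0 <= e by exact: expR_ge0.
have le0 : E (q + h *: v) * expR (- M * h) <= 0.
  rewrite Eq pmulr_lle0 //; move: DEd Ed dM; set A := 'D_v E _; set B := E _ => DEd Ed dM.
  have -> : A * e + B * (- M * e) = (A - M * B) * e by rewrite mulrBl mulrCA !mulNr !mulrA.
  by rewrite mulr_le0_ge0 // subr_le0 (le_trans DEd) // ler_wpM2r.
apply/le_anti; rewrite Eh andbT.
by move: le0; rewrite pmulr_lle0 // expR_gt0.
Qed.
End Gronwall.

(** A smooth majorant of the absolute value, to serve as the rate in Gronwall's
    inequality. *)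
Lemma norm_le_1sqr (R : realDomainType) (p : R) : `|p| <= 1 + p * p.
Proof.
rewrite -expr2 -real_normK ?num_real //; have := normr_ge0 p.
set y := `|p|; move=> y0; have := sqr_ge0 (y - 1); nra.
Qed.

(** * Functions on a box *)

Section Box.
Variable R : realType.
Definition dir1 : 'rV[R]_2 := delta_mx 0 0.
Local Notation d2 := (dir2 R).

Lemma dir2E (q : 'rV[R]_2) s : ((q + s *: d2) 0 0 = q 0 0) * ((q + s *: d2) 0 1 = q 0 1 + s).
Proof. by split; rewrite !mxE /= ?mulr1 ?mulr0 ?addr0. Qed.

Lemma rV2P (q q' : 'rV[R]_2) : q 0 0 = q' 0 0 -> q 0 1 = q' 0 1 -> q = q'.
Proof.
move=> e0 e1; apply/rowP => j; case: j => [[|[|//]] p].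
  by rewrite (_ : Ordinal p = 0) //; exact: val_inj.
by rewrite (_ : Ordinal p = 1) //; exact: val_inj.
Qed.

Lemma rV2_decomp (v : 'rV[R]_2) : v = v 0 0 *: dir1 + v 0 1 *: d2.
Proof. by apply: rV2P; rewrite !mxE /= !mulr1 !mulr0 ?addr0 ?add0r. Qed.

Lemma derive_vline (W : normedModType R) (U : set 'rV[R]_2) (f : 'rV[R]_2 -> W) (c : W) q : open U -> U q ->
  differentiable f q ->
  (forall q', U q' -> q' 0 0 = q 0 0 -> f q' = c) -> 'D_d2 f q = 0.
Proof.
move=> oU Uq df fc; have df0 : differentiable f (q + 0 *: d2) by rewrite scale0r addr0.
have [_ E] := differentiable_line df0; move: E; rewrite scale0r addr0 => <-.
rewrite -(derive_cst c (0 : R) (1 : R)); apply: near_eq_derive.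
have cl : (fun t : R => q + t *: d2) @ (0 : R) --> q.
  rewrite -[X in _ --> X](addr0 q) -(scale0r d2).
  by apply: cvgD; [exact: cvg_cst|apply: cvgZl; exact: cvg_id].
have : \forall t \near (0 : R), U (q + t *: d2) by exact: (cl _ (open_near oU Uq)).
by apply: filterS => t Ut; rewrite /cst fc // dir2E.
Qed.

Variables I J : set R.
Hypotheses (oI : open_interval I) (oJ : open_interval J).
Definition box : set 'rV[R]_2 := [set q | I (q 0 0) /\ J (q 0 1)].

Lemma box_open : open box.
Proof.
have [oI' _] := oI; have [oJ' _] := oJ.
have -> : box = ((fun q : 'rV[R]_2 => q 0 0) @^-1` I) `&` ((fun q : 'rV[R]_2 => q 0 1) @^-1` J) by [].
apply: openI; apply: open_comp => // q _; exact: coord_continuous.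
Qed.

Lemma interval_convex (K : set R) a b' s : is_interval K -> K a -> K b' -> 0 <= s <= 1 ->
  K (a + s * (b' - a)).
Proof.
move=> iK Ka Kb /andP[s0 s1]; have [ab|/ltW ba] := leP a b'.
  by apply: (iK a b' Ka Kb); apply/andP; split; nra.
by apply: (iK b' a Kb Ka); apply/andP; split; nra.
Qed.

Lemma box_convex q q' s : box q -> box q' -> 0 <= s <= 1 -> box (q + s *: (q' - q)).
Proof.
move=> [q0 q1] [q0' q1'] s01; split; rewrite !mxE; apply: interval_convex => //.
  by have [] := oI.
by have [] := oJ.
Qed.

Lemma derive_rV2 (f : 'rV[R]_2 -> R) p v : differentiable f p ->
  'D_v f p = v 0 0 * 'D_dir1 f p + v 0 1 * 'D_d2 f p.
Proof. by move=> df; rewrite {1}[v]rV2_decomp !(deriveE _ df) linearD !linearZ. Qed.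

(** On the segment from q0 to q, the derivative of E is a fixed multiple of the
    one in direction dir1, so Gronwall's inequality applies. *)
Lemma Gronwall_box (E m : 'rV[R]_2 -> R) q0 : smooth_on box E ->
  (forall q, box q -> {for q, continuous m}) ->
  (forall q, box q -> 0 <= E q) ->
  (forall q, box q -> `|'D_dir1 E q| <= m q * E q) ->
  (forall q, box q -> 'D_d2 E q = 0) ->
  box q0 -> E q0 = 0 -> forall q, box q -> E q = 0.
Proof.
move=> sE cm E0 d1E d2E b0 Eq0 q bq; pose v := q - q0.
have -> : q = q0 + 1 *: v by rewrite scale1r subrKC.
apply: (Gronwall_line (m := fun p => `|v 0 0| * m p)) => // s s01.
have bs := box_convex b0 bq s01; have dE := smooth_differentiable sE bs; split=> //.
- exact: (cvgM (@cvg_cst _ _ _ _ _) (cm _ bs)).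
- exact: E0.
- rewrite (derive_rV2 _ dE) d2E // mulr0 addr0 (le_trans (ler_norm _)) // normrM -mulrA.
  by rewrite ler_wpM2l // d1E.
Qed.

(** The mean value theorem on the segment from q0 to q. *)
Lemma box_MVT (f : 'rV[R]_2 -> R) q0 q : smooth_on box f -> box q0 -> box q ->
  exists2 s, box (q0 + s *: (q - q0)) &
    let p := q0 + s *: (q - q0) in
    f q - f q0 = (q - q0) 0 0 * 'D_dir1 f p + (q - q0) 0 1 * 'D_d2 f p.
Proof.
move=> sf b0 bq; have bs s (s01 : 0 <= s <= 1) := box_convex b0 bq s01.
have [s /andP[s0 s1]] := MVT_line ltr01 (fun s s01 => smooth_differentiable sf (bs s s01)).
have b1 : box (q0 + s *: (q - q0)) by apply: bs; rewrite !ltW.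
rewrite scale1r subrKC mulr1 => e; exists s => //=.
by rewrite e (derive_rV2 _ (smooth_differentiable sf b1)).
Qed.

Lemma box_const_rV m (f : 'rV[R]_2 -> 'rV[R]_m) q0 : smooth_on box f ->
  (forall q, box q -> 'D_dir1 f q = 0) -> (forall q, box q -> 'D_d2 f q = 0) ->
  box q0 -> forall q, box q -> f q = f q0.
Proof.
move=> sf d1f d2f b0 q bq; apply/rowP => j.
have [s bs /= e] := box_MVT (smooth_entry box_open 0 j sf) b0 bq.
apply/eqP; rewrite -subr_eq0 e !(derive_entry _ _ _ (smooth_differentiable sf bs)).
by rewrite d1f // d2f // !mxE !mulr0 addr0.
Qed.

Lemma box_vconst (f : 'rV[R]_2 -> R) q0 q : smooth_on box f ->
  box q0 -> box q -> q 0 0 = q0 0 0 ->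
  (forall p, box p -> p 0 0 = q0 0 0 -> 'D_d2 f p = 0) -> f q = f q0.
Proof.
move=> sf b0 bq e00 Df; have [s bs /= e] := box_MVT sf b0 bq.
have v0 : (q - q0) 0 0 = 0 by rewrite !mxE e00 subrr.
apply/eqP; rewrite -subr_eq0 e v0 mul0r add0r Df ?mulr0 //.
by rewrite !mxE e00 subrr mulr0 addr0.
Qed.
End Box.

(** * Rules for partial derivatives in the plane *)

(** The derivative is sealed, once for vector-valued and once for real-valued
    functions, so that terms involving it are compared by their arguments only. *)
HB.lock Definition pd (R : realType) (v : 'rV[R]_2) m (f : 'rV[R]_2 -> 'rV[R]_m) (q : 'rV[R]_2) : 'rV[R]_m := 'D_v f q.
HB.lock Definition sd (R : realType) (v : 'rV[R]_2) (f : 'rV[R]_2 -> R) (q : 'rV[R]_2) : R := 'D_v f q.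

Section PlaneDerivatives.
Variable R : realType.
Implicit Types (U : set 'rV[R]_2) (v q : 'rV[R]_2).

Section Rules.
Variables (U : set 'rV[R]_2) (m : nat).
Hypothesis oU : open U.
Implicit Types (f g : 'rV[R]_2 -> 'rV[R]_m) (s t : 'rV[R]_2 -> R).

Lemma smooth_pd v f : smooth_on U f -> smooth_on U (pd v f).
Proof. rewrite ?pd.unlock ?sd.unlock; exact: smooth_derive. Qed.
Lemma smooth_sd v s : smooth_on U s -> smooth_on U (sd v s).
Proof. rewrite ?pd.unlock ?sd.unlock; exact: smooth_derive. Qed.
Lemma sdE v s q : sd v s q = 'D_v s q.
Proof. by rewrite sd.unlock. Qed.
Lemma pdE v f q : pd v f q = 'D_v f q.
Proof. by rewrite pd.unlock. Qed.
Lemma pd_eq v f g q : U q -> (forall p, U p -> f p = g p) -> pd v f q = pd v g q.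
Proof. rewrite ?pd.unlock ?sd.unlock; exact: eq_on_derive. Qed.
Lemma sd_eq v s t q : U q -> (forall p, U p -> s p = t p) -> sd v s q = sd v t q.
Proof. rewrite ?pd.unlock ?sd.unlock; exact: eq_on_derive. Qed.
Lemma pd_cst v (w : 'rV[R]_m) q : pd v (fun=> w) q = 0.
Proof. rewrite ?pd.unlock ?sd.unlock; exact: derive_cst. Qed.
Lemma sd_cst v (w : R) q : sd v (fun=> w) q = 0.
Proof. rewrite ?pd.unlock ?sd.unlock; exact: derive_cst. Qed.
Lemma sd_eq0 v s q : U q -> (forall p, U p -> s p = 0) -> sd v s q = 0.
Proof. by move=> Uq f0; rewrite (sd_eq v Uq f0) sd_cst. Qed.
Lemma pdD v f g q : smooth_on U f -> smooth_on U g -> U q ->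
  pd v (fun p => f p + g p) q = pd v f q + pd v g q.
Proof. rewrite ?pd.unlock ?sd.unlock; exact: deriveD_on. Qed.
Lemma pdB v f g q : smooth_on U f -> smooth_on U g -> U q ->
  pd v (fun p => f p - g p) q = pd v f q - pd v g q.
Proof. rewrite ?pd.unlock ?sd.unlock; exact: deriveB_on. Qed.
Lemma pdN v f q : smooth_on U f -> U q -> pd v (fun p => - f p) q = - pd v f q.
Proof. rewrite ?pd.unlock ?sd.unlock; exact: deriveN_on. Qed.
Lemma pdZ v s f q : smooth_on U s -> smooth_on U f -> U q ->
  pd v (fun p => s p *: f p) q = sd v s q *: f q + s q *: pd v f q.
Proof. rewrite ?pd.unlock ?sd.unlock; exact: deriveZ_on. Qed.
Lemma pdZc v (s : R) f q : smooth_on U f -> U q ->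
  pd v (fun p => s *: f p) q = s *: pd v f q.
Proof. by move=> sf Uq; rewrite (pdZ v (smooth_cst U s) sf Uq) sd_cst scale0r add0r. Qed.
Lemma sdD v s t q : smooth_on U s -> smooth_on U t -> U q ->
  sd v (fun p => s p + t p) q = sd v s q + sd v t q.
Proof. rewrite ?pd.unlock ?sd.unlock; exact: deriveD_on. Qed.
Lemma sdN v s q : smooth_on U s -> U q -> sd v (fun p => - s p) q = - sd v s q.
Proof. rewrite ?pd.unlock ?sd.unlock; exact: deriveN_on. Qed.
Lemma sdM v s t q : smooth_on U s -> smooth_on U t -> U q ->
  sd v (fun p => s p * t p) q = sd v s q * t q + s q * sd v t q.
Proof. rewrite ?pd.unlock ?sd.unlock; exact: deriveM_on. Qed.
Lemma sdMc v (s : R) t q : smooth_on U t -> U q ->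
  sd v (fun p => s * t p) q = s * sd v t q.
Proof. by move=> sf Uq; rewrite (sdM v (smooth_cst U s) sf Uq) sd_cst mul0r add0r. Qed.
Lemma sdV v s q : smooth_on U s -> s q != 0 -> U q ->
  sd v (fun p => (s p)^-1) q = - (s q ^- 2 * sd v s q).
Proof. rewrite ?pd.unlock ?sd.unlock; exact: deriveV_on. Qed.
Lemma sd_dot v f g q : smooth_on U f -> smooth_on U g -> U q ->
  sd v (fun p => dot (f p) (g p)) q = dot (pd v f q) (g q) + dot (f q) (pd v g q).
Proof. rewrite ?pd.unlock ?sd.unlock; exact: derive_dot_on. Qed.
Lemma sd_dotc v f (w : 'rV[R]_m) q : smooth_on U f -> U q ->
  sd v (fun p => dot (f p) w) q = dot (pd v f q) w.
Proof. by move=> sf Uq; rewrite (sd_dot v sf (smooth_cst U w) Uq) pd_cst dot0r addr0. Qed.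
Lemma pd_comm v w f q : smooth_on U f -> U q -> pd w (pd v f) q = pd v (pd w f) q.
Proof. rewrite ?pd.unlock ?sd.unlock; exact: Schwarz_mx. Qed.
Lemma sd_comm v w s q : smooth_on U s -> U q -> sd w (sd v s) q = sd v (sd w s) q.
Proof. rewrite ?pd.unlock ?sd.unlock; exact: Schwarz_real. Qed.
Lemma pd_vline f w q : smooth_on U f -> U q ->
  (forall q', U q' -> q' 0 0 = q 0 0 -> f q' = w) -> pd (dir2 R) f q = 0.
Proof. rewrite ?pd.unlock ?sd.unlock; by move=> sf Uq; exact: derive_vline (smooth_differentiable sf Uq). Qed.
Lemma sd_vline s w q : smooth_on U s -> U q ->
  (forall q', U q' -> q' 0 0 = q 0 0 -> s q' = w) -> sd (dir2 R) s q = 0.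
Proof. rewrite ?pd.unlock ?sd.unlock; by move=> sf Uq; exact: derive_vline (smooth_differentiable sf Uq). Qed.
Lemma pd_entry v f j q : smooth_on U f -> U q ->
  sd v (fun p => f p 0 j) q = pd v f q 0 j.
Proof. rewrite ?pd.unlock ?sd.unlock; by move=> sf Uq; exact: derive_entry (smooth_differentiable sf Uq). Qed.
Lemma pd_lin v w (h : R) f q : smooth_on U f -> U q ->
  pd (v - h *: w) f q = pd v f q - h *: pd w f q.
Proof.
move=> sf Uq; have df := smooth_differentiable sf Uq.
by rewrite pd.unlock !(deriveE _ df) linearB linearZ.
Qed.
Lemma sd_lin v w (h : R) s q : smooth_on U s -> U q ->
  sd (v - h *: w) s q = sd v s q - h * sd w s q.
Proof.
move=> sf Uq; have df := smooth_differentiable sf Uq.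
by rewrite sd.unlock !(deriveE _ df) linearB linearZ.
Qed.
End Rules.
End PlaneDerivatives.

(** * Local geometry of channel linear Weingarten surfaces *)

(** A piece of a channel surface in coordinates (u, v) whose v-lines are the
    circles. The names w1 and w2 hide which vectors the coordinate directions
    are, so that simplification leaves the derivatives alone. *)
Section LocalChannel.
Variables (R : realType) (I J : set R).
Hypotheses (oI : open_interval I) (oJ : open_interval J).
Local Notation U := (box I J).
Variables (w1 w2 : 'rV[R]_2).
Hypotheses (w1E : w1 = dir1 R) (w2E : w2 = dir2 R).
Local Notation D1 f := (pd w1 f).
Local Notation d1 f := (sd w1 f).
Local Notation d2 f := (sd w2 f).
Local Notation D2 f := (pd w2 f).
Variables (x n : 'rV[R]_2 -> 'rV[R]_3) (k k1 : 'rV[R]_2 -> R) (a b c : R).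
Hypotheses (sx : smooth_on U x) (sn : smooth_on U n).
Hypothesis nn : forall q, U q -> dot (n q) (n q) = 1.
Hypothesis x1n : forall q, U q -> dot (D1 x q) (n q) = 0.
Hypothesis x2n : forall q, U q -> dot (D2 x q) (n q) = 0.
Hypothesis imm : forall q, U q -> forall s t, s *: D1 x q + t *: D2 x q = 0 -> s = 0 /\ t = 0.
Hypothesis circ : forall q, U q -> exists o m rho, [/\ m != 0, (0 : R) < rho &
  forall q', U q' -> q' 0 0 = q 0 0 ->
    dot (x q' - o) (x q' - o) = rho ^+ 2 /\ dot (x q' - o) m = 0].
Hypothesis n2E : forall q, U q -> D2 n q = - k q *: D2 x q.
Hypothesis n1E : forall q, U q -> exists mu, D1 n q = - (k1 q *: D1 x q + mu *: D2 x q).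
Hypothesis lw : forall q, U q -> a * (k q * k1 q) + b * (k q + k1 q) + c = 0.
Hypothesis disc : b ^+ 2 - a * c != 0.

Let oU : open U := box_open oI oJ.

Lemma n_neq0 q : U q -> n q != 0.
Proof. by move=> Uq; rewrite -dot_eq0 nn // oner_neq0. Qed.

Lemma x2_neq0 q : U q -> D2 x q != 0.
Proof.
move=> Uq; apply/eqP => x20; have [] := imm Uq (s := 0) (t := 1).
  by rewrite x20 scale0r scaler0 addr0.
by move=> _ /eqP; rewrite oner_eq0.
Qed.

(** With E, F, G the coefficients of the first fundamental form, ph is F / G, so
    that X is the part of x_u orthogonal to the circles. *)
Definition G q := dot (D2 x q) (D2 x q).
Definition ph q := dot (D1 x q) (D2 x q) / G q.
Definition X q := D1 x q - ph q *: D2 x q.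

Lemma G_neq0 q : U q -> G q != 0.
Proof. by move=> Uq; rewrite dot_eq0 x2_neq0. Qed.
Lemma dotX2 q : U q -> dot (X q) (D2 x q) = 0.
Proof. by move=> Uq; rewrite !dotD divfK ?subrr // G_neq0. Qed.
Lemma dotXn q : U q -> dot (X q) (n q) = 0.
Proof.
move=> Uq; have e1 := x1n Uq; have e2 := x2n Uq.
by rewrite /X !dotD e1 e2 mulr0 subr0.
Qed.
Lemma X_neq0 q : U q -> X q != 0.
Proof.
move=> Uq; apply/eqP => X0; have [] := imm Uq (s := 1) (t := - ph q).
  by rewrite scale1r scaleNr; exact: X0.
by move=> /eqP; rewrite oner_eq0.
Qed.

Lemma sx1 : smooth_on U (D1 x). Proof. exact: smooth_pd. Qed.
Lemma sx2 : smooth_on U (D2 x). Proof. exact: smooth_pd. Qed.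
Lemma sn2 : smooth_on U (D2 n). Proof. exact: smooth_pd. Qed.
Lemma sG : smooth_on U G. Proof. exact: (smooth_dot oU sx2 sx2). Qed.
Lemma sph : smooth_on U ph.
Proof. exact: (smooth_div oU G_neq0 (smooth_dot oU sx1 sx2) sG). Qed.
Lemma sX : smooth_on U X.
Proof. exact: (smoothBv oU sx1 (smoothZ oU sph sx2)). Qed.
Lemma sk : smooth_on U k.
Proof.
apply: (eq_smooth_on oU (f := fun q => - (dot (D2 n q) (D2 x q) / G q))) => [q Uq|].
  by rewrite n2E // dotZl mulNr mulNr opprK mulfK // G_neq0.
apply: (smoothN oU); exact: (smooth_div oU G_neq0 (smooth_dot oU sn2 sx2) sG).
Qed.

Definition vconst T (f : 'rV[R]_2 -> T) := forall q q', U q -> U q' -> q 0 0 = q' 0 0 -> f q = f q'.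

Lemma vconst_d2 (f : 'rV[R]_2 -> R) q : smooth_on U f -> vconst f -> U q -> d2 f q = 0.
Proof.
move=> sf cf Uq; rewrite w2E; apply: (sd_vline oU (w := f q) sf Uq) => q' Uq' e; exact: cf.
Qed.
Lemma vconst_D2 m (f : 'rV[R]_2 -> 'rV[R]_m) q : smooth_on U f -> vconst f -> U q -> D2 f q = 0.
Proof.
move=> sf cf Uq; rewrite w2E; apply: (pd_vline oU (w := f q) sf Uq) => q' Uq' e; exact: cf.
Qed.
Lemma vline_const (f : 'rV[R]_2 -> R) q0 q : smooth_on U f -> U q0 -> U q ->
  q 0 0 = q0 0 0 -> (forall p, U p -> p 0 0 = q0 0 0 -> d2 f p = 0) -> f q = f q0.
Proof. by rewrite w2E sd.unlock; exact: (box_vconst oI oJ). Qed.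
Lemma d2_vconst (f : 'rV[R]_2 -> R) :
  smooth_on U f -> (forall q, U q -> d2 f q = 0) -> vconst f.
Proof.
move=> sf f0 q q' Uq Uq' e; apply: (vline_const sf Uq' Uq e) => p Up _.
exact: f0.
Qed.
Lemma D2_vconst m (f : 'rV[R]_2 -> 'rV[R]_m) :
  smooth_on U f -> (forall q, U q -> D2 f q = 0) -> vconst f.
Proof.
move=> sf f0 q q' Uq Uq' e; apply/rowP => j.
have sfj := smooth_entry oU 0 j sf.
apply: (d2_vconst sfj) => // p Up.
by rewrite (pd_entry _ _ sf Up) f0 // mxE.
Qed.

(** Joachimsthal's theorem. Since n_v = - k x_v is tangent to the circle, both
    <n, x - ctr> and <n, m> are constant along it. So n is a combination of
    x - ctr and m with constant coefficients, and its derivative shows k = - al. *)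
Lemma circle_frame q : U q -> exists ctr m rho al be, [/\ m != 0, 0 < rho &
  forall p, U p -> p 0 0 = q 0 0 -> [/\ dot (x p - ctr) (x p - ctr) = rho ^+ 2,
    dot (x p - ctr) m = 0, dot (D2 x p) (x p - ctr) = 0, dot (D2 x p) m = 0 &
    n p = al *: (x p - ctr) + be *: m /\ k p = - al]].
Proof.
move=> Uq; have [ctr [m [rho [m0 rho0 C]]]] := circ Uq.
have sc : smooth_on U (fun=> ctr) := smooth_cst U ctr.
have sxo : smooth_on U (fun q => x q - ctr) by exact: (smoothBv oU sx sc).
have Dxo v p : U p -> pd v (fun q => x q - ctr) p = pd v x p.
  by move=> Up; rewrite (pdB v sx sc Up) pd_cst subr0.
have line1 p : U p -> p 0 0 = q 0 0 -> dot (D2 x p) (x p - ctr) = 0.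
  move=> Up e.
  have : d2 (fun q => dot (x q - ctr) (x q - ctr)) p = 0.
    rewrite w2E; apply: (sd_vline oU (w := rho ^+ 2) (smooth_dot oU sxo sxo) Up).
    by move=> p' Up' e'; have [] := C p' Up' (etrans e' e).
  rewrite (sd_dot oU _ sxo sxo Up) !Dxo // (dotC (x p - ctr)) -mulr2n => /eqP.
  by rewrite mulrn_eq0 => /eqP.
have line2 p : U p -> p 0 0 = q 0 0 -> dot (D2 x p) m = 0.
  move=> Up e; have : d2 (fun q => dot (x q - ctr) m) p = 0.
    rewrite w2E; apply: (sd_vline oU (w := 0) (smooth_dot oU sxo (smooth_cst U m)) Up).
    by move=> p' Up' e'; have [] := C p' Up' (etrans e' e).
  by rewrite (sd_dotc oU _ m sxo Up) Dxo.
have nxo p : U p -> p 0 0 = q 0 0 -> dot (n p) (x p - ctr) = dot (n q) (x q - ctr).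
  move=> Up e; apply: (vline_const (f := fun q => dot (n q) (x q - ctr)) (smooth_dot oU sn sxo)) => // p' Up' e'.
  by rewrite (sd_dot oU w2 sn sxo Up') Dxo // n2E // dotZl line1 // mulr0 add0r dotC x2n.
have nm p : U p -> p 0 0 = q 0 0 -> dot (n p) m = dot (n q) m.
  move=> Up e; apply: (vline_const (f := fun q => dot (n q) m) (smooth_dot oU sn (smooth_cst U m))) => // p' Up' e'.
  by rewrite (sd_dotc oU w2 m sn Up') n2E // dotZl line2 // mulr0.
pose al := dot (n q) (x q - ctr) / rho ^+ 2; pose be := dot (n q) m / dot m m.
have dec p : U p -> p 0 0 = q 0 0 -> n p = al *: (x p - ctr) + be *: m.
  move=> Up e; have l1 := line1 p Up e; have l2 := line2 p Up e; have [C1 C2] := C p Up e.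
  have xo0 : x p - ctr != 0 by rewrite -dot_eq0 C1 expf_neq0 // gt_eqF.
  rewrite {1}(ortho3_decomp (n p) (x2_neq0 Up) xo0 m0 l1 l2 C2).
  by rewrite (dotC _ (D2 x p)) x2n // mul0r scale0r add0r C1 nxo // nm.
have kal p : U p -> p 0 0 = q 0 0 -> k p = - al.
  move=> Up e.
  pose r q := n q - (al *: (x q - ctr) + be *: m).
  have t1 : smooth_on U (fun q => al *: (x q - ctr)) by exact: (smoothZ oU (smooth_cst U al) sxo).
  have t2 : smooth_on U (fun q => al *: (x q - ctr) + be *: m).
    exact: (smoothD oU t1 (smooth_cst U (be *: m))).
  have sr : smooth_on U r by exact: (smoothBv oU sn t2).
  have : D2 r p = 0.
    rewrite [in pd _ r p]w2E; apply: (pd_vline oU (w := 0) sr Up).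
    by move=> p' Up' e'; rewrite /r {1}dec ?subrr // e'.
  rewrite (pdB _ sn t2 Up) (pdD _ t1 (smooth_cst U (be *: m)) Up) pd_cst addr0.
  rewrite (pdZc _ al sxo Up) Dxo // n2E // -scalerBl.
  by move/eqP; rewrite scaler_eq0 (negPf (x2_neq0 Up)) orbF subr_eq0 => /eqP <-; rewrite opprK.
exists ctr, m, rho, al, be; split=> // p Up e; have [C1 C2] := C p Up e.
split=> //; [exact: line1|exact: line2|split; [exact: dec|exact: kal]].
Qed.

Lemma k_vconst : vconst k.
Proof.
move=> q q' Uq Uq' e; have [ctr [m [rho [al [be [_ _ F]]]]]] := circle_frame Uq.
have [_ _ _ _ [_ ->]] := F q Uq erefl.
by have [_ _ _ _ [_ ->]] := F q' Uq' (esym e).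
Qed.

(** If a k + b = 0, the Weingarten relation reduces to b k + c = 0, and
    eliminating k from both gives b^2 = a c. *)
Lemma akb_neq0 q : U q -> a * k q + b != 0.
Proof.
move=> Uq; apply: contraNneq disc => akb0.
have : b * k q + c = 0 by have := lw Uq; nra.
move=> bkc; have -> : b ^+ 2 - a * c = b * (a * k q + b) - a * (b * k q + c) by ring.
by rewrite akb0 bkc !mulr0 subrr.
Qed.

Lemma k1E q : U q -> k1 q = - (b * k q + c) / (a * k q + b).
Proof.
move=> Uq; have akb := akb_neq0 Uq; apply: (mulIf akb); rewrite divfK //.
by have := lw Uq; nra.
Qed.

Lemma k1_vconst : vconst k1.
Proof. by move=> q q' Uq Uq' e; rewrite !k1E // (k_vconst Uq Uq' e). Qed.

Lemma sk1 : smooth_on U k1.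
Proof.
apply: (eq_smooth_on oU (f := fun q => - (b * k q + c) / (a * k q + b))) => [q Uq|].
  by rewrite k1E.
have sl (s t : R) : smooth_on U (fun q => s * k q + t).
  exact: (smoothD oU (smoothM oU (smooth_cst U s) sk) (smooth_cst U t)).
exact: (smooth_div oU akb_neq0 (smoothN oU (sl b c)) (sl a b)).
Qed.

Lemma d2k q : U q -> d2 k q = 0.
Proof. exact: (vconst_d2 sk k_vconst). Qed.
Lemma d2k1 q : U q -> d2 k1 q = 0.
Proof. exact: (vconst_d2 sk1 k1_vconst). Qed.

(** Both sides are - <n, x_uv>. *)
Lemma II_sym q : U q -> dot (D1 n q) (D2 x q) = dot (D2 n q) (D1 x q).
Proof.
move=> Uq; have := sd_eq0 oU w2 Uq x1n; have := sd_eq0 oU w1 Uq x2n.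
rewrite (sd_dot oU _ sx2 sn Uq) (sd_dot oU _ sx1 sn Uq) (pd_comm oU w1 w2 sx Uq) => e1 e2.
rewrite (dotC (D1 n q)) (dotC (D2 n q)); apply: (addrI (dot (D1 (D2 x) q) (n q))).
by rewrite e1.
Qed.

(** The coefficient of x_v is determined by the symmetry of the second
    fundamental form. *)
Lemma n1X q : U q -> D1 n q = - (k1 q *: X q) - (ph q * k q) *: D2 x q.
Proof.
move=> Uq; have [mu E] := n1E Uq.
have muE : mu = (k q - k1 q) * ph q.
  have := II_sym Uq; rewrite E n2E // dotNl dotDl !dotZl => e.
  have G0 := G_neq0 Uq; apply: (mulIf G0); rewrite /ph mulrA divfK // (dotC (D1 x q)).
  by move: e; rewrite (dotC (D1 x q)) -/(G q); lra.
rewrite E muE /X; apply/rowP => j; rewrite !mxE; ring.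
Qed.

Lemma D2x1 q : U q -> D2 (D1 x) q = D2 X q + d2 ph q *: D2 x q + ph q *: D2 (D2 x) q.
Proof.
move=> Uq; rewrite (pdB _ sx1 (smoothZ oU sph sx2) Uq) (pdZ _ sph sx2 Uq).
by rewrite -addrA subrK.
Qed.

(** Equality of the mixed derivatives of n, where k and k1 depend on u only. *)
Lemma Codazzi q : U q -> (k1 q - k q) *: D2 X q = d1 k q *: D2 x q.
Proof.
move=> Uq; have e1 := pd_eq oU w2 Uq n1X; have e2 := pd_eq oU w1 Uq n2E.
have t1 := smoothZ oU sk1 sX; have spk := smoothM oU sph sk; have t2 := smoothZ oU spk sx2.
rewrite (pd_comm oU w1 w2 sn Uq) e2 in e1.
rewrite (pdB _ (smoothNv oU t1) t2 Uq) (pdN _ t1 Uq) (pdZ _ sk1 sX Uq) in e1.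
rewrite (pdZ _ spk sx2 Uq) (sdM _ sph sk Uq) (d2k Uq) (d2k1 Uq) in e1.
rewrite (pdZ _ (smoothN oU sk) sx2 Uq) (sdN _ sk Uq) in e1.
rewrite -(pd_comm oU w1 w2 sx Uq) (D2x1 Uq) in e1.
apply/rowP => j; move/rowP: e1 => /(_ j); rewrite !mxE; lra.
Qed.

(** The direction of the orthogonal trajectories of the circles: it maps to X, and
    differentiates functions that are constant along the circles as w1 does. *)
Definition wd q : 'rV[R]_2 := w1 - ph q *: w2.
Lemma wd_vconst (f : 'rV[R]_2 -> R) q : smooth_on U f -> vconst f -> U q ->
  sd (wd q) f q = d1 f q.
Proof. by move=> sf vf Uq; rewrite (sd_lin _ _ _ sf Uq) vconst_d2 // mulr0 subr0. Qed.
Lemma wd_vconst_rV m (f : 'rV[R]_2 -> 'rV[R]_m) q : smooth_on U f -> vconst f -> U q ->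
  pd (wd q) f q = D1 f q.
Proof. by move=> sf vf Uq; rewrite (pd_lin _ _ _ sf Uq) vconst_D2 // scaler0 subr0. Qed.
Lemma wdx q : U q -> pd (wd q) x q = X q.
Proof. by move=> Uq; rewrite (pd_lin _ _ _ sx Uq). Qed.
Lemma wdn q : U q -> pd (wd q) n q = - k1 q *: X q.
Proof.
move=> Uq; rewrite (pd_lin _ _ _ sn Uq) n1X // n2E //; apply/rowP => j; rewrite !mxE; ring.
Qed.
Lemma wdx2 q : U q -> pd (wd q) (D2 x) q = D2 X q + d2 ph q *: D2 x q.
Proof.
move=> Uq; rewrite (pd_lin _ _ _ sx2 Uq).
by rewrite -(pd_comm oU w1 w2 sx Uq) (D2x1 Uq) addrK.
Qed.

Lemma Gronwall_chart (E m : 'rV[R]_2 -> R) q0 : smooth_on U E -> smooth_on U m ->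
  (forall q, U q -> 0 <= E q) -> vconst E ->
  (forall q, U q -> `|d1 E q| <= m q * E q) ->
  U q0 -> E q0 = 0 -> forall q, U q -> E q = 0.
Proof.
rewrite w1E => sE sm E0 vE dE; apply: (Gronwall_box oI oJ (m := m)) => //.
- by move=> q Uq; exact: smooth_continuous sm Uq.
- by move=> q Uq; rewrite -sdE dE.
- by move=> q Uq; rewrite -sdE -w2E vconst_d2.
Qed.

Lemma cst_smooth (s : R) : smooth_on U (fun=> s).
Proof. exact: smooth_cst. Qed.

(** Eliminating k1, the condition k1 = k becomes a polynomial equation for k. *)
Definition umbilic_poly q := a * (k q * k q) + 2 * b * k q + c.
Lemma umbilic_polyE q : U q -> umbilic_poly q = - (k1 q - k q) * (a * k q + b).
Proof. by move=> Uq; rewrite /umbilic_poly; have := lw Uq; nra. Qed.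

Lemma d1k q : U q -> d1 k q = (k1 q - k q) * (dot (D2 X q) (D2 x q) / G q).
Proof.
move=> Uq; have := congr1 (fun w => dot w (D2 x q)) (Codazzi Uq).
by rewrite /= !dotZl -/(G q) mulrA => ->; rewrite mulfK // G_neq0.
Qed.

(** By Codazzi k_u = (k1 - k) p with p smooth, so that
    umbilic_poly, which is - (k1 - k) (a k + b), has u-derivative
    - 2 p umbilic_poly. Its square is nonnegative and satisfies the hypotheses of
    Gronwall's inequality. *)
Lemma umbilic_propagates q0 : U q0 -> k1 q0 = k q0 -> forall q, U q -> k1 q = k q.
Proof.
move=> Uq0 e0.
have sP : smooth_on U umbilic_poly.
  have s2 := smoothM oU (smooth_cst U a) (smoothM oU sk sk).
  have s3 := smoothM oU (smooth_cst U (2 * b)) sk.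
  exact: (smoothD oU (smoothD oU s2 s3) (smooth_cst U c)).
have vP : vconst umbilic_poly by move=> q q' Uq Uq' e; rewrite /umbilic_poly (k_vconst Uq Uq' e).
pose p q := dot (D2 X q) (D2 x q) / G q.
have sp : smooth_on U p.
  exact: (smooth_div oU G_neq0 (smooth_dot oU (smooth_pd w2 sX) sx2) sG).
have D1P q : U q -> d1 umbilic_poly q = - 2 * p q * umbilic_poly q.
  move=> Uq; have s2 := smoothM oU (smooth_cst U a) (smoothM oU sk sk).
  have s3 := smoothM oU (smooth_cst U (2 * b)) sk.
  rewrite (sdD _ (smoothD oU s2 s3) (smooth_cst U c) Uq) (sdD _ s2 s3 Uq).
  rewrite (sdMc _ a (smoothM oU sk sk) Uq) (sdMc _ (2 * b) sk Uq) sd_cst.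
  rewrite (sdM _ sk sk Uq) d1k // -/(p q) umbilic_polyE //; ring.
have sPP := smoothM oU sP sP.
have PP_ge0 q : U q -> 0 <= umbilic_poly q * umbilic_poly q by rewrite -expr2 sqr_ge0.
have sm := smoothM oU (cst_smooth 4) (smoothD oU (cst_smooth 1) (smoothM oU sp sp)).
have PP0 q : U q -> umbilic_poly q * umbilic_poly q = 0.
  apply: (Gronwall_chart sPP sm PP_ge0 _ _ Uq0).
  - by move=> r r' Ur Ur' e; rewrite (vP r r').
  - move=> r Ur; rewrite (sdM _ sP sP Ur) D1P //.
    rewrite (_ : _ + _ = -4 * (p r * (umbilic_poly r * umbilic_poly r))); last by ring.
    rewrite 2!normrM normrN (ger0_norm (x := 4)) // (ger0_norm (PP_ge0 _ Ur)) mulrA.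
    by apply: ler_wpM2r => //; [exact: PP_ge0|apply: ler_wpM2l => //; exact: norm_le_1sqr].
  - by rewrite umbilic_polyE // e0 subrr oppr0 !mul0r.
move=> q Uq; have /eqP := PP0 q Uq; rewrite mulf_eq0 orbb umbilic_polyE // mulf_eq0 (negPf (akb_neq0 Uq)) orbF.
by rewrite oppr_eq0 subr_eq0 => /eqP.
Qed.


Section NonUmbilic.
Hypothesis numb : forall q, U q -> k1 q != k q.
Local Notation dk q := (k1 q - k q).

Lemma dk_neq0 q : U q -> dk q != 0.
Proof. by move=> Uq; rewrite subr_eq0 numb. Qed.
Lemma sdk : smooth_on U (fun q => dk q). Proof. exact: (smoothB oU sk1 sk). Qed.

(** By Codazzi, X_v = nu x_v. *)
Definition nu q := d1 k q / dk q.
Definition normX2 q := dot (X q) (X q).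

Lemma d1kE q : U q -> d1 k q = dk q * nu q.
Proof. by move=> Uq; rewrite mulrC divfK // dk_neq0. Qed.
Lemma snu : smooth_on U nu.
Proof. exact: (smooth_div oU dk_neq0 (smooth_sd w1 sk) sdk). Qed.
Lemma D2X q : U q -> D2 X q = nu q *: D2 x q.
Proof.
move=> Uq; apply: (scalerI (dk_neq0 Uq)); rewrite Codazzi // d1kE // scalerA.
by [].
Qed.
Lemma normX2_smooth : smooth_on U normX2. Proof. exact: (smooth_dot oU sX sX). Qed.
Lemma normX2_gt0 q : U q -> 0 < normX2 q.
Proof. by move=> Uq; rewrite dot_gt0 // X_neq0. Qed.
Lemma normX2_neq0 q : U q -> normX2 q != 0.
Proof. by move=> Uq; rewrite gt_eqF // normX2_gt0. Qed.

Lemma d1_vconst f : smooth_on U f -> vconst f -> vconst (d1 f).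
Proof.
move=> sf vf; apply: d2_vconst; first exact: smooth_sd.
move=> q Uq; rewrite (sd_comm oU _ _ sf Uq); apply: (sd_eq0 oU) => // p Up.
exact: vconst_d2.
Qed.
Lemma nu_vconst : vconst nu.
Proof.
move=> q q' Uq Uq' e; rewrite /nu (k_vconst Uq Uq' e) (k1_vconst Uq Uq' e).
by rewrite (d1_vconst sk k_vconst Uq Uq' e).
Qed.
Lemma normX2_vconst : vconst normX2.
Proof.
apply: (d2_vconst normX2_smooth) => q Uq; rewrite (sd_dot oU _ sX sX Uq) D2X // dotZr dotZl.
by rewrite (dotC (D2 x q)) dotX2 // mulr0 addr0.
Qed.

(** The components, along X and n, of the derivative of X along the orthogonal
    trajectories. *)
Definition accX q := d1 normX2 q / (2 * normX2 q).
Definition accn q := k1 q * normX2 q.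
Lemma accX_vconst : vconst accX.
Proof.
move=> q q' Uq Uq' e; rewrite /accX (normX2_vconst Uq Uq' e).
by rewrite (d1_vconst normX2_smooth normX2_vconst Uq Uq' e).
Qed.
Lemma accn_vconst : vconst accn.
Proof.
by move=> q q' Uq Uq' e; rewrite /accn (normX2_vconst Uq Uq' e) (k1_vconst Uq Uq' e).
Qed.
Lemma accX_smooth : smooth_on U accX.
Proof.
apply: (smooth_div oU _ (smooth_sd w1 normX2_smooth) (smoothM oU (cst_smooth 2) normX2_smooth)) => q Uq.
by rewrite mulf_neq0 ?pnatr_eq0 ?normX2_neq0.
Qed.
Lemma accn_smooth : smooth_on U accn. Proof. exact: (smoothM oU sk1 normX2_smooth). Qed.
Lemma d1_normX2 q : U q -> d1 normX2 q = 2 * accX q * normX2 q.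
Proof.
move=> Uq; rewrite /accX; have e0 := normX2_neq0 Uq; field.
exact: e0.
Qed.

Definition Y q := D1 X q - ph q *: D2 X q.
Lemma YE q : U q -> Y q = pd (wd q) X q.
Proof. by move=> Uq; rewrite (pd_lin _ _ _ sX Uq). Qed.

Lemma YX q : U q -> dot (Y q) (X q) = accX q * normX2 q.
Proof.
move=> Uq; have := wd_vconst normX2_smooth normX2_vconst Uq; rewrite (sd_dot oU _ sX sX Uq) -YE //.
rewrite (dotC (X q) (Y q)) d1_normX2 //; lra.
Qed.
Lemma Yn q : U q -> dot (Y q) (n q) = accn q.
Proof.
move=> Uq; have := sd_eq0 oU (wd q) Uq dotXn; rewrite (sd_dot oU _ sX sn Uq) -YE // wdn //.
rewrite dotZr -/(normX2 q) /accn; lra.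
Qed.
Lemma Yx2 q : U q -> dot (Y q) (D2 x q) = 0.
Proof.
move=> Uq; have := sd_eq0 oU (wd q) Uq dotX2; rewrite (sd_dot oU _ sX sx2 Uq) -YE // wdx2 // D2X //.
by rewrite dotDr !dotZr dotX2 // !mulr0 !addr0.
Qed.
Lemma Y_decomp q : U q -> Y q = accX q *: X q + accn q *: n q.
Proof.
move=> Uq; have x2n' : dot (n q) (D2 x q) = 0 by rewrite dotC x2n.
rewrite {1}(ortho3_decomp (Y q) (X_neq0 Uq) (n_neq0 Uq) (x2_neq0 Uq) (dotXn Uq) (dotX2 Uq) x2n').
rewrite YX // Yn // Yx2 // nn // mul0r scale0r addr0 divr1 mulfK //.
exact: normX2_neq0.
Qed.

(** The factor by which A below is multiplied under d / du. *)
Definition rate q := accX q - nu q.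
Lemma rate_smooth : smooth_on U rate. Proof. exact: (smoothB oU accX_smooth snu). Qed.

(** The Gauss equation, from the two ways to compute Y_v: by exchanging
    derivatives, and from the decomposition of Y along X and n. *)
Lemma Gauss q : U q -> d1 nu q = rate q * nu q - k q * k1 q * normX2 q.
Proof.
move=> Uq; have e1 : D2 Y q = (d1 nu q + nu q ^+ 2) *: D2 x q.
  rewrite (pdB _ (smooth_pd w1 sX) (smoothZ oU sph (smooth_pd w2 sX)) Uq).
  rewrite (pdZ _ sph (smooth_pd w2 sX) Uq) (pd_comm oU _ _ sX Uq).
  rewrite (pd_eq oU w1 Uq D2X) (pd_eq oU w2 Uq D2X) (pdZ _ snu sx2 Uq) (pdZ _ snu sx2 Uq).
  rewrite (vconst_d2 snu nu_vconst Uq) -(pd_comm oU w1 w2 sx Uq) (D2x1 Uq) (D2X Uq).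
  apply/rowP => j; rewrite !mxE; ring.
have e2 : D2 Y q = (accX q * nu q - accn q * k q) *: D2 x q.
  rewrite (pd_eq oU w2 Uq Y_decomp) (pdD _ (smoothZ oU accX_smooth sX) (smoothZ oU accn_smooth sn) Uq).
  rewrite (pdZ _ accX_smooth sX Uq) (pdZ _ accn_smooth sn Uq) (vconst_d2 accX_smooth accX_vconst Uq) (vconst_d2 accn_smooth accn_vconst Uq).
  rewrite n2E // (D2X Uq); apply/rowP => j; rewrite !mxE; ring.
have : d1 nu q + nu q ^+ 2 = accX q * nu q - accn q * k q.
  apply/eqP; rewrite -subr_eq0; move/eqP: e2; rewrite e1 -subr_eq0 -scalerBl scaler_eq0.
  by rewrite (negPf (x2_neq0 Uq)) orbF.
rewrite /rate /accn => e; rewrite (_ : d1 nu q = d1 nu q + nu q ^+ 2 - nu q ^+ 2); last by ring.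
rewrite e; ring.
Qed.

(** The direction of the axis of the circle: up to a factor, the only combination
    of X and n that does not vary along the circle. *)
Definition A q := k q *: X q + nu q *: n q.
Lemma sA : smooth_on U A.
Proof. exact: (smoothD oU (smoothZ oU sk sX) (smoothZ oU snu sn)). Qed.
Lemma D2A q : U q -> D2 A q = 0.
Proof.
move=> Uq; rewrite (pdD _ (smoothZ oU sk sX) (smoothZ oU snu sn) Uq) (pdZ _ sk sX Uq) (pdZ _ snu sn Uq).
rewrite (vconst_d2 snu nu_vconst Uq) (d2k Uq) (D2X Uq) (n2E Uq).
apply/rowP => j; rewrite !mxE; ring.
Qed.
Lemma A_vconst : vconst A. Proof. exact: D2_vconst sA D2A. Qed.
Lemma D1A q : U q -> D1 A q = rate q *: A q.
Proof.
move=> Uq; rewrite -(wd_vconst_rV sA A_vconst Uq).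
rewrite (pdD _ (smoothZ oU sk sX) (smoothZ oU snu sn) Uq) (pdZ _ sk sX Uq) (pdZ _ snu sn Uq).
rewrite (wd_vconst sk k_vconst Uq) (wd_vconst snu nu_vconst Uq) -YE // Y_decomp // wdn //.
rewrite Gauss // d1kE // /rate /accn /A; apply/rowP => j; rewrite !mxE; ring.
Qed.

Definition normA2 q := k q * k q * normX2 q + nu q * nu q.
Lemma normA2_smooth : smooth_on U normA2.
Proof. exact: (smoothD oU (smoothM oU (smoothM oU sk sk) normX2_smooth) (smoothM oU snu snu)). Qed.
Lemma normA2_vconst : vconst normA2.
Proof. by move=> q q' Uq Uq' e; rewrite /normA2 (k_vconst Uq Uq' e) (normX2_vconst Uq Uq' e) (nu_vconst Uq Uq' e). Qed.
Lemma d1_normA2 q : U q -> d1 normA2 q = 2 * rate q * normA2 q.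
Proof.
move=> Uq; have skk := smoothM oU sk sk.
rewrite (sdD _ (smoothM oU skk normX2_smooth) (smoothM oU snu snu) Uq) (sdM _ skk normX2_smooth Uq) (sdM _ sk sk Uq).
rewrite (sdM _ snu snu Uq) Gauss // d1kE // d1_normX2 // /normA2 /rate; ring.
Qed.

(** If A = 0, then k = nu = 0. Along the circle n is then parallel to the normal
    m of its plane, so X is radial, X = ga (x - ctr) with ga constant, whence
    X_v = ga x_v. But X_v = nu x_v = 0, so ga = 0 and X = 0. *)
Lemma normA2_neq0 q : U q -> normA2 q != 0.
Proof.
move=> Uq; apply/eqP => N0.
have kk0 : 0 <= k q * k q by rewrite -expr2 sqr_ge0.
have nn0 : 0 <= nu q * nu q by rewrite -expr2 sqr_ge0.
have e0 := normX2_gt0 Uq.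
have k0 : k q = 0.
  apply/eqP; rewrite -sqrf_eq0 expr2; apply/eqP/le_anti; rewrite kk0 andbT.
  by rewrite -(pmulr_lle0 _ e0); move: N0; rewrite /normA2; lra.
have nu0 : nu q = 0.
  by apply/eqP; rewrite -sqrf_eq0 expr2; move: N0; rewrite /normA2 k0 !mul0r add0r => ->.
have [ctr [m [rho [al [be [m0 rho0 F]]]]]] := circle_frame Uq.
have [C1 C2 L1 L2 [nE kE]] := F q Uq erefl.
have al0 : al = 0 by apply/eqP; rewrite -oppr_eq0 -kE k0.
rewrite al0 scale0r add0r in nE.
have be0 : be != 0 by apply: contraTneq (n_neq0 Uq) => b0; rewrite nE b0 scale0r eqxx.
have Xm : dot (X q) m = 0.
  by have := dotXn Uq; rewrite nE dotZr => /eqP; rewrite mulf_eq0 (negPf be0) => /eqP.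
have xo0 : x q - ctr != 0 by rewrite -dot_eq0 C1 expf_neq0 // gt_eqF.
have Xx : dot (X q) (x q - ctr) = 0.
  have sc := smooth_cst (W := 'rV[R]_3) U ctr; have sxo := smoothBv oU sx sc.
  pose g p := dot (X p) (x p - ctr).
  have g2 p : U p -> p 0 0 = q 0 0 -> d2 g p = 0.
    move=> Up e; have [_ _ L _ _] := F p Up e.
    rewrite (sd_dot oU _ sX sxo Up) (pdB _ sx sc Up) pd_cst subr0 D2X // dotZl L mulr0 add0r.
    by rewrite dotX2.
  (* along the circle X = ga (x - ctr) with ga constant, hence X_v = ga x_v *)
  pose ga := g q / rho ^+ 2.
  have XE p : U p -> p 0 0 = q 0 0 -> X p = ga *: (x p - ctr).
    move=> Up e; have [D1' D2' M1 M2 [nE' _]] := F p Up e.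
    have xo1 : x p - ctr != 0 by rewrite -dot_eq0 D1' expf_neq0 // gt_eqF.
    have Xm' : dot (X p) m = 0.
      have := dotXn Up; rewrite nE' al0 scale0r add0r dotZr => /eqP.
      by rewrite mulf_eq0 (negPf be0) => /eqP.
    rewrite {1}(ortho3_decomp (X p) (x2_neq0 Up) xo1 m0 M1 M2 D2') dotX2 // Xm' !mul0r !scale0r add0r addr0.
    have gpq : g p = g q := vline_const (smooth_dot oU sX sxo) Uq Up e g2.
    by rewrite D1' -/(g p) gpq.
  have sr : smooth_on U (fun p => X p - ga *: (x p - ctr)).
    exact: (smoothBv oU sX (smoothZ oU (cst_smooth ga) sxo)).
  have : D2 (fun p => X p - ga *: (x p - ctr)) q = 0.
    rewrite w2E; apply: (pd_vline oU (w := 0) sr Uq) => p Up e.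
    by rewrite XE // subrr.
  rewrite (pdB _ sX (smoothZ oU (cst_smooth ga) sxo) Uq) (pdZc _ ga sxo Uq).
  rewrite (pdB _ sx sc Uq) pd_cst subr0 D2X // nu0 scale0r sub0r => /eqP.
  rewrite oppr_eq0 scaler_eq0 (negPf (x2_neq0 Uq)) orbF /ga mulf_eq0 invr_eq0.
  by rewrite expf_eq0 /= (gt_eqF rho0) orbF => /eqP.
have X0 := ortho3_eq0 (x2_neq0 Uq) xo0 m0 L1 L2 C2 (dotX2 Uq) Xx Xm.
by have := X_neq0 Uq; rewrite X0 eqxx.
Qed.

Lemma A_neq0 q : U q -> A q != 0.
Proof.
move=> Uq; rewrite -dot_eq0 (_ : dot _ _ = normA2 q) ?normA2_neq0 //.
by rewrite /A dot_comb2 dotXn // nn // /normA2 -/(normX2 q); ring.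
Qed.

(** The centre of the circle: centre - x is orthogonal to A and to x_v, and its
    length is such that the centre does not vary along the circle. *)
Definition centre q := x q + (normA2 q)^-1 *: ((k q * normX2 q) *: n q - nu q *: X q).
Lemma k_normX2_smooth : smooth_on U (fun q => k q * normX2 q). Proof. exact: (smoothM oU sk normX2_smooth). Qed.
Lemma sCr : smooth_on U (fun q => (k q * normX2 q) *: n q - nu q *: X q).
Proof. exact: (smoothBv oU (smoothZ oU k_normX2_smooth sn) (smoothZ oU snu sX)). Qed.
Lemma normA2_inv_smooth : smooth_on U (fun q => (normA2 q)^-1). Proof. exact: (smoothV oU normA2_neq0 normA2_smooth). Qed.
Lemma centre_smooth : smooth_on U centre.
Proof. exact: (smoothD oU sx (smoothZ oU normA2_inv_smooth sCr)). Qed.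

Lemma pdC v q : U q -> pd v centre q = pd v x q + (sd v (fun q => (normA2 q)^-1) q *: ((k q * normX2 q) *: n q - nu q *: X q)
  + (normA2 q)^-1 *: ((sd v k q * normX2 q + k q * sd v normX2 q) *: n q + (k q * normX2 q) *: pd v n q
    - (sd v nu q *: X q + nu q *: pd v X q))).
Proof.
move=> Uq; rewrite (pdD _ sx (smoothZ oU normA2_inv_smooth sCr) Uq) (pdZ _ normA2_inv_smooth sCr Uq).
by rewrite (pdB _ (smoothZ oU k_normX2_smooth sn) (smoothZ oU snu sX) Uq) (pdZ _ k_normX2_smooth sn Uq) (pdZ _ snu sX Uq) (sdM _ sk normX2_smooth Uq).
Qed.

Lemma D2C q : U q -> D2 centre q = 0.
Proof.
move=> Uq; rewrite pdC // (vconst_d2 normA2_inv_smooth _ Uq); last first.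
  by move=> r r' Ur Ur' e; rewrite (normA2_vconst Ur Ur' e).
rewrite d2k // (vconst_d2 normX2_smooth normX2_vconst Uq) (vconst_d2 snu nu_vconst Uq) n2E // D2X //.
rewrite !mul0r mulr0 addr0 !scale0r !add0r.
rewrite (_ : _ - _ = - normA2 q *: D2 x q); last first.
  by rewrite /normA2; apply/rowP => j; rewrite !mxE; ring.
by rewrite scalerA mulrN mulVf ?normA2_neq0 // scaleN1r subrr.
Qed.
Lemma centre_vconst : vconst centre. Proof. exact: D2_vconst centre_smooth D2C. Qed.
Lemma D1C q : U q -> D1 centre q = (k q * normX2 q / normA2 q) *: A q.
Proof.
move=> Uq; rewrite -(wd_vconst_rV centre_smooth centre_vconst Uq) pdC // wdx // wdn // -YE // Y_decomp //.
rewrite (wd_vconst sk k_vconst Uq) (wd_vconst snu nu_vconst Uq) (wd_vconst normX2_smooth normX2_vconst Uq).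
rewrite (wd_vconst normA2_inv_smooth _ Uq); last by move=> r r' Ur Ur' e; rewrite (normA2_vconst Ur Ur' e).
rewrite (sdV _ normA2_smooth (normA2_neq0 Uq) Uq) d1_normA2 // Gauss // d1kE // d1_normX2 //.
have N0 := normA2_neq0 Uq; have -> : (normA2 q) ^- 2 * (2 * rate q * normA2 q) = 2 * rate q / normA2 q by field.
have XN : X q = (normA2 q)^-1 *: (normA2 q *: X q) by rewrite scalerA mulVf // scale1r.
rewrite {1}XN; move: (normA2 q)^-1 => iN; rewrite /normA2 /A /accn /rate.
apply/rowP => j; rewrite !mxE; ring.
Qed.

(** The part of A orthogonal to a0, the value of A at q0, solves the homogeneous
    linear equation f_u = rate f and vanishes at q0, hence everywhere; so A is
    everywhere parallel to a0. As centre_u is parallel to A, the part of the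
    centre orthogonal to a0 is constant. *)
Lemma axis_exists q0 : U q0 -> exists ctr ax : 'rV[R]_3, ax != 0 /\
  forall q, U q -> dot (D2 x q) ax = 0 /\ dot (x q - ctr) (D2 x q) = 0.
Proof.
move=> U0; pose a0 := A q0; have a00 : a0 != 0 := A_neq0 U0.
have aa0 : dot a0 a0 != 0 by rewrite dot_eq0.
pose pr (z : 'rV[R]_3) := z - (dot z a0 / dot a0 a0) *: a0.
have pra t z : pr (t *: z) = t *: pr z.
  by rewrite /pr dotZl scalerBr scalerA mulrA.
have spr f : smooth_on U f -> smooth_on U (fun q => pr (f q)).
  move=> sf; have s1 := smoothM oU (smooth_dot oU sf (smooth_cst U a0)) (cst_smooth (dot a0 a0)^-1).
  exact: (smoothBv oU sf (smoothZ oU s1 (smooth_cst U a0))).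
have pdpr v f q : smooth_on U f -> U q -> pd v (fun q => pr (f q)) q = pr (pd v f q).
  move=> sf Uq; have s0 := smooth_dot oU sf (smooth_cst U a0).
  have s1 := smoothM oU s0 (cst_smooth (dot a0 a0)^-1).
  rewrite (pdB _ sf (smoothZ oU s1 (smooth_cst U a0)) Uq) (pdZ _ s1 (smooth_cst U a0) Uq) pd_cst scaler0 addr0.
  by rewrite (sdM _ s0 (cst_smooth _) Uq) sd_cst mulr0 addr0 (sd_dotc oU _ _ sf Uq).
have pr0 : pr 0 = 0 by rewrite /pr dot0l mul0r scale0r subrr.
have sf := spr _ sA; set f := (fun q => pr (A q)) in sf.
have sE := smooth_dot oU sf sf.
have sm := smoothM oU (cst_smooth 2) (smoothD oU (cst_smooth 1) (smoothM oU rate_smooth rate_smooth)).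
have fE0 q : U q -> dot (f q) (f q) = 0.
  apply: (Gronwall_chart sE sm _ _ _ U0).
  - by move=> r Ur; exact: dot_ge0.
  - by move=> r r' Ur Ur' e; rewrite /f (A_vconst Ur Ur' e).
  - move=> r Ur; rewrite (sd_dot oU _ sf sf Ur) (pdpr _ _ _ sA Ur) D1A // pra -/(f r) dotZl dotZr.
    rewrite (_ : _ + _ = 2 * rate r * dot (f r) (f r)); last by ring.
    rewrite 2!normrM (ger0_norm (x := 2)) // (ger0_norm (dot_ge0 _)).
    by apply: ler_wpM2r; [exact: dot_ge0|apply: ler_wpM2l => //; exact: norm_le_1sqr].
  - rewrite /f -/a0 /pr divff // scale1r subrr; exact: dot0l.
have AE q : U q -> A q = (dot (A q) a0 / dot a0 a0) *: a0.
  by move=> Uq; apply/eqP; rewrite -subr_eq0 -dot_eq0 -/(pr _) -/(f q) fE0.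
have CE q : U q -> pr (centre q - centre q0) = 0.
  have sCC := smoothBv oU centre_smooth (smooth_cst U (centre q0)).
  have DCC v r : U r -> pd v (fun q => pr (centre q - centre q0)) r = pr (pd v centre r).
    by move=> Ur; rewrite pdpr // (pdB _ centre_smooth (smooth_cst U (centre q0)) Ur) pd_cst subr0.
  rewrite -pr0 -(subrr (centre q0)).
  apply: (box_const_rV oI oJ (f := fun q => pr (centre q - centre q0))) => //; first exact: spr.
    move=> r Ur; rewrite -pdE -w1E DCC // D1C // pra AE // pra (_ : pr a0 = 0) ?scaler0 //.
    by rewrite /pr divff // scale1r subrr.
  by move=> r Ur; rewrite -pdE -w2E DCC // D2C.
exists (centre q0), a0; split=> // q Uq.
have x2A : dot (D2 x q) (A q) = 0.
  by rewrite /A dot_comb x2n // dotC dotX2 // !mulr0 addr0.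
have x2a : dot (D2 x q) a0 = 0.
  move: x2A; rewrite AE // dotZr => /eqP; rewrite mulf_eq0 => /orP[|/eqP//] /eqP d0.
  by have := A_neq0 Uq; rewrite AE // d0 scale0r eqxx.
split=> //.
have -> : x q - centre q0 = (centre q - centre q0) - (normA2 q)^-1 *: ((k q * normX2 q) *: n q - nu q *: X q).
  by rewrite /centre; apply/rowP => j; rewrite !mxE; ring.
have -> : centre q - centre q0 = (dot (centre q - centre q0) a0 / dot a0 a0) *: a0.
  by apply/eqP; rewrite -subr_eq0 -/(pr _) CE.
move: (dot (centre q - centre q0) a0 / dot a0 a0) => t.
rewrite dotC dot_comb3 x2a (x2n Uq) (dotC (D2 x q) (X q)) (dotX2 Uq).
by rewrite !mulr0 subrr mulr0 subrr.
Qed.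

(** On V, k solves b k^2 + c k = 0, whose roots are simple since c <> 0; so k
    is locally constant and nu = 0. Now A <> 0 excludes k = 0, leaving
    b k + c = 0, which is k1 = 0. By Codazzi and Gauss the pair (b k + c, nu)
    solves a homogeneous linear system in u, so it vanishes on the whole box. *)
Lemma flat_propagates (V : set 'rV[R]_2) q0 : open V -> V `<=` U -> V q0 ->
  c != 0 -> (forall q, V q -> k q * k1 q = 0) -> forall q, U q -> k1 q = 0.
Proof.
move=> oV VU V0 c0 kk0.
have bkc q : V q -> b * (k q * k q) + c * k q = 0.
  move=> Vq; have Uq := VU _ Vq; have ak := akb_neq0 Uq.
  have := congr1 (fun t => t * (a * k q + b)) (kk0 q Vq).
  rewrite /= k1E // mul0r -mulrA divfK //; lra.
have U0 := VU _ V0.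
have d1k0 : d1 k q0 = 0.
  have skV : smooth_on V k := smooth_on_subset VU sk.
  have := sd_eq0 oV w1 V0 bkc.
  have skk := smoothM oV skV skV.
  have sl1 := smoothM oV (smooth_cst V b) skk; have sl2 := smoothM oV (smooth_cst V c) skV.
  rewrite (sdD _ sl1 sl2 V0) (sdMc _ b skk V0) (sdMc _ c skV V0) (sdM _ skV skV V0) => e.
  have e' : (2 * b * k q0 + c) * d1 k q0 = 0 by rewrite -e; ring.
  have c2 : (2 * b * k q0 + c) ^+ 2 = c ^+ 2.
    have -> : (2 * b * k q0 + c) ^+ 2 = c ^+ 2 + 4 * b * (b * (k q0 * k q0) + c * k q0) by ring.
    by rewrite bkc // mulr0 addr0.
  have cn : 2 * b * k q0 + c != 0 by rewrite -sqrf_eq0 c2 sqrf_eq0.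
  by move/eqP: e'; rewrite mulf_eq0 (negPf cn) => /eqP.
have nu0 : nu q0 = 0 by rewrite /nu d1k0 mul0r.
have k0 : k q0 != 0.
  by apply: contra_neq (normA2_neq0 U0) => k0; rewrite /normA2 k0 nu0 !mul0r addr0.
have ff0 : b * k q0 + c = 0.
  have /eqP : k q0 * (b * k q0 + c) = 0 by rewrite -[RHS](bkc q0) //; ring.
  by rewrite mulf_eq0 (negPf k0) => /eqP.
pose ff q := b * k q + c; pose r q := k q * normX2 q / (a * k q + b); pose y q := b * dk q + r q.
have sl (s t : R) : smooth_on U (fun q => s * k q + t).
  exact: (smoothD oU (smoothM oU (cst_smooth s) sk) (cst_smooth t)).
have sff : smooth_on U ff := sl b c.
have sr : smooth_on U r := smooth_div oU akb_neq0 k_normX2_smooth (sl a b).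
have sy : smooth_on U y := smoothD oU (smoothM oU (cst_smooth b) sdk) sr.
have sE := smoothD oU (smoothM oU sff sff) (smoothM oU snu snu).
have sm := smoothD oU (smoothD oU (cst_smooth 1) (smoothM oU sy sy))
   (smoothM oU (cst_smooth 2) (smoothD oU (cst_smooth 1) (smoothM oU rate_smooth rate_smooth))).
have E0 q : U q -> ff q * ff q + nu q * nu q = 0.
  apply: (Gronwall_chart sE sm _ _ _ U0).
  - by move=> p Up; rewrite -!expr2 addr_ge0 ?sqr_ge0.
  - by move=> p p' Up Up' e; rewrite /ff (k_vconst Up Up' e) (nu_vconst Up Up' e).
  - move=> p Up; rewrite (sdD _ (smoothM oU sff sff) (smoothM oU snu snu) Up) (sdM _ sff sff Up) (sdM _ snu snu Up).
    have -> : d1 ff p = b * (dk p * nu p).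
      by rewrite (sdD _ (smoothM oU (cst_smooth b) sk) (cst_smooth c) Up) (sdMc _ b sk Up) sd_cst addr0 d1kE.
    have -> : d1 nu p = rate p * nu p + r p * ff p.
      rewrite Gauss // {1}k1E // /r /ff; have := akb_neq0 Up => ak; field.
      exact: ak.
    rewrite (_ : _ + _ + _ = y p * (2 * ff p * nu p) + 2 * rate p * (nu p * nu p)); last by rewrite /y; ring.
    apply: le_trans (ler_normD _ _) _; rewrite [leRHS]mulrDl lerD //.
      rewrite normrM; apply: ler_pM => //; first exact: norm_le_1sqr.
      have h1 := sqr_ge0 (ff p - nu p); have h2 := sqr_ge0 (ff p + nu p).
      rewrite ler_norml; nra.
    have n0 : 0 <= nu p * nu p by rewrite -expr2 sqr_ge0.
    have f0 : 0 <= ff p * ff p by rewrite -expr2 sqr_ge0.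
    rewrite 2!normrM (ger0_norm (x := 2)) // (ger0_norm n0).
    apply: ler_pM => //.
      by apply: ler_wpM2l => //; exact: norm_le_1sqr.
    by rewrite lerDr.
  - by rewrite /ff ff0 nu0 !mul0r addr0.
move=> q Uq; rewrite k1E //.
have n0 : 0 <= nu q * nu q by rewrite -expr2 sqr_ge0.
have /eqP : ff q * ff q = 0.
  have f0 : 0 <= ff q * ff q by rewrite -expr2 sqr_ge0.
  by apply/le_anti; rewrite f0 andbT; have := E0 q Uq; lra.
by rewrite mulf_eq0 orbb /ff => /eqP ->; rewrite oppr0 mul0r.
Qed.

End NonUmbilic.
End LocalChannel.

(** * Smoothness of inverse maps *)

Section InverseMap.
Variables (R : realType) (m : nat).

Lemma mulmx_continuous (A : 'M[R]_m) : continuous (fun h : 'rV[R]_m => h *m A).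
Proof.
move=> h; have : smooth_on [set: 'rV[R]_m] (fun h : 'rV[R]_m => h *m A).
  apply: (smooth_mulmx openT); [exact: smooth_id|exact: smooth_cst].
by move=> s; exact: smooth_continuous s I.
Qed.

(** As f (g z) = z, the increment of g differs from that of z times the inverse
    Jacobian by an error that is small relative to the increment of g; a small
    enough relative error (e' below) also bounds the increment of g by that of z. *)
Lemma inverse_differentiable (U' : set 'rV[R]_m) (f g : 'rV[R]_m -> 'rV[R]_m) w :
  open U' -> U' w -> differentiable f (g w) -> 'J f (g w) \in unitmx ->
  {for w, continuous g} -> (forall z, U' z -> f (g z) = z) ->
  differentiable g w /\ forall v, 'D_v g w = v *m invmx ('J f (g w)).
Proof.
move=> oU' Uw df Ju cg fgK; set B := invmx ('J f (g w)).
have [M M0 BM] := linear_lipschitz (@mulmx_continuous B : continuous (mulmxr B)).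
have dfE h : 'd f (g w) h = h *m 'J f (g w) by rewrite -deriveEjacobian // deriveE.
have E : forall e, 0 < e -> \forall h \near (0 : 'rV[R]_m),
    `|g (h + w) - g w - mulmxr B h| <= e * `|h|.
  move=> e e0; pose e' := Num.min (1 / (2 * M)) (e / (2 * M ^+ 2)).
  have e'0 : 0 < e' by rewrite lt_min !divr_gt0 // ?mulr_gt0 // exprn_gt0.
  have cw : (fun h : 'rV[R]_m => h + w) @ (0 : 'rV[R]_m) --> w.
    have : {for (0 : 'rV[R]_m), continuous (fun h : 'rV[R]_m => h + w)}.
      by apply: differentiable_continuous; apply: differentiableD.
    by rewrite /prop_for /continuous_at add0r.
  have cgw : (fun h => g (h + w)) @ (0 : 'rV[R]_m) --> g w by apply: cvg_comp cw cg.
  have cg0 : (fun h => g (h + w) - g w) @ (0 : 'rV[R]_m) --> (0 : 'rV[R]_m).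
    have : {for g w, continuous (fun z : 'rV[R]_m => z - g w)}.
      by apply: differentiable_continuous; apply: differentiableB.
    by rewrite /prop_for /continuous_at subrr; apply: cvg_comp cgw.
  have n1 : \forall h \near (0 : 'rV[R]_m), U' (h + w).
    exact: cw (open_near oU' Uw).
  have n2 : \forall h \near (0 : 'rV[R]_m), `|f (g (h + w) - g w + g w) - f (g w)
      - 'd f (g w) (g (h + w) - g w)| <= e' * `|g (h + w) - g w|.
    exact: cg0 _ (diff_eps df e'0).
  apply: filterS2 n1 n2 => h Uh; set k := g (h + w) - g w => kE.
  move: kE; rewrite {1}/k subrK !fgK // addrK dfE; set r := h - _ => rE.
  have LE : h *m B = k + r *m B.
    by rewrite -{1}(subrK (k *m 'J f (g w)) h) mulmxDl mulmxK // addrC.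
  have rB : `|r *m B| <= M * e' * `|k|.
    by apply: le_trans (BM r) _; rewrite -mulrA ler_pM2l.
  have Me1 : M * e' <= 1 / 2.
    apply: (@le_trans _ _ (M * (1 / (2 * M)))); first by rewrite ler_pM2l // ge_min lexx.
    by rewrite mul1r invfM mulrCA mulfV ?gt_eqF // mulr1 mul1r.
  have kh : `|k| <= 2 * M * `|h|.
    have : `|k| <= `|h *m B| + `|r *m B|.
      have -> : k = h *m B - r *m B by rewrite LE addrK.
      exact: ler_normB.
    have := BM h; rewrite /= => b1; have k0 := normr_ge0 k.
    have : M * e' * `|k| <= 1 / 2 * `|k| by rewrite ler_wpM2r.
    by lra.
  rewrite /= -[X in `|X - _|]/k LE opprD addNKr normrN.
  apply: (le_trans rB); apply: (@le_trans _ _ (M * e' * (2 * M * `|h|))).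
    by rewrite ler_wpM2l // mulr_ge0 // ltW.
  have -> : M * e' * (2 * M * `|h|) = e' * (2 * M ^+ 2) * `|h| by ring.
  rewrite ler_wpM2r // -ler_pdivlMr ?mulr_gt0 ?exprn_gt0 // ge_min lexx orbT //.
have [d1 d2] := is_diff_eps (L := mulmxr B) (@mulmx_continuous B) E.
split=> [|v]; first exact: d1.
by rewrite (deriveE v d1) d2.
Qed.

Lemma smooth_jacobian n (U : set 'rV[R]_m) (f : 'rV[R]_m -> 'rV[R]_n) : open U -> smooth_on U f ->
  smooth_on U (fun q => 'J f q).
Proof.
move=> oU sf; apply: (smooth_mx oU) => i j.
apply: (eq_smooth_on oU (f := fun q => ('D_(delta_mx 0 i) f q : 'rV[R]_n) 0 j)).
  move=> q Uq; rewrite deriveEjacobian; last exact: smooth_differentiable sf Uq.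
  by rewrite -rowE mxE.
by apply: (smooth_entry oU); exact: smooth_derive.
Qed.

(** The formula for the derivative of g involves only g and smooth maps, so
    regularity follows by induction on the order, starting from continuity. *)
Lemma smooth_inverse (U U' : set 'rV[R]_m) (f g : 'rV[R]_m -> 'rV[R]_m) :
  open U -> open U' -> smooth_on U f -> (forall q, U q -> 'J f q \in unitmx) ->
  (forall w, U' w -> U (g w)) -> (forall w, U' w -> f (g w) = w) ->
  (forall w, U' w -> {for w, continuous g}) -> smooth_on U' g.
Proof.
move=> oU oU' sf Ju gU fgK cg; elim=> [|k IH]; first exact: cg.
have dg w : U' w -> _ := fun Uw => inverse_differentiable oU' Uw
  (smooth_differentiable sf (gU w Uw)) (Ju _ (gU w Uw)) (cg w Uw) fgK.
split=> [w Uw|v]; first by have [] := dg w Uw.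
have sv : smooth_on U (fun q => v *m invmx ('J f q)).
  apply: (smooth_mulmx oU); first exact: smooth_cst.
  by apply: (smooth_invmx oU) => //; exact: smooth_jacobian.
apply: (eq_Ck_on oU' (f := fun w => v *m invmx ('J f (g w)))).
  by move=> w Uw; have [_ ->] := dg w Uw.
exact: (Ck_on_rV_comp oU' gU IH (sv k)).
Qed.
End InverseMap.

(** * Inverting a function along fibres *)

Section FiberInverse.
Variable R : realType.

Definition pt (s t : R) : 'rV[R]_2 := s *: dir1 R + t *: dir2 R.
Lemma pt0 s t : pt s t 0 0 = s.
Proof. by rewrite !mxE /= mulr1 mulr0 addr0. Qed.
Lemma pt1 s t : pt s t 0 1 = t.
Proof. by rewrite !mxE /= mulr1 mulr0 add0r. Qed.
Lemma ptE (q : 'rV[R]_2) : pt (q 0 0) (q 0 1) = q. Proof. by rewrite /pt -rV2_decomp. Qed.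

Lemma ball_rV2 (q0 q : 'rV[R]_2) r : 0 < r -> `|q 0 0 - q0 0 0| < r -> `|q 0 1 - q0 0 1| < r ->
  ball q0 r q.
Proof.
move=> r0 h0 h1; rewrite -ball_normE /= distrC {1}/Num.norm /= mx_normrE.
apply: bigmax_lt => // -[i j] _; rewrite !mxE /= (ord1 i).
case: j => [[|[|//]] p].
  by rewrite (_ : Ordinal p = 0) //; exact: val_inj.
by rewrite (_ : Ordinal p = 1) //; exact: val_inj.
Qed.

Definition rect (a b r s : R) : set 'rV[R]_2 := [set q | `|q 0 0 - a| < r /\ `|q 0 1 - b| < s].

Lemma coord_dist_near (q : 'rV[R]_2) (j : 'I_2) (a r : R) : `|q 0 j - a| < r ->
  \forall p \near q, `|(p : 'rV[R]_2) 0 j - a| < r.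
Proof.
move=> h; have d0 : 0 < r - `|q 0 j - a| by rewrite subr_gt0.
have n : \forall t \near q 0 j, `|t - a| < r.
  apply/nbhs_ballP; exists (r - `|q 0 j - a|) => //= t; rewrite -ball_normE /= => ht.
  rewrite (le_lt_trans (ler_distD (q 0 j) t a)) // -ltrBrDr distrC //.
exact: (@coord_continuous R 1 2 0 j q _ n).
Qed.

Lemma rect_open a b r s : open (rect a b r s).
Proof.
rewrite openE => q [h0 h1]; rewrite /interior.
by apply: filterS2 (coord_dist_near h0) (coord_dist_near h1) => p.
Qed.

Lemma smooth_pt (V : normedModType R) (U : set V) (f g : V -> R) : open U -> smooth_on U f -> smooth_on U g ->
  smooth_on U (fun q => pt (f q) (g q)).
Proof.
by move=> oU sf sg; apply: (smoothD oU); apply: (smoothZ oU) => //; exact: smooth_cst.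
Qed.

Lemma smooth_coord (U : set 'rV[R]_2) j : open U -> smooth_on U (fun q : 'rV[R]_2 => q 0 j).
Proof. by move=> oU; apply: (smooth_entry oU); exact: smooth_id. Qed.

Lemma derive_coord v (q : 'rV[R]_2) j : 'D_v (fun p : 'rV[R]_2 => p 0 j) q = v 0 j.
Proof.
have d : differentiable (id : 'rV[R]_2 -> 'rV[R]_2) q by [].
by apply: etrans (derive_entry 0 j v d) _; rewrite derive_id.
Qed.

Lemma continuous_scaleD (V W : normedModType R) (f g : V -> R) (a b : W) p :
  {for p, continuous f} -> {for p, continuous g} ->
  {for p, continuous (fun q => f q *: a + g q *: b)}.
Proof. by move=> cf cg; apply: cvgD; apply: cvgZl. Qed.

Lemma continuous_eps (V : normedModType R) (f : V -> R) p :
  (forall e, 0 < e -> \forall q \near p, `|f p - f q| < e) -> {for p, continuous f}.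
Proof. by move=> h; apply/cvgrPdist_lt => e /h. Qed.

Lemma norm_sign_dist (s g a : R) : `|s| = 1 -> `|s * g - s * a| = `|g - a|.
Proof. by move=> s1; rewrite -mulrBr normrM s1 mul1r. Qed.

(** The inverse of (u, v) |-> (u, phi (u, v)). As phi is strictly monotone in v
    with slope bounded below, the intermediate value theorem on each line
    u = const yields the inverse, and the slope bound makes it continuous. *)
Lemma fiber_inverse (U : set 'rV[R]_2) (phi : 'rV[R]_2 -> R) q0 : open U -> U q0 -> smooth_on U phi ->
  'D_(dir2 R) phi q0 != 0 ->
  exists eps eta beta (g : 'rV[R]_2 -> 'rV[R]_2),
  [/\ [/\ 0 < eps, 0 < eta & 0 < beta],
      forall q, rect (q0 0 0) (q0 0 1) eps eta q -> U q,
      forall w, rect (q0 0 0) (phi q0) eps beta w ->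
        [/\ rect (q0 0 0) (q0 0 1) eps eta (g w), g w 0 0 = w 0 0 & phi (g w) = w 0 1],
      forall q, rect (q0 0 0) (q0 0 1) eps eta q -> `|phi q - phi q0| < beta ->
        g (pt (q 0 0) (phi q)) = q &
      smooth_on (rect (q0 0 0) (phi q0) eps beta) g].
Proof.
move=> oU U0 sphi d0; set u0 : R := q0 0 0; set v0 : R := q0 0 1; set p0 : R := phi q0.
pose D2 := 'D_(dir2 R) phi.
pose s := Num.sg (D2 q0).
have s1 : `|s| = 1 by rewrite normr_sg d0.
pose c := `|D2 q0| / 2.
have c0 : 0 < c by rewrite divr_gt0 // normr_gt0.
have sD : smooth_on U D2 := smooth_derive _ sphi.
have cD := smooth_continuous sD U0.
have n1 : \forall q \near q0, c < s * D2 q.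
  have n : \forall q \near q0, `|D2 q0 - D2 q| < c by exact: (proj1 (cvgrPdist_lt _ _) cD _ c0).
  apply: filterS n => q; rewrite -(norm_sign_dist _ _ s1) ltr_norml => /andP[_].
  have -> : s * D2 q0 = c + c by rewrite -normrEsg /c -splitr.
  by rewrite ltrBlDr -ltrBlDl addrK.
have [r /= r0 rP] := proj1 (nbhs_ballP _ _) (filterI (open_near oU U0) n1).
pose eta := r / 2; have eta0 : 0 < eta by rewrite divr_gt0.
have etar : eta < r by rewrite ltr_pdivrMr // ltr_pMr // ltr1n.
pose beta := c * eta / 2; have beta0 : 0 < beta by rewrite divr_gt0 // mulr_gt0.
(* s makes phi increasing in v; near q0 its slope is at least c, half of its slope at q0 *)
have inU (q : 'rV[R]_2) : `|q 0 0 - u0| < r -> `|q 0 1 - v0| < r -> U q /\ c < s * D2 q.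
  by move=> h h'; have [] := rP _ (ball_rV2 r0 h h').
have mono u v v' : `|u - u0| < r -> `|v - v0| < r -> `|v' - v0| < r -> v < v' ->
    c * (v' - v) <= s * phi (pt u v') - s * phi (pt u v).
  move=> hu hv hv' vv'; have h0 : 0 < v' - v by rewrite subr_gt0.
  have inl t : 0 <= t <= v' - v -> `|(pt u v + t *: dir2 R) 0 0 - u0| < r /\ `|(pt u v + t *: dir2 R) 0 1 - v0| < r.
    move=> /andP[t0 tv]; rewrite !(dir2E (pt u v) t) pt0 pt1; split=> //.
    move: hv hv'; rewrite !ltr_norml => /andP[h1 h2] /andP[h3 h4]; apply/andP; split; lra.
  have [t /andP[t0 tv] E] := MVT_line h0 (fun t ht => smooth_differentiable sphi (inU _ (inl t ht).1 (inl t ht).2).1).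
  have e : pt u v + (v' - v) *: dir2 R = pt u v'.
    by apply: rV2P; rewrite (dir2E (pt u v) _) ?pt0 // !pt1 subrKC.
  have tt : 0 <= t <= v' - v by rewrite !ltW.
  rewrite e in E; rewrite -mulrBr E mulrA ler_wpM2r // ltW //.
  by have [] := inU _ (inl t tt).1 (inl t tt).2.
have dist u v v' : `|u - u0| < r -> `|v - v0| < r -> `|v' - v0| < r ->
    c * `|v' - v| <= `|phi (pt u v') - phi (pt u v)|.
  move=> hu hv hv'; have [lt|lt|->] := ltgtP v v'; last by rewrite !subrr !normr0 mulr0.
    rewrite -(norm_sign_dist (phi (pt u v')) (phi (pt u v)) s1) gtr0_norm ?subr_gt0 //.
    by apply: le_trans (mono u v v' hu hv hv' lt) (ler_norm _).
  rewrite distrC (distrC (phi _)) -(norm_sign_dist (phi (pt u v)) (phi (pt u v')) s1) gtr0_norm ?subr_gt0 //.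
  by apply: le_trans (mono u v' v hu hv' hv lt) (ler_norm _).
(* eps keeps phi (u, v0) within beta of phi q0; by the slope bound and 2 beta = c eta, the
   values of phi at v0 - eta and v0 + eta then enclose the whole target interval *)
have cphi := smooth_continuous sphi U0.
have n2 : \forall q \near q0, `|phi q0 - phi q| < beta by exact: (proj1 (cvgrPdist_lt _ _) cphi _ beta0).
have [r2 /= r20 r2P] := proj1 (nbhs_ballP _ _) n2.
pose eps := Num.min r r2; have eps0 : 0 < eps by rewrite lt_min r0.
have lt_eps (a : R) : `|a| < eps -> `|a| < r /\ `|a| < r2 by rewrite lt_min => /andP.
have phiu u : `|u - u0| < eps -> `|phi (pt u v0) - p0| < beta.
  move=> /lt_eps[_ hu]; rewrite distrC; apply: r2P; apply: ball_rV2 => //; first by rewrite pt0.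
  by rewrite pt1 subrr normr0.
have v0r : `|v0 - v0| < r by rewrite subrr normr0.
have vp : `|v0 + eta - v0| < r by rewrite addrAC subrr add0r gtr0_norm.
have vm : `|v0 - eta - v0| < r by rewrite addrAC subrr add0r normrN gtr0_norm.
have ends u w : `|u - u0| < eps -> `|w - p0| < beta ->
    s * phi (pt u (v0 - eta)) < s * w /\ s * w < s * phi (pt u (v0 + eta)).
  move=> hu hw; have [hur _] := lt_eps _ hu; have h1 := phiu _ hu.
  have lt1 : v0 < v0 + eta by rewrite ltrDl.
  have lt2 : v0 - eta < v0 by rewrite gtrBl.
  have m1 := mono _ _ _ hur v0r vp lt1; have m2 := mono _ _ _ hur vm v0r lt2.
  have a1 : v0 + eta - v0 = eta by ring.
  have a2 : v0 - (v0 - eta) = eta by ring.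
  rewrite a1 in m1; rewrite a2 in m2.
  move: h1 hw; rewrite -(norm_sign_dist _ _ s1) -(norm_sign_dist w p0 s1) !ltr_norml /beta.
  move=> /andP[h1 h2] /andP[h3 h4]; split; lra.
pose sol (w : 'rV[R]_2) v := [/\ `|v - v0| < eta & phi (pt (w 0 0) v) = w 0 1].
have solP (w : 'rV[R]_2) : rect u0 p0 eps beta w -> exists v, sol w v.
  move=> [hu hw]; have [e1 e2] := ends _ _ hu hw; have [hur _] := lt_eps _ hu.
  have le : v0 - eta <= v0 + eta by rewrite lerD2l ge0_cp // ltW.
  have cf : {within `[v0 - eta, v0 + eta], continuous (fun v => s * phi (pt (w 0 0) v))}.
    apply: continuous_within_itv => v /andP[v1 v2].
    have Uv : U (pt (w 0 0) v).
      apply: (inU _ _ _).1; rewrite ?pt0 ?pt1 //.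
      by rewrite (@le_lt_trans _ _ eta) // ler_norml; apply/andP; split; lra.
    have da : differentiable (fun v => pt (w 0 0) v) v.
      by apply: differentiableD => //; exact: (@differentiableZl _ _ _ id).
    apply: differentiable_continuous; apply: (@differentiableM _ _ (fun=> s)) => //.
    apply: (@differentiable_comp _ _ _ _ (fun v => pt (w 0 0) v) phi) => //.
    exact: smooth_differentiable sphi Uv.
  have mm : Num.min (s * phi (pt (w 0 0) (v0 - eta))) (s * phi (pt (w 0 0) (v0 + eta))) <= s * w 0 1
     <= Num.max (s * phi (pt (w 0 0) (v0 - eta))) (s * phi (pt (w 0 0) (v0 + eta))).
    by rewrite ge_min le_max (ltW e1) (ltW e2) orbT.
  have [v] := IVT le cf mm; rewrite in_itv /= => /andP[v1 v2] /mulfI E.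
  have sn0 : s != 0 by rewrite sgr_eq0.
  have {}E := E sn0; exists v; split=> //.
  rewrite ltr_norml; apply/andP; split.
    rewrite ltrBrDl lt_neqAle v1 andbT; apply: contraTneq e1 => ->.
    by rewrite E ltxx.
  rewrite ltrBlDl lt_neqAle v2 andbT; apply: contraTneq e2 => <-.
  by rewrite E ltxx.
pose psi (w : 'rV[R]_2) : R := xget 0 [set v | sol w v].
have psiP (w : 'rV[R]_2) : rect u0 p0 eps beta w -> sol w (psi w).
  by move=> /solP[v hv]; exact: (@xgetPex _ 0 [set v | sol w v] (ex_intro _ v hv)).
pose g (w : 'rV[R]_2) := pt (w 0 0) (psi w).
have lt_etar (a : R) : `|a| < eta -> `|a| < r by move=> h; exact: lt_trans h etar.
have sub q : rect u0 v0 eps eta q -> U q /\ c < s * D2 q.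
  by move=> [/lt_eps[h _] /lt_etar h']; exact: inU.
have gP w : rect u0 p0 eps beta w -> [/\ rect u0 v0 eps eta (g w), g w 0 0 = w 0 0 & phi (g w) = w 0 1].
  move=> rw; have [h1 h2] := psiP w rw; have [hu _] := rw.
  by rewrite /g; split=> //; [split; rewrite ?pt0 ?pt1|rewrite pt0].
exists eps, eta, beta, g; split=> //.
- by move=> q /sub[].
- move=> q [hu hv] hp; have rw : rect u0 p0 eps beta (pt (q 0 0) (phi q)).
    by split; rewrite ?pt0 ?pt1.
  have [h1 h2] := psiP _ rw; rewrite !pt0 pt1 in h2.
  apply: rV2P; rewrite /g ?pt0 ?pt1 //.
  have [hur _] := lt_eps _ hu.
  have := dist _ _ _ hur (lt_etar _ hv) (lt_etar _ h1).
  rewrite h2 ptE subrr normr0 pmulr_rle0 // normr_le0 subr_eq0 => /eqP //.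
have oR : open (rect u0 v0 eps eta) by exact: rect_open.
have oB : open (rect u0 p0 eps beta) by exact: rect_open.
have sphi' : smooth_on (rect u0 v0 eps eta) phi by apply: smooth_on_subset sphi => q /sub[].
pose f (q : 'rV[R]_2) := pt (q 0 0) (phi q).
have sf : smooth_on (rect u0 v0 eps eta) f.
  by apply: (smooth_pt oR) => //; exact: smooth_coord.
apply: (smooth_inverse oR oB sf).
- move=> q rq; have [_ cq] := sub q rq.
  rewrite -row_free_unit; apply: inj_row_free => v.
  have df := smooth_differentiable sf rq; have dphi := smooth_differentiable sphi' rq.
  rewrite -(deriveEjacobian v df).
  have e0 : ('D_v f q) 0 0 = v 0 0.
    rewrite -(derive_entry 0 0 v df) (_ : (fun q => f q 0 0) = (fun q : 'rV[R]_2 => q 0 0)) ?derive_coord //.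
    by apply/funext => p; rewrite /f pt0.
  have e1 : ('D_v f q) 0 1 = 'D_v phi q.
    rewrite -(derive_entry 0 1 v df) (_ : (fun q => f q 0 1) = phi) //.
    by apply/funext => p; rewrite /f pt1.
  move=> z; rewrite z mxE in e0; rewrite z mxE in e1.
  have vE : v = v 0 1 *: dir2 R by rewrite [LHS]rV2_decomp -e0 scale0r add0r.
  move: e1; rewrite vE (deriveE _ dphi) linearZ /= -(deriveE _ dphi) => /esym/eqP.
  rewrite scaler_eq0 => /orP[/eqP ->|/eqP D0]; first by rewrite scale0r.
  by move: cq; rewrite /D2 D0 mulr0 ltNge (ltW c0).
- by move=> w /gP[].
- move=> w /gP[_ g0 g1]; apply: rV2P; rewrite /f ?pt0 ?pt1 //.
- move=> w1 rw1; have [[hu hv] gw0 gw1] := gP w1 rw1.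
  rewrite gw0 in hu; have [hur _] := lt_eps _ hu.
  have cp : {for w1, continuous psi}.
    apply: continuous_eps => e e0.
    have U1 : U (pt (w1 0 0) (psi w1)) by apply: (sub _ _).1; split; rewrite ?pt0 ?pt1 //; have [] := psiP w1 rw1.
    pose F (w : 'rV[R]_2) := w 0 1 - phi (pt (w 0 0) (psi w1)).
    have cF : {for w1, continuous F}.
      apply: differentiable_continuous; apply: differentiableB; first exact: differentiable_coord.
      apply: (@differentiable_comp _ _ _ _ (fun w : 'rV[R]_2 => pt (w 0 0) (psi w1)) phi); last exact: smooth_differentiable sphi U1.
      apply: differentiableD => //; apply: (@differentiableZl _ _ _ (fun w : 'rV[R]_2 => w 0 0)).
      exact: differentiable_coord.
    have F0 : F w1 = 0 by rewrite /F; have [_ ->] := psiP w1 rw1; rewrite subrr.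
    have ce : 0 < c * e by rewrite mulr_gt0.
    have nF : \forall w \near w1, `|F w1 - F w| < c * e by exact: (proj1 (cvgrPdist_lt _ _) cF _ ce).
    apply: filterS2 nF (open_near oB rw1) => w; rewrite F0 sub0r normrN => Fw rw.
    have [h1 h2] := psiP w rw; have [k1 k2] := psiP w1 rw1.
    have [/lt_eps[hwr _] _] := rw.
    rewrite -(ltr_pM2l c0); apply: le_lt_trans Fw.
    rewrite distrC /F -h2; exact: dist hwr (lt_etar _ k1) (lt_etar _ h1).
  have s2 : {for w1, continuous (fun w : 'rV[R]_2 => w 0 0)} by exact: coord_continuous.
  exact: (continuous_scaleD s2 cp).
Qed.
End FiberInverse.

(** * Algebra of the shape operator *)

Lemma det_mx22 (R : comNzRingType) (A : 'M[R]_2) : \det A = A 0 0 * A 1 1 - A 0 1 * A 1 0.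
Proof.
have l1 : lift ord0 (ord0 : 'I_1) = 1 :> 'I_2 by exact: val_inj.
have l0 : lift (1 : 'I_2) (ord0 : 'I_1) = 0 :> 'I_2 by exact: val_inj.
rewrite (expand_det_row _ 0) !big_ord_recl big_ord0 addr0 l1 /cofactor !det_mx11 !mxE l1 l0 /=.
by rewrite expr0 expr1 mul1r mulN1r mulrN.
Qed.

Local Notation shape := Defs.shape.
Section ShapeAlgebra.
Variable R : realType.

Lemma char_poly2 (A : 'M[R]_2) : char_poly A = 'X ^+ 2 - (\tr A) *: 'X + (\det A)%:P.
Proof.
rewrite /char_poly det_mx22 !mxE /= !mulr1n !mulr0n !sub0r det_mx22 /mxtrace !big_ord_recl big_ord0.
rewrite (_ : lift ord0 ord0 = 1) ?addr0; last exact: val_inj.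
rewrite -mul_polyC !polyCD !polyCN !polyCM; ring.
Qed.

Lemma char_poly2E (A : 'M[R]_2) (k l : R) :
  char_poly A = ('X - k%:P) * ('X - l%:P) <-> k + l = \tr A /\ k * l = \det A.
Proof.
have E2 : ('X - k%:P) * ('X - l%:P) = 'X ^+ 2 - (k + l) *: 'X + (k * l)%:P.
  rewrite -mul_polyC polyCD polyCM; ring.
rewrite char_poly2 E2; split=> [e|[-> ->] //].
have := congr1 (fun p : {poly R} => p`_1) e; have := congr1 (fun p : {poly R} => p`_0) e.
rewrite !(coefD, coefN, coefZ, coefX, coefXn, coefC) /=; split; lra.
Qed.

Lemma gram_unit (A : 'M[R]_(2, 3)) : row_free A -> A *m A^T \in unitmx.
Proof.
move=> Af; rewrite -row_free_unit; apply: inj_row_free => v vA.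
have : dot (v *m A) (v *m A) = 0.
  by rewrite /dot trmx_mul mulmxA -(mulmxA v) vA mul0mx mxE.
move/eqP; rewrite dot_eq0 => /eqP e; apply: (row_free_inj Af).
by rewrite e mul0mx.
Qed.

(** The first fundamental form is invertible, so the Weingarten equations
    determine the shape operator. *)
Lemma shape_unique (x n : 'rV[R]_2 -> 'rV[R]_3) q M :
  row_free ('J x q) -> 'J n q = - (M *m 'J x q) -> shape x n q = M.
Proof.
move=> xf nE; rewrite /Defs.shape /second_form /first_form nE (mulNmx (M *m _)) opprK -(mulmxA M).
by rewrite mulmxK // gram_unit.
Qed.

(** Make p orthogonal to q; together with n this gives an orthogonal basis. *)
Lemma tangent_decomp (p q n z : 'rV[R]_3) : dot p n = 0 -> dot q n = 0 -> dot n n = 1 ->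
  (forall s t, s *: p + t *: q = 0 -> s = 0 /\ t = 0) -> dot z n = 0 ->
  exists s t, z = s *: p + t *: q.
Proof.
move=> pn qn nn ind zn.
have q0 : q != 0.
  apply/eqP => q0; have [] := ind 0 1; first by rewrite scale0r q0 scaler0 addr0.
  by move=> _ /eqP; rewrite oner_eq0.
have qq : dot q q != 0 by rewrite dot_eq0.
pose X := p - (dot p q / dot q q) *: q.
have X0 : X != 0.
  apply/eqP => X0; have [] := ind 1 (- (dot p q / dot q q)); first by rewrite scale1r scaleNr.
  by move=> /eqP; rewrite oner_eq0.
have n0 : n != 0 by rewrite -dot_eq0 nn oner_neq0.
have Xq : dot X q = 0 by rewrite dotDl dotNl dotZl divfK // subrr.
have Xn : dot X n = 0 by rewrite dotDl dotNl dotZl pn qn mulr0 subrr.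
rewrite (ortho3_decomp z X0 q0 n0 Xq Xn qn) zn mul0r scale0r addr0.
set s := _ / dot X X; exists s, (dot z q / dot q q - s * (dot p q / dot q q)).
by rewrite /X scalerBr scalerA scalerBl addrA addrAC.
Qed.

Lemma row_free2 (A : 'M[R]_(2, 3)) : row_free A <->
  (forall s t, s *: row 0 A + t *: row 1 A = 0 -> s = 0 /\ t = 0).
Proof.
have E s t : s *: row 0 A + t *: row 1 A = (s *: dir1 R + t *: dir2 R) *m A.
  by rewrite mulmxDl -!scalemxAl -!rowE.
split=> [Af s t|ind].
  rewrite E -(mul0mx _ A) => /(row_free_inj Af) e.
  by move/rowP: e => e; split; [have := e 0|have := e 1]; rewrite !mxE /= ?mulr1 ?mulr0 ?addr0 ?add0r.
apply: inj_row_free => v; rewrite [v]rV2_decomp -E => /ind[-> ->].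
by rewrite !scale0r addr0.
Qed.

Lemma rows2P m (A B : 'M[R]_(2, m)) : row 0 A = row 0 B -> row 1 A = row 1 B -> A = B.
Proof.
move=> e0 e1; apply/row_matrixP => i; case: i => [[|[|//]] p].
  by rewrite (_ : Ordinal p = 0) //; exact: val_inj.
by rewrite (_ : Ordinal p = 1) //; exact: val_inj.
Qed.

Lemma matrix2P (A B : 'M[R]_2) : A 0 0 = B 0 0 -> A 0 1 = B 0 1 ->
  A 1 0 = B 1 0 -> A 1 1 = B 1 1 -> A = B.
Proof.
move=> e00 e01 e10 e11; apply: rows2P; apply: rV2P; rewrite !mxE //.
Qed.

(** The derivatives of n are tangent, hence combinations of those of x. *)
Lemma weingarten_eq (x n : 'rV[R]_2 -> 'rV[R]_3) q :
  row_free ('J x q) -> dot (n q) (n q) = 1 ->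
  (forall v, dot (v *m 'J x q) (n q) = 0) -> (forall v, dot (v *m 'J n q) (n q) = 0) ->
  'J n q = - (shape x n q *m 'J x q).
Proof.
move=> xf nn xn nnv; have ind := proj1 (row_free2 _) xf.
have tJ i : dot (row i ('J x q)) (n q) = 0 by rewrite rowE; exact: xn.
have tN i : dot (row i ('J n q)) (n q) = 0 by rewrite rowE; exact: nnv.
have r i : exists s t, row i ('J n q) = s *: row 0 ('J x q) + t *: row 1 ('J x q).
  exact: (tangent_decomp (tJ 0) (tJ 1) nn ind (tN i)).
have [s0 [t0 e0]] := r 0; have [s1 [t1 e1]] := r 1.
pose M : 'M[R]_2 := \matrix_(i, j) (if i == 0 then if j == 0 then - s0 else - t0 else if j == 0 then - s1 else - t1).
suff E : 'J n q = - (M *m 'J x q) by rewrite (shape_unique xf E).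
rewrite /M; move: ('J n q) ('J x q) e0 e1 => B A e0 e1.
apply: rows2P; [rewrite e0|rewrite e1]; apply/rowP => j; rewrite !mxE !big_ord_recl big_ord0 !mxE /=.
  rewrite (_ : lift ord0 ord0 = 1) //=; last exact: val_inj.
  by rewrite addr0 opprD !mulNr !opprK.
rewrite (_ : lift ord0 ord0 = 1) //=; last exact: val_inj.
by rewrite addr0 opprD !mulNr !opprK.
Qed.

(** The chosen eigenvalues may come in the opposite order, so only symmetric
    functions of k and l are determined. *)
Lemma principal_curvaturesP (x n : 'rV[R]_2 -> 'rV[R]_3) q (k l : R) :
  char_poly (shape x n q) = ('X - k%:P) * ('X - l%:P) ->
  [/\ gauss_curvature x n q = k * l, mean_curvature x n q = (k + l) / 2 &
      (kappa1 x n q = kappa2 x n q <-> k = l)].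
Proof.
move=> E; have := @xgetPex _ (0, 0) [set k : R * R |
    char_poly (shape x n q) = ('X - k.1%:P) * ('X - k.2%:P)] (ex_intro _ (k, l) E).
rewrite /= -/(principal_curvatures x n q) -/(kappa1 x n q) -/(kappa2 x n q) => /char_poly2E[s p].
move/char_poly2E : E => [s' p'].
rewrite /gauss_curvature /mean_curvature p p' s s'; split=> //.
set u := kappa1 x n q in s p *; set v := kappa2 x n q in s p *.
have key : (u - v) ^+ 2 = (k - l) ^+ 2.
  have -> : (u - v) ^+ 2 = (u + v) ^+ 2 - 4 * (u * v) by ring.
  have -> : (k - l) ^+ 2 = (k + l) ^+ 2 - 4 * (k * l) by ring.
  by rewrite s p s' p'.
split=> e; apply/eqP; rewrite -subr_eq0 -sqrf_eq0.
  by rewrite -key e subrr expr0n.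
by rewrite key e subrr expr0n.
Qed.

Lemma char_poly_conj (P A : 'M[R]_2) : P \in unitmx -> char_poly (P *m A *m invmx P) = char_poly A.
Proof.
move=> Pu; rewrite !char_poly2 mxtrace_mulC mulmxA mulVmx // mul1mx !det_mulmx mulrAC -det_mulmx mulmxV // det1 mul1r.
by [].
Qed.

Lemma det2_shift (S : 'M[R]_2) t : \det (1%:M + t *: S) = 1 + t * \tr S + t ^+ 2 * \det S.
Proof.
rewrite !det_mx22 /mxtrace !big_ord_recl big_ord0 !mxE /=.
rewrite (_ : lift ord0 ord0 = 1) ?addr0; last exact: val_inj.
by rewrite ?mulr1n ?mulr0n; ring.
Qed.

(** From T (1 + t S) = S one gets the determinant. For the trace, the
    Cayley-Hamilton theorem gives
    (S + t det S) (1 + t S) = det (1 + t S) S. *)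
Lemma parallel_shape_invariants (S : 'M[R]_2) t : 1%:M + t *: S \in unitmx ->
  let T := S *m invmx (1%:M + t *: S) in
  \det T * \det (1%:M + t *: S) = \det S /\
  \tr T * \det (1%:M + t *: S) = \tr S + 2 * t * \det S.
Proof.
move=> Bu T; have TB : T *m (1%:M + t *: S) = S by rewrite mulmxKV.
split; first by rewrite -det_mulmx TB.
have CH : (S + (t * \det S)%:M) *m (1%:M + t *: S) = \det (1%:M + t *: S) *: S.
  have l1 : lift ord0 (ord0 : 'I_1) = 1 :> 'I_2 by exact: val_inj.
  rewrite det2_shift !det_mx22 /mxtrace.
  apply: matrix2P; rewrite !mxE !big_ord_recl !big_ord0 !mxE /= l1 ?mulr1n ?mulr0n; ring.
have TE : \det (1%:M + t *: S) *: T = S + (t * \det S)%:M.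
  by rewrite /T scalemxAl -CH mulmxK.
rewrite mulrC -mxtraceZ TE mxtraceD mxtrace_scalar mulr2n; ring.
Qed.
End ShapeAlgebra.

(** * Smooth real functions *)

Section RealFunctions.
Variable R : realType.

Lemma derivable_real_differentiable (f : R -> R) s : derivable f s 1 -> differentiable f s.
Proof. by move/derivable1_diffP. Qed.

Lemma derive_real (f : R -> R) s v : differentiable f s -> 'D_v f s = v * 'D_1 f s.
Proof.
move=> df; have d1 : derivable f s 1 by exact/derivable1_diffP.
by rewrite (deriveE v df) (deriv1E d1) /= derive1E.
Qed.

Lemma Ck_on_real_derive k (U : set R) (f g : R -> R) : open U ->
  (forall s, U s -> is_derive s 1 f (g s)) -> Ck_on k U g -> Ck_on k.+1 U f.
Proof.
move=> oU fg sg; have df s : U s -> differentiable f s.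
  by move=> /fg h; apply: derivable_real_differentiable; case: h.
split=> [//|v]; apply: (eq_Ck_on oU (f := fun s => v * g s)).
  by move=> s Us; rewrite (derive_real v (df _ Us)); have [_ ->] := fg s Us.
by apply: (Ck_onM oU) => //; exact: Ck_on_cst.
Qed.

Lemma smooth_real_derive (U : set R) (f g : R -> R) : open U ->
  (forall s, U s -> is_derive s 1 f (g s)) -> smooth_on U g -> smooth_on U f.
Proof.
move=> oU fg sg [|k]; last exact: Ck_on_real_derive fg (sg k).
exact/Ck_onS/(Ck_on_real_derive oU fg (sg 0%N)).
Qed.

Lemma posR_open : open [set s : R | 0 < s]. Proof. exact: open_gt. Qed.

Lemma smooth_sqrt : smooth_on [set s : R | 0 < s] (@Num.sqrt R).
Proof.
elim=> [|k IH]; first by move=> s _; exact: sqrt_continuous.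
have d (s : R) : 0 < s -> is_derive s 1 Num.sqrt (2 * Num.sqrt s)^-1 by exact: is_derive1_sqrt.
apply: (Ck_on_real_derive posR_open d).
apply: (Ck_onV posR_open) => [s s0|]; first by rewrite mulf_neq0 // ?pnatr_eq0 // gt_eqF // sqrtr_gt0.
by apply: (Ck_onM posR_open) => //; exact: Ck_on_cst.
Qed.

Lemma smooth_atan : smooth_on [set: R] (@atan R).
Proof.
have d (s : R) : [set: R] s -> is_derive s 1 atan (1 + s ^+ 2)^-1 by move=> _; exact: is_derive1_atan.
apply: (smooth_real_derive openT d).
apply: (smoothV openT) => [s _|]; first by rewrite gt_eqF // ltr_pwDl // sqr_ge0.
by apply: (smoothD openT); [exact: smooth_cst|apply: (smoothX openT); exact: smooth_idR].
Qed.

Lemma smooth_sin_cos : smooth_on [set: R] (@sin R) /\ smooth_on [set: R] (@cos R).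
Proof.
suff H k : Ck_on k [set: R] (@sin R) /\ Ck_on k [set: R] (@cos R) by split=> k; have [] := H k.
elim: k => [|k [IHs IHc]]; first by split=> s _; [exact: continuous_sin|exact: continuous_cos].
split.
  have d (s : R) : [set: R] s -> is_derive s 1 sin (cos s) by move=> _; exact: is_derive_sin.
  exact: (Ck_on_real_derive openT d).
have d (s : R) : [set: R] s -> is_derive s 1 cos (-1 * sin s).
  by rewrite mulN1r => _; exact: is_derive_cos.
apply: (Ck_on_real_derive openT d).
by apply: (Ck_onM openT) => //; exact: Ck_on_cst.
Qed.

(** The functions s^(-i) exp (- 1 / s), extended by 0. The linear span of this
    family is stable under differentiation, which is why all i are considered. *)
Definition flat i (s : R) : R := if 0 < s then s ^- i * expR (- s^-1) else 0.

(** The exponential series of 1 / s contains s^(- i - 1) / (i + 1)!. *)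
Lemma flat_bound i s : `|flat i s| <= (i.+1)`!%:R * `|s|.
Proof.
rewrite /flat; case: ltP => s0; last by rewrite normr0 mulr_ge0.
have si0 : 0 < s^-1 by rewrite invr_gt0.
have e0 := expR_gt0 (s^-1).
rewrite expRN ger0_norm; last by rewrite mulr_ge0 // invr_ge0 ?exprn_ge0 // ltW.
rewrite (gtr0_norm s0) ler_pdivrMr // -mulrA.
have b : (s^-1) ^+ i.+1 <= (i.+1)`!%:R * expR (s^-1).
  have := expR_ge1Dxn i (ltW si0).
  have f0 : (0 : R) < (i.+1)`!%:R by rewrite ltr0n fact_gt0.
  move=> h; rewrite mulrC -ler_pdivrMr //; apply: le_trans h; rewrite lerDr //.
rewrite mulrCA -ler_pdivrMl // -exprVn; apply: le_trans b.
by rewrite exprSr mulrC.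
Qed.

Lemma flat_sqr_bound i h : `|flat i h| <= (i.+2)`!%:R * `|h| * `|h|.
Proof.
have [h0|h0] := ltP 0 h; last by rewrite /flat ltNge h0 /= normr0 !mulr_ge0.
have -> : flat i h = h * flat i.+1 h.
  by rewrite /flat h0 mulrA exprS invfM mulrA mulfV ?mul1r // gt_eqF.
by rewrite normrM mulrC ler_wpM2r // flat_bound.
Qed.

Lemma is_derive_inv (s : R) : s != 0 -> is_derive s (1 : R) (fun s => s^-1) (- s ^- 2).
Proof.
move=> s0; apply: DeriveDef; first by apply: derivableV.
rewrite (deriveV (f := id)) // derive_id /GRing.scale /= mulr1 //.
Qed.

Lemma flat_derive i (s : R) : is_derive s (1 : R) (flat i) (flat i.+2 s - i%:R * flat i.+1 s).
Proof.
have [s0|s0|es] := ltgtP 0 s.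
- pose g (y : R) := y ^+ i * expR (- y).
  have n : \forall t \near s, g t^-1 = flat i t.
    by apply: filterS (open_near posR_open s0) => t /= t0; rewrite /flat t0 /g exprVn.
  apply: (near_eq_is_derive n).
  have d1 : is_derive s (1 : R) (fun s => s^-1) (- s ^- 2) by apply: is_derive_inv; rewrite gt_eqF.
  have d2 : is_derive s^-1 (1 : R) (fun y : R => y ^+ i) (i%:R * s^-1 ^+ i.-1).
    apply: DeriveDef; first exact: exprn_derivable.
    by rewrite -derive1E exp_derive1.
  have d3 : is_derive s^-1 (1 : R) (fun y : R => expR (- y)) (expR (- s^-1) * - 1).
    by apply: is_derive1_comp; exact: is_deriveNid.
  apply: is_derive_eq (is_derive1_comp (is_deriveM d2 d3) d1) _.
  rewrite /flat s0 -!exprVn /GRing.scale /= !exprS.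
  case: i {g n d2} => [|i] /=; first by rewrite !expr0; ring.
  by rewrite exprS; ring.
- have n : \forall t \near s, (fun=> 0) t = flat i t.
    apply: filterS (open_near (@open_lt _ 0) s0) => t /= t0.
    by rewrite /flat ltNge (ltW t0).
  apply: is_derive_eq (near_eq_is_derive n (is_derive_cst (0 : R) s 1)) _.
  by rewrite /flat ltNge (ltW s0) /= mulr0 subrr.
rewrite -{}es; pose L := 'd (fun=> 0 : R) (0 : R).
have L0 : L = (fun=> 0) :> (R -> R) by exact: diff_cst.
have f0 j : flat j 0 = 0 by rewrite /flat ltxx.
have [||d1 d2] := @is_diff_eps R R R (flat i) 0 L.
- exact: diff_continuous.
- move=> e e0; pose C : R := (i.+2)`!%:R.
  have C0 : 0 < C by rewrite ltr0n fact_gt0.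
  apply/nbhs_ballP; exists (e / C); first by rewrite /= divr_gt0.
  move=> h; rewrite -ball_normE /= sub0r normrN ltr_pdivlMr // => hC.
  rewrite addr0 f0 subr0 L0 subr0; apply: (le_trans (flat_sqr_bound i h)).
  by rewrite ler_wpM2r // mulrC ltW.
- rewrite !f0 mulr0 subrr; apply: DeriveDef; first exact: diff_derivable.
  by rewrite (deriveE _ d1) d2 L0.
Qed.

Lemma smooth_flat i : smooth_on [set: R] (flat i).
Proof.
move=> k; elim: k i => [|k IH] i.
  move=> s _; apply: differentiable_continuous; apply: derivable_real_differentiable.
  by have [] := flat_derive i s.
apply: (Ck_on_real_derive openT (fun s _ => flat_derive i s)).
have n : Ck_on k [set: R] (fun s => -1 * (i%:R * flat i.+1 s)).
  by do 2 (apply: (Ck_onM openT); first exact: Ck_on_cst).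
by apply: (eq_Ck_on openT _ (Ck_onD openT (IH i.+2) n)) => s _; rewrite mulN1r.
Qed.

(** The squares 9 / 16 and 1 / 4 belong to the radii 3 / 4, beyond which the
    function vanishes, and 1 / 2, up to which it is 1. *)
Definition bump (s : R) : R :=
  flat 0 (9 / 16 - s ^+ 2) / (flat 0 (9 / 16 - s ^+ 2) + flat 0 (s ^+ 2 - 1 / 4)).

Lemma flat0_gt0 s : 0 < s -> 0 < flat 0 s.
Proof. by move=> s0; rewrite /flat s0 expr0 invr1 mul1r expR_gt0. Qed.
Lemma flat0_ge0 s : 0 <= flat 0 s.
Proof. by rewrite /flat; case: ifP => // _; rewrite expr0 invr1 mul1r expR_ge0. Qed.
Lemma flat0_le0 s : s <= 0 -> flat 0 s = 0.
Proof. by rewrite /flat leNgt => /negPf ->. Qed.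

Lemma bump_den s : 0 < flat 0 (9 / 16 - s ^+ 2) + flat 0 (s ^+ 2 - 1 / 4).
Proof.
have [h|h] := ltP (s ^+ 2) (9 / 16).
  by rewrite ltr_pwDl ?flat0_ge0 // flat0_gt0 // subr_gt0.
by rewrite ltr_wpDl ?flat0_ge0 // flat0_gt0 //; lra.
Qed.

Lemma smooth_bump : smooth_on [set: R] bump.
Proof.
have s2 : smooth_on [set: R] (fun s : R => s ^+ 2) by apply: (smoothX openT); exact: smooth_idR.
have sc (t : R) : smooth_on [set: R] (fun=> t : R) by exact: smooth_cst.
have s3 := smooth_real_comp openT (U' := [set: R]) (fun _ _ => I) (smoothB openT (sc (9 / 16)) s2) (@smooth_flat 0).
have s4 := smooth_real_comp openT (U' := [set: R]) (fun _ _ => I) (smoothB openT s2 (sc (1 / 4))) (@smooth_flat 0).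
apply: (smooth_div openT _ s3 (smoothD openT s3 s4)) => s _.
by rewrite gt_eqF // bump_den.
Qed.

Lemma bump1 s : `|s| <= 1 / 2 -> bump s = 1.
Proof.
move=> h; have : s ^+ 2 <= 1 / 4.
  rewrite -real_normK ?num_real // (_ : 1 / 4 = (1 / 2) ^+ 2); last by rewrite expr2; lra.
  by rewrite lerXn2r // nnegrE //; lra.
move=> h2; rewrite /bump (flat0_le0 (s := s ^+ 2 - _)) ?subr_le0 // addr0 divff // gt_eqF // flat0_gt0 //; lra.
Qed.

Lemma bump0 s : 3 / 4 <= `|s| -> bump s = 0.
Proof.
move=> h; have : 9 / 16 <= s ^+ 2.
  rewrite -[s ^+ 2]real_normK ?num_real // (_ : 9 / 16 = (3 / 4) ^+ 2); last by rewrite expr2; lra.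
  by rewrite lerXn2r // nnegrE //; lra.
by move=> h2; rewrite /bump flat0_le0 ?subr_le0 // mul0r.
Qed.
End RealFunctions.

(** * Concatenation of functions, angle functions *)

Section Concatenation.
Variable R : realType.

Lemma slot_unique (s : R) (i j : nat) : `|s - 3 * i%:R| < 1 -> `|s - 3 * j%:R| < 1 -> i = j.
Proof.
wlog ij : i j / (i <= j)%N.
  by move=> h hi hj; have [le|/ltnW le] := leqP i j; [exact: h|apply/esym/h].
move=> hi hj; apply/eqP; rewrite eqn_leq ij leqNgt; apply/negP => lt.
have : (i.+1%:R : R) <= j%:R by rewrite ler_nat.
rewrite -natr1; move: hi hj; rewrite !ltr_norml => /andP[h1 h2] /andP[h3 h4] h5; lra.
Qed.

Lemma dist_open (a r : R) : open [set s : R | `|s - a| < r].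
Proof.
have -> : [set s : R | `|s - a| < r] = ball a r.
  by apply/seteqP; split=> s; rewrite -ball_normE /= distrC.
exact: ball_open.
Qed.

(** The i-th function, cut off by bump, is moved to the slot of radius 1 around
    3 i. The slots are disjoint, and the cut-off functions vanish near their ends. *)
Lemma concatenation (f : nat -> R -> R) :
  (forall i, smooth_on [set s : R | `|s| < 1] (f i)) ->
  exists2 F : R -> R, smooth_on [set: R] F &
    forall i s, `|s| < 1 / 2 -> F (3 * i%:R + s) = f i s.
Proof.
move=> sf.
pose F s := if pselect (exists i : nat, `|s - 3 * i%:R| < 1) is left h
  then bump (s - 3 * (sval (cid h))%:R) * f (sval (cid h)) (s - 3 * (sval (cid h))%:R) else 0.
have FE s i : `|s - 3 * i%:R| < 1 -> F s = bump (s - 3 * i%:R) * f i (s - 3 * i%:R).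
  move=> hi; rewrite /F; case: pselect => [h|[]]; last by exists i.
  by case: (cid h) => j /= hj; rewrite (slot_unique hi hj).
have F0 s : (forall i : nat, 3 / 4 <= `|s - 3 * i%:R|) -> F s = 0.
  move=> h; rewrite /F; case: pselect => // hi; case: (cid hi) => j /= hj.
  by rewrite bump0 // mul0r.
exists F; last first.
  move=> i s hs; have e : 3 * i%:R + s - 3 * i%:R = s by rewrite addrAC subrr add0r.
  by rewrite (FE _ i) e ?bump1 ?mul1r // ?ltW //; lra.
apply: smooth_on_local => s _; have [[i hi]|nh] := pselect (exists i : nat, `|s - 3 * i%:R| < 1).
  exists [set s : R | `|s - 3 * i%:R| < 1] => //; have oU := @dist_open (3 * i%:R) 1.
  have ss : smooth_on [set s : R | `|s - 3 * i%:R| < 1] (fun s => s - 3 * i%:R).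
    by apply: (smoothB oU); [exact: smooth_idR|exact: smooth_cst].
  apply: (eq_smooth_on oU (f := fun s => bump (s - 3 * i%:R) * f i (s - 3 * i%:R))).
    by move=> t ht; rewrite (FE t i ht).
  apply: (smoothM oU).
    exact: (smooth_real_comp oU (fun _ _ => I) ss (@smooth_bump R)).
  apply: (smooth_real_comp oU _ ss (sf i)) => t //.
exists [set t : R | `|t - s| < 1 / 4]; first by rewrite /= subrr normr0; lra.
apply: (eq_smooth_on (@dist_open s (1 / 4)) (f := fun=> 0)); last exact: smooth_cst.
move=> t /= ht; rewrite F0 // => i.
have hi : 1 <= `|s - 3 * i%:R| by rewrite leNgt; apply/negP => hi; apply: nh; exists i.
have := ler_distD t s (3 * i%:R); rewrite (distrC s t); lra.
Qed.
End Concatenation.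

Section Angle.
Variable R : realType.

Lemma cos_sin_surj (c s : R) : c ^+ 2 + s ^+ 2 = 1 -> exists t, cos t = c /\ sin t = s.
Proof.
move=> h; have c1 : -1 <= c <= 1.
  rewrite -ler_norml -(@ler_pXn2r _ 2) ?nnegrE // expr1n real_normK ?num_real // -h lerDl sqr_ge0 //.
have e : Num.sqrt (1 - c ^+ 2) = `|s| by rewrite -h addrAC subrr add0r sqrtr_sqr.
have [s0|s0] := leP 0 s.
  by exists (acos c); rewrite acosK ?in_itv //= sin_acos // e ger0_norm.
by exists (- acos c); rewrite cosN sinN acosK ?in_itv //= sin_acos // e ltr0_norm // opprK.
Qed.

Lemma cos_sin_atan (p r : R) : 0 < p -> p ^+ 2 + r ^+ 2 = 1 ->
  cos (atan (r / p)) = p /\ sin (atan (r / p)) = r.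
Proof.
move=> p0 h; have pn : p != 0 by rewrite gt_eqF.
have c : cos (atan (r / p)) = p.
  rewrite cos_atan (_ : 1 + (r / p) ^+ 2 = (p^-1) ^+ 2); last first.
    by rewrite expr_div_n -[1](@divff _ (p ^+ 2)) ?expf_neq0 // -mulrDl h mul1r exprVn.
  by rewrite sqrtr_sqr gtr0_norm ?invr_gt0 // invrK.
split=> //; have := atanK (r / p); rewrite /tan c => /(congr1 (fun t => t * p)).
by rewrite !divfK.
Qed.

(** If t0 is the angle of w at q0, then in the frame rotated by t0 the vector w
    has first component p > 0 near q0, and its angle is t0 + atan (r / p). *)
Lemma angle_exists (U : set 'rV[R]_2) (w : 'rV[R]_2 -> 'rV[R]_3) (e1 e2 ax : 'rV[R]_3) q0 :
  open U -> U q0 -> smooth_on U w ->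
  dot e1 e1 = 1 -> dot e2 e2 = 1 -> dot ax ax = 1 ->
  dot e1 e2 = 0 -> dot e1 ax = 0 -> dot e2 ax = 0 ->
  (forall q, U q -> dot (w q) (w q) = 1 /\ dot (w q) ax = 0) ->
  exists V phi, [/\ open V, V q0, V `<=` U, smooth_on V phi &
    forall q, V q -> w q = cos (phi q) *: e1 + sin (phi q) *: e2].
Proof.
move=> oU U0 sw e11 e22 aa e12 e1a e2a wu.
have nz (z : 'rV[R]_3) : dot z z = 1 -> z != 0 by move=> z1; rewrite -dot_eq0 z1 oner_neq0.
have wE q : U q -> w q = dot (w q) e1 *: e1 + dot (w q) e2 *: e2.
  move=> Uq; have [_ wa] := wu q Uq.
  rewrite {1}(ortho3_decomp (w q) (nz _ e11) (nz _ e22) (nz _ aa) e12 e1a e2a) wa mul0r scale0r addr0.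
  by rewrite e11 e22 !divr1.
have w1 q : U q -> dot (w q) e1 ^+ 2 + dot (w q) e2 ^+ 2 = 1.
  move=> Uq; have [<- _] := wu q Uq; rewrite {3 4}(wE _ Uq) dot_comb2 e11 e22 e12; ring.
have [t0 [c0 s0]] := cos_sin_surj (w1 q0 U0).
pose p q := cos t0 * dot (w q) e1 + sin t0 * dot (w q) e2.
pose r q := - sin t0 * dot (w q) e1 + cos t0 * dot (w q) e2.
have cs : cos t0 * cos t0 + sin t0 * sin t0 = 1 by rewrite -!expr2 cos2Dsin2.
have pr q : U q -> p q ^+ 2 + r q ^+ 2 = 1.
  move=> Uq; rewrite -[RHS](w1 q Uq) -[RHS]mul1r -cs /p /r; ring.
have sd (z : 'rV[R]_3) : smooth_on U (fun q => dot (w q) z).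
  by apply: (smooth_dot oU) => //; exact: smooth_cst.
have sl (a b : R) : smooth_on U (fun q => a * dot (w q) e1 + b * dot (w q) e2).
  by apply: (smoothD oU); apply: (smoothM oU) => //; exact: smooth_cst.
have sp : smooth_on U p by exact: sl.
have sr : smooth_on U r by exact: sl.
pose V := [set q | U q /\ 0 < p q].
have oV : open V.
  rewrite openE => q [Uq pq]; rewrite /interior.
  have cp := smooth_continuous sp Uq.
  have n : \forall z \near q, `|p q - p z| < p q by exact: (proj1 (cvgrPdist_lt _ _) cp _ pq).
  apply: filterS2 (open_near oU Uq) n => z Uz; rewrite ltr_norml => /andP[_ h]; split=> //.
  by move: h; rewrite ltrBlDr ltrDl.
have VU : V `<=` U by move=> q [].
exists V, (fun q => t0 + atan (r q / p q)); split=> //.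
- by split=> //; rewrite /p -c0 -s0 cs.
- apply: (smoothD oV); first exact: smooth_cst.
  apply: (smooth_real_comp oV (fun _ _ => I) _ (@smooth_atan R)).
  apply: (smooth_div oV) => [q [_ /gt_eqF -> //]||]; exact: smooth_on_subset VU _.
move=> q [Uq pq]; have [c s] := cos_sin_atan pq (pr q Uq).
rewrite {1}(wE q Uq) cosD sinD c s; congr (_ *: _ + _ *: _).
  rewrite -[LHS]mul1r -cs /p /r; ring.
rewrite -[LHS]mul1r -cs /p /r; ring.
Qed.
End Angle.

(** * Rotational form about an axis *)

Section AxisForm.
Variables (R : realType) (I J : set R).
Hypotheses (oI : open_interval I) (oJ : open_interval J).
Local Notation U := (box I J).
Variables (w2 : 'rV[R]_2).
Hypotheses (w2E : w2 = dir2 R).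
Local Notation D2 f := (pd w2 f).
Local Notation d2 f := (sd w2 f).
Variables (x n : 'rV[R]_2 -> 'rV[R]_3) (k : 'rV[R]_2 -> R) (ctr ax : 'rV[R]_3).
Hypotheses (sx : smooth_on U x) (sn : smooth_on U n).
Hypothesis x2n : forall q, U q -> dot (D2 x q) (n q) = 0.
Hypothesis x20 : forall q, U q -> D2 x q != 0.
Hypothesis n2E : forall q, U q -> D2 n q = - k q *: D2 x q.
Hypothesis ax0 : ax != 0.
Hypothesis axisP : forall q, U q -> dot (D2 x q) ax = 0 /\ dot (x q - ctr) (D2 x q) = 0.
Let oU : open U := box_open oI oJ.
Let sx2 : smooth_on U (D2 x) := smooth_pd w2 sx.
Let sc : smooth_on U (fun=> ctr) := smooth_cst U ctr.
Let sxc : smooth_on U (fun q => x q - ctr) := smoothBv oU sx sc.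

(** At q0 the vectors x_v and x_vv are orthogonal to ax and B and are linearly
    independent: x_vv has a nonzero component along the radial vector u. So B is a
    multiple of ax. *)
Lemma axis_rigid (V : set 'rV[R]_2) q0 B : open V -> V `<=` U -> V q0 ->
  (forall q, V q -> dot (D2 x q) B = 0) -> forall q, U q -> dot (D2 x q) B = 0.
Proof.
move=> oV VU V0 VB; have U0 := VU _ V0.
have aa : dot ax ax != 0 by rewrite dot_eq0.
pose y := D2 (D2 x) q0; pose z := x q0 - ctr.
pose u := z - (dot z ax / dot ax ax) *: ax.
have sV f : smooth_on U f -> smooth_on V (f : _ -> 'rV[R]_3) := smooth_on_subset VU.
have yB : dot y B = 0.
  by have := sd_eq0 oV w2 V0 VB; rewrite (sd_dotc oV _ _ (sV _ sx2) V0).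
have ya : dot y ax = 0.
  have := sd_eq0 oU w2 U0 (fun q Uq => (axisP Uq).1).
  by rewrite (sd_dotc oU _ _ sx2 U0).
have zy : dot y z = - dot (D2 x q0) (D2 x q0).
  have := sd_eq0 oU w2 U0 (fun q Uq => (axisP Uq).2).
  rewrite (sd_dot oU _ sxc sx2 U0) (pdB _ sx sc U0) pd_cst subr0 -/y -/z (dotC z); lra.
have uy : dot y u = - dot (D2 x q0) (D2 x q0).
  by rewrite /u dotDr dotNr dotZr ya mulr0 subr0.
have G0 : dot (D2 x q0) (D2 x q0) != 0 by rewrite dot_eq0 x20.
have u0 : u != 0 by apply: contraNneq G0 => u0; rewrite -oppr_eq0 -uy u0 dot0r.
have [xa xz] := axisP U0.
have ua : dot u ax = 0 by rewrite /u dotDl dotNl dotZl divfK // subrr.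
have xu : dot (D2 x q0) u = 0 by rewrite /u dotDr dotNr dotZr xa mulr0 subr0 dotC.
have au : dot ax u = 0 by rewrite dotC.
have dB := ortho3_decomp B (x20 U0) ax0 u0 xa xu au.
rewrite (dotC B (D2 x q0)) VB // mul0r scale0r add0r in dB.
have Bu : dot B u = 0.
  move: yB; rewrite {1}dB dot_comb ya mulr0 add0r uy mulrN => /eqP.
  rewrite oppr_eq0 mulf_eq0 (negPf G0) orbF mulf_eq0 invr_eq0 dot_eq0 (negPf u0) orbF.
  by move/eqP.
rewrite Bu mul0r scale0r addr0 in dB.
by move=> q Uq; rewrite dB dotZr (axisP Uq).1 mulr0.
Qed.

Hypothesis ax1 : dot ax ax = 1.

(** The radial vector rad has constant length along each circle, and n is a
    combination of rad and ax with coefficients constant along the circle. So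
    x - t n differs from x only in the radius and the height. *)
Lemma rotational_form (t : R) : exists (r h : 'rV[R]_2 -> R) (w : 'rV[R]_2 -> 'rV[R]_3),
  [/\ [/\ smooth_on U r, smooth_on U h & smooth_on U w], vconst I J r, vconst I J h,
     (forall q, U q -> [/\ dot (w q) (w q) = 1, dot (w q) ax = 0 & D2 w q != 0]) &
     forall q, U q -> x q - t *: n q = ctr + (r q *: w q + h q *: ax)].
Proof.
have sax : smooth_on U (fun=> ax) := smooth_cst U ax.
pose et q := dot (x q - ctr) ax; have set_ : smooth_on U et := smooth_dot oU sxc sax.
pose rad q := x q - ctr - et q *: ax.
have srad : smooth_on U rad := smoothBv oU sxc (smoothZ oU set_ sax).
have Dxc q : U q -> D2 (fun q => x q - ctr) q = D2 x q.
  by move=> Uq; rewrite (pdB _ sx sc Uq) pd_cst subr0.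
have et2 q : U q -> d2 et q = 0.
  by move=> Uq; rewrite (sd_dotc oU _ _ sxc Uq) Dxc //; have [] := axisP Uq.
have vet : vconst I J et := d2_vconst oI oJ w2E set_ et2.
have rad2 q : U q -> D2 rad q = D2 x q.
  move=> Uq; rewrite (pdB _ sxc (smoothZ oU set_ sax) Uq) (pdZ _ set_ sax Uq) Dxc //.
  by rewrite et2 // pd_cst scaler0 scale0r addr0 subr0.
have rada q : dot (rad q) ax = 0.
  by rewrite /rad dotDl dotNl dotZl ax1 mulr1 subrr.
have radx q : U q -> dot (rad q) (D2 x q) = 0.
  move=> Uq; have [a1 a2] := axisP Uq.
  by rewrite /rad dotDl dotNl dotZl a2 (dotC ax) a1 mulr0 subrr.
pose rr q := dot (rad q) (rad q); have srr : smooth_on U rr := smooth_dot oU srad srad.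
have vrr : vconst I J rr.
  apply: (d2_vconst oI oJ w2E srr) => q Uq.
  by rewrite (sd_dot oU _ srad srad Uq) rad2 // (dotC (D2 x q)) radx // addr0.
have rr0 q : U q -> 0 < rr q.
  move=> Uq; apply: dot_gt0; apply/eqP => r0.
  have : D2 rad q = 0.
    rewrite w2E; apply: (pd_vline oU (w := 0) srad Uq) => q' Uq' e.
    by apply/eqP; rewrite -dot_eq0 -/(rr q') (vrr _ _ Uq' Uq e) /rr r0 dot0l.
  by rewrite rad2 // => /eqP; rewrite (negPf (x20 Uq)).
pose ro q := Num.sqrt (rr q).
have sro : smooth_on U ro := smooth_real_comp oU rr0 srr (@smooth_sqrt R).
have ro0 q : U q -> 0 < ro q by move=> Uq; rewrite sqrtr_gt0 rr0.
have ron q : U q -> ro q != 0 by move=> Uq; rewrite gt_eqF // ro0.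
have vro : vconst I J ro by move=> q q' Uq Uq' e; rewrite /ro (vrr _ _ Uq Uq' e).
have sroi : smooth_on U (fun q => (ro q)^-1) := smoothV oU ron sro.
pose w q := (ro q)^-1 *: rad q; have sw : smooth_on U w := smoothZ oU sroi srad.
have Dw q : U q -> D2 w q = (ro q)^-1 *: D2 x q.
  move=> Uq; rewrite (pdZ _ sroi srad Uq) rad2 // (vconst_d2 oI oJ w2E sroi _ Uq) ?scale0r ?add0r //.
  by move=> p p' Up Up' e; rewrite (vro _ _ Up Up' e).
have rww q : U q -> rad q = ro q *: w q.
  by move=> Uq; rewrite /w scalerA divff ?scale1r // ron.
pose a1 q := dot (n q) (rad q) / rr q; pose b1 q := dot (n q) ax.
have snr : smooth_on U (fun q => dot (n q) (rad q)) := smooth_dot oU sn srad.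
have rrn q : U q -> rr q != 0 by move=> Uq; rewrite gt_eqF // rr0.
have sa1 : smooth_on U a1 := smooth_div oU rrn snr srr.
have sb1 : smooth_on U b1 := smooth_dot oU sn sax.
have vb1 : vconst I J b1.
  apply: (d2_vconst oI oJ w2E sb1) => q Uq.
  by rewrite (sd_dotc oU _ _ sn Uq) n2E // dotZl (axisP Uq).1 mulr0.
have vnr : vconst I J (fun q => dot (n q) (rad q)).
  apply: (d2_vconst oI oJ w2E snr) => q Uq.
  by rewrite (sd_dot oU _ sn srad Uq) n2E // rad2 // dotZl (dotC (D2 x q)) radx // (dotC (n q)) x2n // mulr0 addr0.
have va1 : vconst I J a1 by move=> q q' Uq Uq' e; rewrite /a1 (vrr _ _ Uq Uq' e) (vnr _ _ Uq Uq' e).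
have nE q : U q -> n q = a1 q *: rad q + b1 q *: ax.
  move=> Uq; have rn : rad q != 0 by rewrite -dot_eq0 -/(rr q) rrn.
  have xr : dot (D2 x q) (rad q) = 0 by rewrite dotC radx.
  rewrite {1}(ortho3_decomp (n q) (x20 Uq) rn ax0 xr (axisP Uq).1 (rada q)).
  by rewrite (dotC (n q) (D2 x q)) x2n // mul0r scale0r add0r ax1 divr1.
have s1 (f : 'rV[R]_2 -> R) : smooth_on U f -> smooth_on U (fun q => t * f q).
  by move=> sf; exact: (smoothM oU (smooth_cst U t) sf).
exists (fun q => (1 - t * a1 q) * ro q), (fun q => et q - t * b1 q), w; split.
- split=> //; last exact: (smoothB oU set_ (s1 _ sb1)).
  exact: (smoothM oU (smoothB oU (smooth_cst U (1 : R)) (s1 _ sa1)) sro).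
- by move=> q q' Uq Uq' e; rewrite (va1 _ _ Uq Uq' e) (vro _ _ Uq Uq' e).
- by move=> q q' Uq Uq' e; rewrite (vet _ _ Uq Uq' e) (vb1 _ _ Uq Uq' e).
- move=> q Uq; split.
  + rewrite /w dotZl dotZr -/(rr q) mulrA -invfM -expr2 sqr_sqrtr ?mulVf ?rrn //.
    by rewrite ltW // rr0.
  + by rewrite /w dotZl rada mulr0.
  + by rewrite Dw // scaler_eq0 negb_or invr_eq0 ron // x20.
move=> q Uq; rewrite -scalerA -rww // {1}nE //.
have -> : x q = ctr + (rad q + et q *: ax) by rewrite /rad subrK addrC subrK.
move: (rad q) (et q) (a1 q) (b1 q) => u1 u2 u3 u4.
apply/rowP => j; rewrite !mxE; ring.
Qed.
End AxisForm.

(** * Charts and coordinate changes *)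

Section Charts.
Variables (R : realType) (T : topologicalType).
Implicit Types (d : chart R T).

Lemma chart_preimage_open d (A : set T) : open A -> open (cimg d `&` cinv d @^-1` A).
Proof.
move=> oA; rewrite openE => q [iq Aq]; rewrite /interior.
have n : \forall z \near q, A (cinv d z) by exact: (cinv_continuous iq (open_nbhs_nbhs (conj oA Aq))).
by apply: filterS2 (open_near (@cimg_open _ _ d) iq) n => z zi zA.
Qed.

Lemma chart_image_open d (B : set 'rV[R]_2) : open B -> open (cdom d `&` cmap d @^-1` B).
Proof.
move=> oB; rewrite openE => p [dp Bp]; rewrite /interior.
have n : \forall z \near p, B (cmap d z) by exact: (cmap_continuous dp (open_nbhs_nbhs (conj oB Bp))).
have n' : \forall z \near p, cdom d z by exact: (open_nbhs_nbhs (conj (@cdom_open _ _ d) dp)).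
by apply: filterS2 n' n => z zi zA.
Qed.
End Charts.

Section Jacobians.
Variable R : realType.

Lemma jacobianP l m (f : 'rV[R]_l -> 'rV[R]_m) q A : differentiable f q ->
  (forall v, 'D_v f q = v *m A) -> 'J f q = A.
Proof.
move=> df h; apply/row_matrixP => i; rewrite !rowE -(deriveEjacobian _ df).
exact: h.
Qed.

Lemma jacobian_comp l m r (f : 'rV[R]_l -> 'rV[R]_m) (g : 'rV[R]_m -> 'rV[R]_r) q :
  differentiable f q -> differentiable g (f q) ->
  'J (g \o f) q = 'J f q *m 'J g (f q).
Proof.
move=> df dg; apply: jacobianP; first exact: differentiable_comp.
move=> v; rewrite (derive_comp v df dg) (deriveEjacobian _ dg) (deriveEjacobian _ df).
by rewrite mulmxA.
Qed.

Lemma jacobian_eq l m (U : set 'rV[R]_l) (f g : 'rV[R]_l -> 'rV[R]_m) q : open U -> U q ->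
  differentiable f q -> (forall p, U p -> f p = g p) -> 'J f q = 'J g q.
Proof.
move=> oU Uq df fg; have dg : differentiable g q.
  by apply: near_eq_differentiable df; exact: eq_on_near fg.
apply: jacobianP => // v; rewrite (eq_on_derive v oU Uq fg).
exact: deriveEjacobian.
Qed.

Lemma jacobian_id m (q : 'rV[R]_m) : 'J (id : 'rV[R]_m -> 'rV[R]_m) q = 1%:M.
Proof.
apply: jacobianP; first by [].
by move=> v; rewrite derive_id mulmx1.
Qed.
End Jacobians.

Lemma conj_weingarten (R : realType) (P A : 'M[R]_2) (N X N' X' : 'M[R]_(2, 3)) : P \in unitmx ->
  N = P *m N' -> X = P *m X' -> N' = - (A *m X') -> N = - (P *m A *m invmx P *m X).
Proof. by move=> Pu -> -> ->; rewrite mulmxN -!mulmxA mulKmx. Qed.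

Section SurfaceCharts.
Variables (R : realType) (S : smooth_surface R).
Implicit Types (d : chart R S).

Lemma atlas_coordinates d : atlas d -> coordinates d.
Proof. by move=> ad c ac; exact: atlas_compatible. Qed.

Definition overlap d d' : set 'rV[R]_2 := cimg d `&` cinv d @^-1` cdom d'.
Lemma overlap_open d d' : open (overlap d d').
Proof. exact: chart_preimage_open (@cdom_open _ _ d'). Qed.

Lemma smooth_in_coordinates m (f : S -> 'rV[R]_m) d : smooth_map f -> coordinates d ->
  smooth_on (cimg d) (f \o cinv d).
Proof.
move=> sf cd; apply: smooth_on_local => q iq.
have [c ac cq] := atlas_cover (cinv d q).
exists (overlap d c) => //; have oV := @overlap_open d c.
have [_ s1] := cd c ac.
apply: (eq_smooth_on oV (f := fun q => (f \o cinv c) ((cmap c \o cinv d) q))).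
  by move=> z [iz /= cz]; rewrite /= cmapK.
apply: (smooth_rV_comp oV _ s1 (sf c ac)).
by move=> z [iz /= cz]; exact: cmap_img.
Qed.

Lemma transition_smooth d d' : coordinates d -> coordinates d' ->
  smooth_on (overlap d d') (cmap d' \o cinv d).
Proof.
move=> cd cd'; apply: smooth_on_local => q [iq /= dq].
have [c ac cq] := atlas_cover (cinv d q).
pose V := overlap d c `&` overlap d d'.
have oV : open V by apply: openI; exact: overlap_open.
exists V; first by [].
have [_ s1] := cd c ac; have [s2 _] := cd' c ac.
have s1V : smooth_on V (cmap c \o cinv d) by apply: smooth_on_subset s1 => z [].
apply: (eq_smooth_on oV (f := fun q => (cmap d' \o cinv c) ((cmap c \o cinv d) q))).
  by move=> z [[iz /= cz] _]; rewrite /= cmapK.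
apply: (smooth_rV_comp oV _ s1V s2).
by move=> z [[iz /= cz] [_ /= dz]]; split; [exact: cmap_img|rewrite /= cmapK].
Qed.

Lemma transition_overlap d d' q : overlap d d' q -> overlap d' d (cmap d' (cinv d q)).
Proof.
by move=> [iq /= dq]; split; [exact: cmap_img|rewrite /= cmapK //; exact: cinv_dom].
Qed.

Lemma transition_jacobian_unit d d' q : coordinates d -> coordinates d' -> overlap d d' q ->
  'J (cmap d' \o cinv d) q \in unitmx.
Proof.
move=> cd cd' oq; have oV := @overlap_open d d'.
have d1 := smooth_differentiable (transition_smooth cd cd') oq.
have d2 := smooth_differentiable (transition_smooth cd' cd) (transition_overlap oq).
have E : 'J ((cmap d \o cinv d') \o (cmap d' \o cinv d)) q = 1%:M.
  rewrite -(jacobian_id q); apply: (jacobian_eq oV oq).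
    exact: (@differentiable_comp _ _ _ _ (cmap d' \o cinv d) (cmap d \o cinv d')).
  by move=> z [iz /= dz]; rewrite /= cmapK // cinvK.
have E2 := etrans (esym (jacobian_comp d1 d2)) E.
exact: (proj1 (mulmx1_unit E2)).
Qed.

Lemma coordinate_change m (f : S -> 'rV[R]_m) d d' q : smooth_map f ->
  coordinates d -> coordinates d' -> overlap d d' q ->
  'J (f \o cinv d) q = 'J (cmap d' \o cinv d) q *m 'J (f \o cinv d') (cmap d' (cinv d q)).
Proof.
move=> sf cd cd' oq; have oV := @overlap_open d d'; have [iq /= dq] := oq.
have d1 := smooth_differentiable (transition_smooth cd cd') oq.
have d2 := smooth_differentiable (smooth_in_coordinates sf cd') (cmap_img dq).
have d3 := smooth_differentiable (smooth_in_coordinates sf cd) iq.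
have E2 := jacobian_comp d1 d2; apply: etrans E2.
apply: (jacobian_eq oV oq d3) => z [iz /= dz].
by rewrite /= cmapK.
Qed.

Section Fronts.
Variables (x n : S -> 'rV[R]_3).
Hypothesis fr : front x n.

Lemma front_smooth : smooth_map x /\ smooth_map n. Proof. by have [] := fr. Qed.

Lemma front_tangent d q v : coordinates d -> cimg d q -> dot (v *m 'J (x \o cinv d) q) (n (cinv d q)) = 0.
Proof.
move=> cd iq; have [sx sn _ tg] := fr.
have [c ac cq] := atlas_cover (cinv d q).
rewrite (coordinate_change sx cd (atlas_coordinates ac) (conj iq cq)) mulmxA.
have dx := smooth_differentiable (sx c ac) (cmap_img cq).
by rewrite -(deriveEjacobian _ dx) -{2}(cmapK cq); exact: (tg c ac _ (cmap_img cq)).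
Qed.

Lemma front_normal d q v : coordinates d -> cimg d q -> dot (v *m 'J (n \o cinv d) q) (n (cinv d q)) = 0.
Proof.
move=> cd iq; have [sx sn nn tg] := fr.
have snd := smooth_in_coordinates sn cd.
have E : sd v (fun q => dot ((n \o cinv d) q) ((n \o cinv d) q)) q = 0.
  by rewrite (sd_eq (@cimg_open _ _ d) v iq (t := fun=> 1)) ?sd_cst // => p _; exact: nn.
rewrite (sd_dot (@cimg_open _ _ d) v snd snd iq) pdE (deriveEjacobian _ (smooth_differentiable snd iq)) in E.
rewrite (dotC ((n \o cinv d) q)) -mulr2n in E; move/eqP: E; rewrite mulrn_eq0 /= => /eqP; exact.
Qed.

Lemma immersion_transfer d d' q : coordinates d -> coordinates d' -> overlap d d' q ->
  immersion_at (x \o cinv d') (cmap d' (cinv d q)) -> immersion_at (x \o cinv d) q.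
Proof.
move=> cd cd' oq; rewrite /immersion_at (coordinate_change front_smooth.1 cd cd' oq) => rf.
have Pu := transition_jacobian_unit cd cd' oq.
by rewrite /row_free eqmxMfull ?row_full_unit.
Qed.

Lemma front_weingarten d q : coordinates d -> cimg d q -> immersion_at (x \o cinv d) q ->
  'J (n \o cinv d) q = - (shape (x \o cinv d) (n \o cinv d) q *m 'J (x \o cinv d) q).
Proof.
move=> cd iq im; have [_ _ nn _] := fr; apply: weingarten_eq => //.
- exact: nn.
- by move=> v; exact: front_tangent.
- by move=> v; exact: front_normal.
Qed.

(** The Jacobian of the coordinate change conjugates the two shape matrices. *)
Lemma char_poly_shape_change d d' q : coordinates d -> coordinates d' -> overlap d d' q ->
  immersion_at (x \o cinv d') (cmap d' (cinv d q)) ->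
  char_poly (shape (x \o cinv d) (n \o cinv d) q) =
  char_poly (shape (x \o cinv d') (n \o cinv d') (cmap d' (cinv d q))).
Proof.
move=> cd cd' oq im'; have im := immersion_transfer cd cd' oq im'; have [iq /= dq] := oq.
have [sx sn] := front_smooth; have Pu := transition_jacobian_unit cd cd' oq.
apply: etrans _ (char_poly_conj _ Pu); apply: congr1; apply: (shape_unique im).
exact: (conj_weingarten Pu (coordinate_change sn cd cd' oq) (coordinate_change sx cd cd' oq)
  (front_weingarten cd' (cmap_img dq) im')).
Qed.
End Fronts.
End SurfaceCharts.

(** * Foliated charts and connectedness *)

Section FoliatedChart.
Variables (R : realType) (S : smooth_surface R) (x n : S -> 'rV[R]_3).
Hypothesis im : immersed_surface x n.
Variables (d : chart R S) (I J : set R).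
Hypotheses (cd : coordinates d) (imgE : cimg d = box I J).
Local Notation U := (box I J).
Local Notation xd := (x \o cinv d).
Local Notation nd := (n \o cinv d).

Lemma immersed_coordinates q : cimg d q -> immersion_at xd q.
Proof.
move=> iq; have [c ac cq] := atlas_cover (cinv d q).
apply: (immersion_transfer (proj1 im) cd (atlas_coordinates ac) (conj iq cq)).
exact: (proj2 im (cinv d q) c ac cq).
Qed.

(** The second coordinate direction of a foliated chart is principal, so the
    shape matrix is triangular and its diagonal entries are the principal
    curvatures along and across the leaves. *)
Definition leaf_curvature q := shape xd nd q 1 1.
Definition cross_curvature q := shape xd nd q 0 0.

Hypothesis prin : forall q, U q -> principal_direction xd nd q (dir2 R).

Lemma box_in_image q : U q -> cimg d q. Proof. by rewrite imgE. Qed.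
Lemma chart_x_smooth : smooth_on U xd.
Proof. by rewrite -imgE; exact: smooth_in_coordinates (proj1 (front_smooth (proj1 im))) cd. Qed.
Lemma chart_n_smooth : smooth_on U nd.
Proof. by rewrite -imgE; exact: smooth_in_coordinates (proj2 (front_smooth (proj1 im))) cd. Qed.
Lemma chart_n_unit q : U q -> dot (nd q) (nd q) = 1.
Proof. by move=> _; have [[_ _ nn _] _] := im; exact: nn. Qed.
Lemma chart_pd_x v q : U q -> pd v xd q = v *m 'J xd q.
Proof. by move=> Uq; rewrite pdE (deriveEjacobian _ (smooth_differentiable chart_x_smooth Uq)). Qed.
Lemma chart_pd_n v q : U q -> pd v nd q = v *m 'J nd q.
Proof. by move=> Uq; rewrite pdE (deriveEjacobian _ (smooth_differentiable chart_n_smooth Uq)). Qed.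
Lemma chart_x_tangent v q : U q -> dot (pd v xd q) (nd q) = 0.
Proof. by move=> Uq; rewrite chart_pd_x //; exact: (front_tangent (proj1 im) _ cd (box_in_image Uq)). Qed.
Lemma chart_x_free q : U q -> forall s t, s *: pd (dir1 R) xd q + t *: pd (dir2 R) xd q = 0 -> s = 0 /\ t = 0.
Proof.
move=> Uq s t; rewrite !chart_pd_x // /dir1 /dir2 -!rowE.
exact: (proj1 (row_free2 _) (immersed_coordinates (box_in_image Uq))).
Qed.
Lemma chart_weingarten q : U q -> 'J nd q = - (shape xd nd q *m 'J xd q).
Proof. by move=> Uq; exact: (front_weingarten (proj1 im) cd (box_in_image Uq) (immersed_coordinates (box_in_image Uq))). Qed.
Lemma shape_triangular q : U q -> shape xd nd q 1 0 = 0.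
Proof.
move=> /prin[_ [k]]; rewrite /dir2 -rowE; move: (shape xd nd q) => A /rowP/(_ 0).
by rewrite !mxE /= mulr0.
Qed.
Lemma chart_n_dir2 q : U q -> pd (dir2 R) nd q = - leaf_curvature q *: pd (dir2 R) xd q.
Proof.
move=> Uq; rewrite chart_pd_n // chart_pd_x // chart_weingarten // mulmxN mulmxA scaleNr; congr (- _).
have -> : dir2 R *m shape xd nd q = leaf_curvature q *: dir2 R.
  move: (shape_triangular Uq); rewrite /leaf_curvature; move: (shape xd nd q) => A A10.
  by rewrite /dir2 -rowE; apply: rV2P; rewrite !mxE /= ?mulr0 ?mulr1.
by rewrite -scalemxAl.
Qed.
Lemma chart_n_dir1 q : U q -> exists mu, pd (dir1 R) nd q =
  - (cross_curvature q *: pd (dir1 R) xd q + mu *: pd (dir2 R) xd q).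
Proof.
move=> Uq; exists (shape xd nd q 0 1).
rewrite chart_pd_n // !chart_pd_x // chart_weingarten // mulmxN mulmxA; congr (- _).
have -> : dir1 R *m shape xd nd q = cross_curvature q *: dir1 R + shape xd nd q 0 1 *: dir2 R.
  rewrite /cross_curvature; move: (shape xd nd q) => A.
  by rewrite {1}/dir1 -rowE; apply: rV2P; rewrite !mxE /= ?mulr0 ?mulr1 ?addr0 ?add0r.
by rewrite mulmxDl -!scalemxAl.
Qed.
Lemma leaf_char_poly q : U q ->
  char_poly (shape xd nd q) = ('X - (leaf_curvature q)%:P) * ('X - (cross_curvature q)%:P).
Proof.
move=> Uq; apply/char_poly2E; rewrite det_mx22 shape_triangular // mulr0 subr0 mulrC; split=> //.
rewrite /mxtrace !big_ord_recl big_ord0 addr0 addrC.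
by rewrite (_ : lift ord0 ord0 = 1) //; exact: val_inj.
Qed.

Lemma chart_circles : (forall q, U q -> in_circle (x @` plaque d q)) ->
  forall q, U q -> exists o m rho, [/\ m != 0, (0 : R) < rho &
    forall q', U q' -> q' 0 0 = q 0 0 ->
    dot (xd q' - o) (xd q' - o) = rho ^+ 2 /\ dot (xd q' - o) m = 0].
Proof.
move=> circ q Uq; have [ctr [m [rho [m0 rho0 C]]]] := circ q Uq.
exists ctr, m, rho; split=> // q' Uq' e; apply: C.
exists (cinv d q') => //; exists q' => //; split=> //.
exact: box_in_image.
Qed.
End FoliatedChart.

Section Connected.
Variables (R : realType) (S : smooth_surface R) (F : set (chart R S)).
Hypothesis Fcover : forall p, exists2 d, F d & cdom d p.

(** The set where P holds and its complement are unions of chart domains, so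
    both are open. *)
Lemma leafwise_global (P : S -> Prop) :
  (forall d, F d -> forall p p', cdom d p -> cdom d p' -> P p -> P p') ->
  (exists p, P p) -> forall p, P p.
Proof.
move=> loc ex p.
have oP (Q : S -> Prop) : (forall d, F d -> forall p p', cdom d p -> cdom d p' -> Q p -> Q p') ->
    open [set p | Q p].
  move=> locQ; rewrite openE => q Qq; have [d Fd dq] := Fcover q.
  have : \forall z \near q, cdom d z by exact: (open_nbhs_nbhs (conj (@cdom_open _ _ d) dq)).
  by apply: filterS => z dz; exact: (locQ d Fd q z).
have o1 := oP P loc.
have o2 : open [set p | ~ P p].
  apply: oP => d Fd q q' dq dq' nP Pq'; apply: nP; exact: loc Fd _ _ dq' dq Pq'.
have B : [set p | P p] = [set: S].
  apply: (@surface_connected _ S).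
  - by have [q Pq] := ex; exists q.
  - by exists [set p | P p] => //; rewrite setTI.
  - exists [set p | P p]; last by rewrite setTI.
    rewrite -[X in closed X]setCK; exact: open_closedC.
by have : [set: S] p by []; rewrite -B.
Qed.
End Connected.

Section Recharting.
Variables (R : realType) (S : smooth_surface R).

(** A diffeomorphism f from A to B, with inverse g, changes the coordinates on
    part of a chart. *)
Lemma rechart (d : chart R S) (A B : set 'rV[R]_2) (f g : 'rV[R]_2 -> 'rV[R]_2) :
  coordinates d -> open A -> open B -> A `<=` cimg d ->
  smooth_on A f -> smooth_on B g ->
  (forall q, A q -> B (f q) /\ g (f q) = q) -> (forall w, B w -> A (g w) /\ f (g w) = w) ->
  exists d' : chart R S, [/\ coordinates d', cdom d' = cdom d `&` cmap d @^-1` A, cimg d' = B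
    & forall w, B w -> cinv d' w = cinv d (g w)].
Proof.
move=> cd oA oB Ad sf sg fA gB.
have h1 : open (cdom d `&` cmap d @^-1` A) by exact: chart_image_open.
have h2 p : (cdom d `&` cmap d @^-1` A) p -> B (f (cmap d p)) by move=> [_ /= /fA[]].
have h3 w : B w -> (cdom d `&` cmap d @^-1` A) (cinv d (g w)).
  move=> /gB[Ag _]; split; first exact/cinv_dom/Ad.
  by rewrite /= cinvK //; exact: Ad.
have h4 p : (cdom d `&` cmap d @^-1` A) p -> cinv d (g (f (cmap d p))) = p.
  by move=> [dp /= Ap]; have [_ ->] := fA _ Ap; rewrite cmapK.
have h5 w : B w -> f (cmap d (cinv d (g w))) = w.
  by move=> /gB[Ag e]; rewrite cinvK //; exact: Ad.
have h6 p : (cdom d `&` cmap d @^-1` A) p -> {for p, continuous (fun p => f (cmap d p))}.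
  move=> [dp /= Ap]; apply: (@continuous_comp _ _ _ (cmap d) f); first exact: cmap_continuous.
  exact: smooth_continuous sf Ap.
have h7 w : B w -> {for w, continuous (fun w => cinv d (g w))}.
  move=> Bw; apply: (@continuous_comp _ _ _ g (cinv d)); first exact: smooth_continuous sg Bw.
  by apply: cinv_continuous; apply: Ad; have [] := gB w Bw.
exists (Chart h1 oB h2 h3 h4 h5 h6 h7); split=> // c ac.
have [s1 s2] := cd c ac; split=> /=.
  pose V := cimg c `&` cinv c @^-1` (cdom d `&` cmap d @^-1` A).
  have oV : open V by exact: chart_preimage_open.
  have VA q : V q -> A ((cmap d \o cinv c) q) by move=> [_ [_]].
  have sV : smooth_on V (cmap d \o cinv c) by apply: smooth_on_subset s1 => q [iq [dq _]].
  exact: (smooth_rV_comp oV VA sV sf).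
pose V := B `&` (fun w => cinv d (g w)) @^-1` cdom c.
have oV : open V by exact: (chart_preimage_open (d := Chart h1 oB h2 h3 h4 h5 h6 h7) (@cdom_open _ _ c)).
have VA w : V w -> (cimg d `&` cinv d @^-1` cdom c) (g w).
  by move=> [Bw cw]; split=> //; apply: Ad; have [] := gB w Bw.
have sV : smooth_on V g by apply: smooth_on_subset sg => w [].
exact: (smooth_rV_comp oV VA sV s2).
Qed.
End Recharting.

(** * Orthonormal frames and parallel surfaces *)

Section OrthonormalFrame.
Variable R : realType.

Lemma dot3E (u v : 'rV[R]_3) : dot u v = u 0 0 * v 0 0 + u 0 1 * v 0 1 + u 0 2 * v 0 2.
Proof.
rewrite dotE !big_ord_recl big_ord0 addr0 addrA.
rewrite (_ : lift ord0 ord0 = 1); last exact: val_inj.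
by rewrite (_ : lift ord0 (lift ord0 ord0) = 2); last exact: val_inj.
Qed.

Lemma normalize (u : 'rV[R]_3) : u != 0 -> exists2 s : R, s != 0 & dot (s *: u) (s *: u) = 1.
Proof.
move=> u0; have uu := dot_gt0 u0; exists (Num.sqrt (dot u u))^-1.
  by rewrite invr_eq0 gt_eqF // sqrtr_gt0.
by rewrite dotZl dotZr mulrA -expr2 exprVn sqr_sqrtr ?mulVf ?gt_eqF // ltW.
Qed.

Definition cross (u v : 'rV[R]_3) : 'rV[R]_3 := \row_(j < 3)
  [:: u 0 1 * v 0 2 - u 0 2 * v 0 1; u 0 2 * v 0 0 - u 0 0 * v 0 2; u 0 0 * v 0 1 - u 0 1 * v 0 0]`_j.

(** Not all vectors are multiples of a, since the first two vectors of the
    standard basis are orthogonal and nonzero; the cross product completes the frame. *)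
Lemma orthonormal_completion (a : 'rV[R]_3) : dot a a = 1 -> exists e1 e2 : 'rV[R]_3,
  [/\ dot e1 e1 = 1, dot e2 e2 = 1 & [/\ dot e1 e2 = 0, dot e1 a = 0 & dot e2 a = 0]].
Proof.
move=> aa.
have [e1 e11 e1a] : exists2 e1 : 'rV[R]_3, dot e1 e1 = 1 & dot e1 a = 0.
  have [z z0] : exists z : 'rV[R]_3, z - dot z a *: a != 0.
    apply: contrapT => /forallNP h.
    have e i : delta_mx 0 i = dot (delta_mx 0 i) a *: a.
      by apply/eqP; rewrite -subr_eq0; apply/negPn/negP/h.
    have d01 : dot (delta_mx 0 0 : 'rV[R]_3) (delta_mx 0 1) = 0.
      by rewrite dot3E !mxE /= !(mulr0, mul0r, addr0).
    have d00 : dot (delta_mx 0 0 : 'rV[R]_3) (delta_mx 0 0) = 1.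
      by rewrite dot3E !mxE /= !(mulr0, mul0r, addr0, mulr1).
    have d11 : dot (delta_mx 0 1 : 'rV[R]_3) (delta_mx 0 1) = 1.
      by rewrite dot3E !mxE /= !(mulr0, mul0r, addr0, add0r, mulr1).
    rewrite (e 0) dotZl dotZr aa mulr1 in d00; rewrite (e 1) dotZl dotZr aa mulr1 in d11.
    rewrite (e 0) (e 1) dotZl dotZr aa mulr1 in d01.
    have : (1 : R) = 0 by rewrite -[LHS]mulr1 -{1}d00 -d11 mulrACA d01 mul0r.
    by move/eqP; rewrite oner_eq0.
  have [s s0 s1] := normalize z0; exists (s *: (z - dot z a *: a)) => //.
  by rewrite dotZl dotDl dotNl dotZl aa mulr1 subrr mulr0.
exists e1, (cross a e1); split=> //.
  have -> : dot (cross a e1) (cross a e1) = dot a a * dot e1 e1 - dot e1 a ^+ 2.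
    by rewrite !dot3E !mxE /=; ring.
  by rewrite aa e11 e1a expr0n subr0 mulr1.
by split=> //; rewrite dot3E !mxE /=; ring.
Qed.

Lemma frame_matrix (e1 e2 a : 'rV[R]_3) :
  dot e1 e1 = 1 -> dot e2 e2 = 1 -> dot a a = 1 -> dot e1 e2 = 0 -> dot e1 a = 0 -> dot e2 a = 0 ->
  exists Q : 'M[R]_3, Q *m Q^T = 1%:M /\
    forall r h v, rotate r h v *m Q = r *: (cos v *: e1 + sin v *: e2) + h *: a.
Proof.
move=> e11 e22 aa e12 e1a e2a; pose f (i : 'I_3) := [:: e1; e2; a]`_i.
exists (\matrix_i f i); split.
  apply/matrixP => i j; rewrite !mxE; transitivity (dot (f i) (f j)).
    by rewrite dotE; apply: eq_bigr => l _; rewrite !mxE.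
  have e21 : dot e2 e1 = 0 by rewrite dotC.
  have ea1 : dot a e1 = 0 by rewrite dotC.
  have ea2 : dot a e2 = 0 by rewrite dotC.
  by case: i j => [[|[|[]]] // ?] [[|[|[]]] // ?].
move=> r h v; apply/rowP => j; rewrite !mxE !big_ord_recl big_ord0 !mxE /f /=; ring.
Qed.
End OrthonormalFrame.

Section ParallelSurface.
Variables (R : realType) (S : smooth_surface R) (x n : S -> 'rV[R]_3) (t : R).
Hypothesis im : immersed_surface x n.
(** The parallel surface y from which x is recovered as y + t n. *)
Definition offset p := x p - t *: n p.

Lemma offset_smooth : smooth_map offset.
Proof.
have [sx sn] := front_smooth (proj1 im); move=> c ac.
have oc : open (cimg c) by exact: cimg_open.
exact: (smoothBv oc (sx c ac) (smoothZ oc (smooth_cst _ t) (sn c ac))).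
Qed.

(** The Weingarten equations turn the derivative of n into that of x. *)
Lemma offset_jacobian d q : coordinates d -> cimg d q ->
  'J (offset \o cinv d) q = (1%:M + t *: shape (x \o cinv d) (n \o cinv d) q) *m 'J (x \o cinv d) q.
Proof.
move=> cd iq; have oc : open (cimg d) by exact: cimg_open.
have [sx sn] := front_smooth (proj1 im).
have sxd := smooth_in_coordinates sx cd; have snd := smooth_in_coordinates sn cd.
have dp := smooth_differentiable (smooth_in_coordinates offset_smooth cd) iq.
have dx := smooth_differentiable sxd iq; have dn := smooth_differentiable snd iq.
apply: jacobianP => // v.
have -> : 'D_v (offset \o cinv d) q = 'D_v (x \o cinv d) q - t *: 'D_v (n \o cinv d) q.
  have := pdB v sxd (smoothZ oc (smooth_cst _ t) snd) iq.
  by rewrite (pdZc v t snd iq) !pdE.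
rewrite (deriveEjacobian _ dx) (deriveEjacobian _ dn).
rewrite (front_weingarten (proj1 im) cd iq (immersed_coordinates im cd iq)).
rewrite mulmxN scalerN opprK mulmxDl mul1mx mulmxDr; congr (_ + _).
by rewrite -scalemxAl scalemxAr.
Qed.

Lemma offset_front : front offset n.
Proof.
have [[sx sn nn tg] _] := im; split=> //; first exact: offset_smooth.
move=> c ac q iq v; have cc := atlas_coordinates ac.
rewrite (deriveEjacobian _ (smooth_differentiable (offset_smooth ac) iq)) offset_jacobian // mulmxA.
exact: (front_tangent (proj1 im) _ cc iq).
Qed.

Variables (k l : R) (d : chart R S) (q : 'rV[R]_2).
Hypotheses (cd : coordinates d) (iq : cimg d q).
Local Notation A := (shape (x \o cinv d) (n \o cinv d) q).
Hypothesis cpA : char_poly A = ('X - k%:P) * ('X - l%:P).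

Lemma offset_det : \det (1%:M + t *: A) = (1 + t * k) * (1 + t * l).
Proof. by have [s p] := proj1 (char_poly2E _ _ _) cpA; rewrite det2_shift -s -p; ring. Qed.

Lemma offset_immersion : immersion_at (offset \o cinv d) q <-> (1 + t * k) * (1 + t * l) != 0.
Proof.
rewrite /immersion_at offset_jacobian // -offset_det -unitfE -unitmxE; split=> [rf|u].
  rewrite -row_free_unit; apply: inj_row_free => v vB; apply: (row_free_inj rf).
  by rewrite mulmxA vB !mul0mx.
by rewrite /row_free eqmxMfull ?row_full_unit //; exact: (immersed_coordinates im cd iq).
Qed.

Lemma offset_curvatures : immersion_at (offset \o cinv d) q ->
  gauss_curvature (offset \o cinv d) (n \o cinv d) q = k * l / ((1 + t * k) * (1 + t * l)) /\
  mean_curvature (offset \o cinv d) (n \o cinv d) q =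
    (k + l + 2 * t * (k * l)) / ((1 + t * k) * (1 + t * l)) / 2.
Proof.
move=> imp; have d0 := proj1 offset_immersion imp.
have Bu : 1%:M + t *: A \in unitmx by rewrite unitmxE unitfE offset_det.
have sE : shape (offset \o cinv d) (n \o cinv d) q = A *m invmx (1%:M + t *: A).
  apply: (shape_unique imp); rewrite offset_jacobian //.
  rewrite (front_weingarten (proj1 im) cd iq (immersed_coordinates im cd iq)).
  by rewrite mulmxA mulmxKV.
have [s p] := proj1 (char_poly2E _ _ _) cpA.
have [dT tT] := parallel_shape_invariants Bu; rewrite offset_det -p in dT; rewrite offset_det -p -s in tT.
have [k0 l0] : 1 + t * k != 0 /\ 1 + t * l != 0 by move: d0; rewrite mulf_eq0 negb_or => /andP.
have cp : char_poly (shape (offset \o cinv d) (n \o cinv d) q) =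
    ('X - (k / (1 + t * k))%:P) * ('X - (l / (1 + t * l))%:P).
  rewrite sE; apply/char_poly2E; split; apply: (mulIf d0).
    by rewrite tT; field; rewrite k0 l0.
  by rewrite dT; field; rewrite k0 l0.
have [-> -> _] := principal_curvaturesP cp; split; field; rewrite ?k0 ?l0 //.
Qed.
End ParallelSurface.

(** * The common axis of all circles *)

Section ChannelLW.
Variables (R : realType) (S : smooth_surface R) (x n : S -> 'rV[R]_3).
Variables (F : set (chart R S)) (a b c : R).
Hypothesis im : immersed_surface x n.
Hypothesis lw : linear_weingarten_with x n a b c.
Hypothesis FF : curvature_line_foliation x n F.
Hypothesis circ : forall d, F d -> forall q, cimg d q -> in_circle (x @` plaque d q).
Hypothesis disc : b ^+ 2 - a * c != 0.

Local Notation kd d := (leaf_curvature x n d).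
Local Notation k1d d := (cross_curvature x n d).

Lemma F_coordinates d : F d -> coordinates d.
Proof. by have [[h _ _] _] := FF; move=> /h[]. Qed.
Lemma F_box d : F d -> exists I J, [/\ open_interval I, open_interval J & cimg d = box I J].
Proof. by have [[h _ _] _] := FF; move=> /h[_ [I [J [oI oJ E]]]]; exists I, J. Qed.
Lemma F_cover p : exists2 d, F d & cdom d p.
Proof. by have [[_ h _] _] := FF; exact: h. Qed.

(** The principal curvatures in arbitrary coordinates are those of a foliated
    chart. *)
Lemma F_curvatures d e p : F d -> coordinates e -> cdom d p -> cdom e p ->
  char_poly (shape (x \o cinv e) (n \o cinv e) (cmap e p)) =
  ('X - (kd d (cmap d p))%:P) * ('X - (k1d d (cmap d p))%:P).
Proof.
move=> Fd ce dp ep; have cd := F_coordinates Fd; have [I [J [oI oJ E]]] := F_box Fd.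
have prin : forall q, box I J q -> principal_direction (x \o cinv d) (n \o cinv d) q (dir2 R).
  by move=> q Uq; have [_ h] := FF; apply: h Fd _ _; rewrite E.
have oe : overlap e d (cmap e p) by split; [exact: cmap_img|rewrite /= cmapK].
have iq : cimg d (cmap d p) by exact: cmap_img.
have imd : immersion_at (x \o cinv d) (cmap d (cinv e (cmap e p))).
  by rewrite cmapK //; exact: (immersed_coordinates im cd iq).
rewrite (char_poly_shape_change (proj1 im) ce cd oe imd) cmapK //.
by apply: (leaf_char_poly prin); rewrite -E.
Qed.

Lemma F_lw d q : F d -> cimg d q -> a * (kd d q * k1d d q) + b * (kd d q + k1d d q) + c = 0.
Proof.
move=> Fd iq; have [e ae eq] := atlas_cover (cinv d q).
have dq : cdom d (cinv d q) by exact: cinv_dom.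
have cp := F_curvatures Fd (atlas_coordinates ae) dq eq; rewrite cinvK // in cp.
have [g m _] := principal_curvaturesP cp.
have := (proj2 lw) e ae _ (cmap_img eq); rewrite g m => H.
by rewrite -[RHS]H; field.
Qed.

Section OneChart.
Variables (d : chart R S) (Fd : F d) (I J : set R).
Hypotheses (oI : open_interval I) (oJ : open_interval J) (E : cimg d = box I J).
Let cd := F_coordinates Fd.

Lemma F_prin q : box I J q -> principal_direction (x \o cinv d) (n \o cinv d) q (dir2 R).
Proof. by move=> Uq; have [_ h] := FF; apply: h Fd _ _; rewrite E. Qed.
Let sx := chart_x_smooth im cd E.
Let sn := chart_n_smooth im cd E.
Let nn q (Uq : box I J q) := chart_n_unit im d Uq.
Let x1n q (Uq : box I J q) := chart_x_tangent im cd E (dir1 R) Uq.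
Let x2n q (Uq : box I J q) := chart_x_tangent im cd E (dir2 R) Uq.
Let imm q (Uq : box I J q) := chart_x_free im cd E Uq.
Let cir := chart_circles E (fun q Uq => circ Fd (box_in_image E Uq)).
Let n2E q (Uq : box I J q) := chart_n_dir2 im cd E F_prin Uq.
Let n1E q (Uq : box I J q) := chart_n_dir1 im cd E Uq.
Let lwd q (Uq : box I J q) := F_lw Fd (box_in_image E Uq).

Lemma F_umbilic q0 q : box I J q0 -> box I J q -> k1d d q0 = kd d q0 -> k1d d q = kd d q.
Proof.
move=> U0 Uq e0.
exact: (umbilic_propagates oI oJ erefl erefl sx sn x1n x2n imm cir n2E n1E lwd disc U0 e0 Uq).
Qed.

Lemma F_x20 q : box I J q -> pd (dir2 R) (x \o cinv d) q != 0.
Proof. by move=> Uq; exact: (x2_neq0 imm Uq). Qed.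

Hypothesis numb : forall q, box I J q -> k1d d q != kd d q.

Lemma F_axis q0 : box I J q0 -> exists ctr ax : 'rV[R]_3, ax != 0 /\
  forall q, box I J q -> dot (pd (dir2 R) (x \o cinv d) q) ax = 0 /\
    dot ((x \o cinv d) q - ctr) (pd (dir2 R) (x \o cinv d) q) = 0.
Proof.
exact: (axis_exists oI oJ erefl erefl sx sn nn x1n x2n imm cir n2E n1E lwd disc numb).
Qed.

Lemma F_flat (V : set 'rV[R]_2) q0 : open V -> V `<=` box I J -> V q0 -> c != 0 ->
  (forall q, V q -> kd d q * k1d d q = 0) -> forall q, box I J q -> k1d d q = 0.
Proof.
exact: (flat_propagates oI oJ erefl erefl sx sn nn x1n x2n imm cir n2E n1E lwd disc numb).
Qed.

Lemma F_rigid ctr ax : ax != 0 ->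
  (forall q, box I J q -> dot (pd (dir2 R) (x \o cinv d) q) ax = 0 /\
    dot ((x \o cinv d) q - ctr) (pd (dir2 R) (x \o cinv d) q) = 0) ->
  forall (V : set 'rV[R]_2) q0 B, open V -> V `<=` box I J -> V q0 ->
  (forall q, V q -> dot (pd (dir2 R) (x \o cinv d) q) B = 0) ->
  forall q, box I J q -> dot (pd (dir2 R) (x \o cinv d) q) B = 0.
Proof.
move=> ax0 axP V q0 B; exact: (axis_rigid oI oJ sx F_x20 ax0 axP).
Qed.

Lemma F_rot ctr ax t : dot ax ax = 1 ->
  (forall q, box I J q -> dot (pd (dir2 R) (x \o cinv d) q) ax = 0 /\
    dot ((x \o cinv d) q - ctr) (pd (dir2 R) (x \o cinv d) q) = 0) ->
  exists (r h : 'rV[R]_2 -> R) (w : 'rV[R]_2 -> 'rV[R]_3),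
  [/\ [/\ smooth_on (box I J) r, smooth_on (box I J) h & smooth_on (box I J) w],
     vconst I J r, vconst I J h,
     (forall q, box I J q -> [/\ dot (w q) (w q) = 1, dot (w q) ax = 0 & pd (dir2 R) w q != 0]) &
     forall q, box I J q -> x (cinv d q) - t *: n (cinv d q) = ctr + (r q *: w q + h q *: ax)].
Proof.
move=> ax1 axP; have ax0 : ax != 0 by rewrite -dot_eq0 ax1 oner_neq0.
exact: (rotational_form oI oJ erefl sx sn x2n F_x20 n2E ax0 axP ax1).
Qed.
End OneChart.

Hypothesis numbilic : ~ totally_umbilic x n.

(** Being umbilic spreads over foliated charts, hence over the surface. *)
Lemma no_umbilic d q : F d -> cimg d q -> k1d d q != kd d q.
Proof.
move=> Fd iq; apply/eqP => e0; apply: numbilic.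
pose P p := forall e, F e -> cdom e p -> k1d e (cmap e p) = kd e (cmap e p).
have key d1 d2 p : F d1 -> F d2 -> cdom d1 p -> cdom d2 p ->
    k1d d1 (cmap d1 p) = kd d1 (cmap d1 p) -> k1d d2 (cmap d2 p) = kd d2 (cmap d2 p).
  move=> F1 F2 p1 p2 e1; have c1 := F_coordinates F1.
  have [_ _ h1] := principal_curvaturesP (F_curvatures F1 c1 p1 p1).
  have [_ _ h2] := principal_curvaturesP (F_curvatures F2 c1 p2 p1).
  by apply/esym/h2/h1.
have all : forall p, P p.
  apply: (leafwise_global F_cover) => [e Fe p p' ep ep' Pp e' Fe' ep2|].
    apply: (key e e' p' Fe Fe' ep' ep2); have [I [J [oI oJ E]]] := F_box Fe.
    have iU r : cdom e r -> box I J (cmap e r) by rewrite -E; exact: (@cmap_img _ _ e r).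
    exact: (F_umbilic Fe oI oJ E (iU p ep) (iU p' ep') (Pp e Fe ep)).
  exists (cinv d q) => e Fe ep; apply: (key d e _ Fd Fe (cinv_dom iq) ep).
  by rewrite (cinvK iq).
move=> e ae z iz; have [d' Fd' dz] := F_cover (cinv e z).
have [_ _ h] := principal_curvaturesP (F_curvatures Fd' (atlas_coordinates ae) dz (cinv_dom iz)).
by rewrite -(cinvK iz); apply/h/esym/all.
Qed.

Lemma curvatures_exist p : exists k l, [/\ k != l, a * (k * l) + b * (k + l) + c = 0 &
  forall e, coordinates e -> cdom e p ->
    char_poly (shape (x \o cinv e) (n \o cinv e) (cmap e p)) = ('X - k%:P) * ('X - l%:P)].
Proof.
have [d Fd dp] := F_cover p; exists (kd d (cmap d p)), (k1d d (cmap d p)); split.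
- by rewrite eq_sym; exact: (no_umbilic Fd (cmap_img dp)).
- exact: (F_lw Fd (cmap_img dp)).
- by move=> e ce ep; exact: (F_curvatures Fd ce dp ep).
Qed.

Definition on_axis ctr (ax : 'rV[R]_3) d := forall q, cimg d q ->
  dot (pd (dir2 R) (x \o cinv d) q) ax = 0 /\
  dot ((x \o cinv d) q - ctr) (pd (dir2 R) (x \o cinv d) q) = 0.

(** The chart d' has some axis of its own. On the overlap the circles of d and d'
    have the same tangents, so ax and the difference of the two centres are
    orthogonal to the circles of d' there; by rigidity they are so on all of d'. *)
Lemma axis_transfer ctr ax d d' p : F d -> F d' -> cdom d p -> cdom d' p ->
  on_axis ctr ax d -> on_axis ctr ax d'.
Proof.
move=> Fd Fd' dp dp' axd.
have cd := F_coordinates Fd; have cd' := F_coordinates Fd'.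
have [I [J [oI oJ E]]] := F_box Fd'.
have nu q : box I J q -> k1d d' q != kd d' q by rewrite -E => Uq; exact: (no_umbilic _ Uq).
have iq0 : cimg d' (cmap d' p) by exact: (cmap_img dp').
have iq0' : box I J (cmap d' p) by rewrite -E.
have [c1 [a1 [a10 ax1]]] := F_axis Fd' oI oJ E nu iq0'.
have oV := @overlap_open R S d' d; have V0 : overlap d' d (cmap d' p).
  by split=> //=; rewrite cmapK.
have VU : overlap d' d `<=` box I J by rewrite -E => q [].
have [sx _] := front_smooth (proj1 im).
have par2 q : overlap d' d q -> exists s : R,
    pd (dir2 R) (x \o cinv d') q = s *: pd (dir2 R) (x \o cinv d) (cmap d (cinv d' q)).
  move=> oq; have [iq /= dq] := oq.
  have dx' := smooth_differentiable (smooth_in_coordinates sx cd') iq.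
  have dx := smooth_differentiable (smooth_in_coordinates sx cd) (cmap_img dq).
  have dt := smooth_differentiable (transition_smooth cd' cd) oq.
  rewrite !pdE (deriveEjacobian _ dx') (coordinate_change sx cd' cd oq) mulmxA.
  rewrite -(deriveEjacobian _ dt) (deriveEjacobian _ dx).
  have [[_ _ h] _] := FF; have h0 := h d' d Fd' Fd q iq dq.
  set T := 'D_(dir2 R) (cmap d \o cinv d') q in h0 *.
  exists (T 0 1); rewrite {1}[T]rV2_decomp h0 scale0r add0r -scalemxAl //.
have xeq q : overlap d' d q -> x (cinv d' q) = x (cinv d (cmap d (cinv d' q))).
  by move=> [_ /= dq]; rewrite cmapK.
have V1 q : overlap d' d q -> dot (pd (dir2 R) (x \o cinv d') q) ax = 0.
  move=> oq; have [s ->] := par2 q oq; have [_ /= dq] := oq.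
  by rewrite dotZl (axd _ (cmap_img dq)).1 mulr0.
have V2 q : overlap d' d q -> dot ((x \o cinv d') q - ctr) (pd (dir2 R) (x \o cinv d') q) = 0.
  move=> oq; have [s ->] := par2 q oq; have [_ /= dq] := oq.
  have /= e2 := (axd _ (cmap_img dq)).2.
  by rewrite dotZr /= (xeq _ oq) e2 mulr0.
have V3 q : overlap d' d q -> dot (pd (dir2 R) (x \o cinv d') q) (c1 - ctr) = 0.
  move=> oq; have := V2 q oq; have [_] := ax1 q (VU _ oq).
  rewrite dotC (dotC (_ - ctr)) !dotDr !dotNr; lra.
have W1 := F_rigid Fd' oI oJ E a10 ax1 oV VU V0 V1.
have W3 := F_rigid Fd' oI oJ E a10 ax1 oV VU V0 V3.
move=> q; rewrite E => Uq; split; first exact: W1.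
have [_] := ax1 q Uq; have := W3 q Uq.
rewrite (dotC _ (pd _ _ _)) (dotC (_ - ctr)) !dotDr !dotNr; lra.
Qed.

Lemma global_axis : exists ctr ax, dot ax ax = 1 /\ forall d, F d -> on_axis ctr ax d.
Proof.
have [[p _]|S0] := pselect (exists p : S, True); last first.
  exfalso; apply: numbilic => d ad q iq; exfalso; apply: S0.
  by exists (cinv d q).
have [d0 F0 dp] := F_cover p; have [I [J [oI oJ E]]] := F_box F0.
have nu q : box I J q -> k1d d0 q != kd d0 q by rewrite -E => Uq; exact: (no_umbilic _ Uq).
have U0 : box I J (cmap d0 p) by rewrite -E; exact: cmap_img.
have [ctr [a0 [a00 ax0]]] := F_axis F0 oI oJ E nu U0.
have [s s0 s1] := normalize a00; exists ctr, (s *: a0); split=> //.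
pose P p := forall d, F d -> cdom d p -> on_axis ctr (s *: a0) d.
have all : forall p, P p.
  apply: (leafwise_global F_cover) => [d Fd p1 p2 d1 d2 P1 d' Fd' d2'|].
    exact: (axis_transfer Fd Fd' d2 d2' (P1 d Fd d1)).
  exists p => d Fd dp'; apply: (axis_transfer F0 Fd dp dp') => q; rewrite E => Uq.
  by have [e1 e2] := ax0 q Uq; rewrite dotZr e1 mulr0.
move=> d Fd q iq; exact: all (cinv d q) d Fd (cinv_dom iq) q iq.
Qed.

(** If K = 0 on an open set, then K = 0 on every foliated chart that meets it, and
    so on the whole surface. This is a linear Weingarten condition with vanishing
    discriminant. *)
Lemma nowhere_flat (O : set S) p : c != 0 -> open O -> O p ->
  (forall p', O p' -> exists k l, k * l = 0 /\ exists e, [/\ coordinates e, cdom e p' &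
    char_poly (shape (x \o cinv e) (n \o cinv e) (cmap e p')) = ('X - k%:P) * ('X - l%:P)]) ->
  tubular x n.
Proof.
move=> c0 oO Op flat; left; exists 1, 0, 0; split; last by rewrite /discriminant expr0n mulr0 subr0.
split; first by move=> [/eqP]; rewrite oner_eq0.
have prod_eq (k l k' l' : R) (A : 'M[R]_2) : char_poly A = ('X - k%:P) * ('X - l%:P) ->
    char_poly A = ('X - k'%:P) * ('X - l'%:P) -> k * l = k' * l'.
  by move=> /char_poly2E[_ ->] /char_poly2E[_ ->].
pose Q p := exists2 V : set S, open V & V p /\ forall p' d, V p' -> F d -> cdom d p' ->
  kd d (cmap d p') * k1d d (cmap d p') = 0.
have all : forall p, Q p.
  apply: (leafwise_global F_cover) => [d Fd p1 p2 d1 d2 [V oV [V1 VP]]|]; last first.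
    exists p; exists O => //; split=> // p' d Op' Fd dp'.
    have [k [l [kl [e [ce ep cp]]]]] := flat p' Op'.
    by rewrite -(prod_eq _ _ _ _ _ cp (F_curvatures Fd ce dp' ep)).
  have [I [J [oI oJ E]]] := F_box Fd.
  have nu q : box I J q -> k1d d q != kd d q by rewrite -E => Uq; exact: (no_umbilic _ Uq).
  pose V' := cimg d `&` cinv d @^-1` V.
  have oV' : open V' by exact: chart_preimage_open.
  have V'U : V' `<=` box I J by rewrite -E => q [].
  have V'0 : V' (cmap d p1) by split; [exact: cmap_img|rewrite /= cmapK].
  have k10 := F_flat Fd oI oJ E nu oV' V'U V'0 c0.
  have {}k10 : forall q, box I J q -> k1d d q = 0.
    apply: k10 => q [iq /= Vq]; have := VP _ d Vq Fd (cinv_dom iq).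
    by rewrite cinvK.
  exists (cdom d); first exact: cdom_open.
  split=> // p' d' dp' Fd' dp''.
  have cd' := F_coordinates Fd'.
  rewrite (prod_eq _ _ _ _ _ (F_curvatures Fd' cd' dp'' dp'') (F_curvatures Fd cd' dp' dp'')).
  by rewrite k10 ?mulr0 // -E; exact: cmap_img.
move=> e ae q iq; have [d Fd dq] := F_cover (cinv e q).
have cp := F_curvatures Fd (atlas_coordinates ae) dq (cinv_dom iq); rewrite cinvK // in cp.
have [-> _ _] := principal_curvaturesP cp.
have [V _ [Vq VP]] := all (cinv e q).
by rewrite (VP _ d Vq Fd dq) !mulr0 mul0r !addr0.
Qed.
End ChannelLW.

(** * Charts adapted to the rotation *)

Section RotationCharts.
Variable R : realType.

Lemma derive_comp_eq0 (U : set 'rV[R]_2) (phi : 'rV[R]_2 -> R) (e1 e2 : 'rV[R]_3) v q :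
  open U -> smooth_on U phi -> U q -> 'D_v phi q = 0 ->
  pd v (fun q => cos (phi q) *: e1 + sin (phi q) *: e2) q = 0.
Proof.
move=> oU sphi Uq D0; have dphi := smooth_differentiable sphi Uq.
have [ss sc] := smooth_sin_cos R.
have comp0 (f : R -> R) : smooth_on [set: R] f -> 'D_v (fun q => f (phi q)) q = 0.
  move=> sf; have df : differentiable f (phi q) := smooth_differentiable sf I.
  rewrite deriveE; last exact: (differentiable_comp dphi df).
  by rewrite (diff_comp dphi df) /= -(deriveE _ dphi) D0 linear0.
have s1 : smooth_on U (fun q => cos (phi q)) by exact: (smooth_real_comp oU (U' := setT) _ sphi sc).
have s2 : smooth_on U (fun q => sin (phi q)) by exact: (smooth_real_comp oU (U' := setT) _ sphi ss).
rewrite (pdD v (smoothZ oU s1 (smooth_cst U e1)) (smoothZ oU s2 (smooth_cst U e2)) Uq).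
rewrite (pdZ v s1 (smooth_cst U e1) Uq) (pdZ v s2 (smooth_cst U e2) Uq).
by rewrite !sdE !comp0 // !pd_cst !scale0r !scaler0 !addr0.
Qed.

Lemma level_open (U : set 'rV[R]_2) (A : set 'rV[R]_2) (phi : 'rV[R]_2 -> R) a b :
  open A -> A `<=` U -> smooth_on U phi -> open [set q | A q /\ `|phi q - a| < b].
Proof.
move=> oA AU sphi; rewrite openE => q [Aq h]; rewrite /interior.
have d0 : 0 < b - `|phi q - a| by rewrite subr_gt0.
have cphi : {for q, continuous phi} := smooth_continuous sphi (AU q Aq).
have n : \forall p \near q, `|phi q - phi p| < b - `|phi q - a|.
  exact: (proj1 (cvgrPdist_lt _ _) cphi _ d0).
apply: filterS2 (open_near oA Aq) n => p Ap hp; split=> //.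
by apply: (le_lt_trans (ler_distD (phi q) _ _)); rewrite distrC -ltrBrDr.
Qed.

Variables (S : smooth_surface R).

(** On N, y is obtained by rotating the curve (r, h), and its parameter may be
    moved to any interval of length 1: sg is the parameter that corresponds to 0. *)
Definition local_profile (y : S -> 'rV[R]_3) (ctr : 'rV[R]_3) (Q : 'M[R]_3) (N : set S)
    (r h : R -> R) : Prop :=
  [/\ open N, smooth_on [set s : R | `|s| < 1] r, smooth_on [set s : R | `|s| < 1] h &
    forall (sg : R) p, N p -> exists d : chart R S, [/\ coordinates d, cdom d p &
      forall q, cimg d q -> `|q 0 0 - sg| < 1 / 2 /\
        y (cinv d q) = ctr + rotate (r (q 0 0 - sg)) (h (q 0 0 - sg)) (q 0 1) *m Q]].

(** The angle phi of the unit radial vector w replaces v as a coordinate, since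
    w_v <> 0. The coordinate u is replaced by sg + (u - u0) / eps, so that the
    local profile curve occupies a slot of fixed size around an arbitrary centre
    sg, ready for concatenation. *)
Lemma rotation_charts (d : chart R S) (I J : set R) (y : S -> 'rV[R]_3) (ctr e1 e2 ax : 'rV[R]_3)
    (Q : 'M[R]_3) (r h : 'rV[R]_2 -> R) (w : 'rV[R]_2 -> 'rV[R]_3) p :
  coordinates d -> open_interval I -> open_interval J -> cimg d = box I J -> cdom d p ->
  [/\ dot e1 e1 = 1, dot e2 e2 = 1 & dot ax ax = 1] ->
  [/\ dot e1 e2 = 0, dot e1 ax = 0 & dot e2 ax = 0] ->
  (forall r h v : R, rotate r h v *m Q = r *: (cos v *: e1 + sin v *: e2) + h *: ax) ->
  [/\ smooth_on (box I J) r, smooth_on (box I J) h & smooth_on (box I J) w] ->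
  vconst I J r -> vconst I J h ->
  (forall q, box I J q -> [/\ dot (w q) (w q) = 1, dot (w q) ax = 0 & pd (dir2 R) w q != 0]) ->
  (forall q, box I J q -> y (cinv d q) = ctr + (r q *: w q + h q *: ax)) ->
  exists N r1 h1, N p /\ local_profile y ctr Q N r1 h1.
Proof.
move=> cd oI oJ E dp [e11 e22 axx] [e12 e1a e2a] QE [sr sh sw] vr vh wP yE.
pose q0 := cmap d p; have oU : open (box I J) := box_open oI oJ.
have U0 : box I J q0 by rewrite -E; exact: (cmap_img dp).
have wP2 q : box I J q -> dot (w q) (w q) = 1 /\ dot (w q) ax = 0 by move=> /wP[].
have [V [phi [oV V0 VU sphi wE]]] := angle_exists oU U0 sw e11 e22 axx e12 e1a e2a wP2.
have D2 : 'D_(dir2 R) phi q0 != 0.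
  apply/eqP => D0; have [_ _ /eqP] := wP q0 U0; apply.
  by rewrite (pd_eq oV _ V0 wE); exact: (derive_comp_eq0 e1 e2 oV sphi V0 D0).
have [eps [eta [beta [g [[eps0 eta0 beta0] rV gP gK sg]]]]] := fiber_inverse oV V0 sphi D2.
set u0 := q0 0 0 in rV gP gK sg; set v0 := q0 0 1 in rV gP gK sg.
have epsN : eps != 0 by rewrite gt_eqF.
pose A : set 'rV[R]_2 := [set q | rect u0 v0 (eps / 2) eta q /\ `|phi q - phi q0| < beta].
have half q : rect u0 v0 (eps / 2) eta q -> rect u0 v0 eps eta q.
  by move=> [h1 h2]; split=> //; apply: (lt_trans h1); lra.
have AV : A `<=` V by move=> q [/half/rV].
have oA : open A.
  apply: (level_open (U := V)) sphi; first exact: rect_open.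
  by move=> q /half/rV.
have shift (s : R) : `|s| < 1 -> box I J (pt (u0 + eps * s) v0).
  move=> s1; apply/VU/rV; split; rewrite ?pt0 ?pt1 ?subrr ?normr0 // addrAC subrr add0r.
  by rewrite normrM (gtr0_norm eps0) gtr_pMr.
have oD : open [set s : R | `|s| < 1].
  rewrite (_ : [set s : R | _] = ball (0 : R) 1); first exact: ball_open.
  by apply/seteqP; split=> s /=; rewrite -ball_normE /= sub0r normrN.
have line : smooth_on [set s : R | `|s| < 1] (fun s : R => pt (u0 + eps * s) v0).
  apply: (smooth_pt oD); last exact: smooth_cst.
  apply: (smoothD oD); first exact: smooth_cst.
  apply: (smoothM oD); [exact: smooth_cst|exact: smooth_idR].
exists (cdom d `&` cmap d @^-1` A), (fun s => r (pt (u0 + eps * s) v0)),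
  (fun s => h (pt (u0 + eps * s) v0)); split.
  split=> //; split; last by rewrite /= subrr normr0.
  by split; rewrite /= subrr normr0 // divr_gt0.
split; first exact: chart_image_open.
- exact: (smooth_rV_comp_real oD shift line sr).
- exact: (smooth_rV_comp_real oD shift line sh).
move=> s p' [dp' /= Ap'].
pose B := rect s (phi q0) (1 / 2) beta; have oB : open B by exact: rect_open.
pose f (q : 'rV[R]_2) := pt (s + (q 0 0 - u0) / eps) (phi q).
pose a (z : 'rV[R]_2) := pt (u0 + eps * (z 0 0 - s)) (z 0 1).
have aP z : B z -> rect u0 (phi q0) eps beta (a z) /\ `|a z 0 0 - u0| < eps / 2.
  move=> [z0 z1]; suff H : `|a z 0 0 - u0| < eps / 2.
    split=> //; split; last by rewrite pt1.
    apply: (lt_trans H); lra.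
  rewrite pt0 addrAC subrr add0r normrM (gtr0_norm eps0) ltr_pM2l //.
  by rewrite -[X in _ < X]mul1r.
have sf : smooth_on A f.
  apply: (smooth_pt oA); last exact: smooth_on_subset sphi.
  apply: (smoothD oA); first exact: smooth_cst.
  apply: (smoothM oA); last exact: smooth_cst.
  apply: (smoothB oA); [exact: smooth_coord|exact: smooth_cst].
have sa : smooth_on B a.
  apply: (smooth_pt oB); last exact: smooth_coord.
  apply: (smoothD oB); first exact: smooth_cst.
  apply: (smoothM oB); first exact: smooth_cst.
  apply: (smoothB oB); [exact: smooth_coord|exact: smooth_cst].
have sga : smooth_on B (fun z => g (a z)).
  by apply: (smooth_rV_comp oB _ sa sg) => z /aP[].
have fA q : A q -> B (f q) /\ g (a (f q)) = q.
  move=> [hq hphi]; have af : a (f q) = pt (q 0 0) (phi q).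
    by rewrite /a /f pt0 pt1; congr (pt _ _); field.
  rewrite af gK //; last exact: half.
  have [h1 _] := hq; split=> //; split; last by rewrite /f pt1.
  rewrite /f pt0 addrAC subrr add0r normrM normfV (gtr0_norm eps0) ltr_pdivrMr //.
  by rewrite mul1r mulrC.
have gB z : B z -> A (g (a z)) /\ f (g (a z)) = z.
  move=> Bz; have [ra h0] := aP z Bz; have [[g1 g2] g3 g4] := gP (a z) ra.
  have [_ z1] := Bz; split; last first.
    by apply: rV2P; rewrite /f ?pt0 ?pt1 ?g3 ?g4 /a ?pt0 ?pt1 //; field.
  split; last by rewrite g4 /a pt1.
  by split=> //; rewrite g3.
have Ad : A `<=` cimg d by rewrite E => q /AV/VU.
have [d' [cd' dom' img' inv']] := rechart cd oA oB Ad sf sga fA gB.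
exists d'; split=> //; first by rewrite dom'.
move=> z; rewrite img' => Bz; split; first by have [] := Bz.
have [ra _] := aP z Bz; have [rg g3 g4] := gP (a z) ra.
have [Ag _] := gB z Bz; have Vg := AV _ Ag; have Ug := VU _ Vg.
rewrite (inv' z Bz) (yE _ Ug) QE (wE _ Vg) g4.
have z1 : `|z 0 0 - s| < 1.
  have [z0 _] := Bz; apply: (lt_trans z0); lra.
have e0 : g (a z) 0 0 = pt (u0 + eps * (z 0 0 - s)) v0 0 0 by rewrite g3 /a !pt0.
rewrite (vr _ _ Ug (shift _ z1) e0) (vh _ _ Ug (shift _ z1) e0).
by rewrite /a pt1.
Qed.
End RotationCharts.

(** * A single profile curve *)

Section Revolution.
Variables (R : realType) (S : smooth_surface R).

(** Each member of a countable basis selects one of the sets N t that contain it. *)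
Lemma lindelof (T : Type) (N : T -> set S) (t0 : T) : (forall t, open (N t)) ->
  (forall p, exists t, N t p) -> exists s : nat -> T, forall p, exists i, N (s i) p.
Proof.
move=> oN cN; have [B cB [Bo Bb]] := @surface_second_countable _ S.
have [f finj] := elimT (countable_injP _) cB.
have pick i : exists t, forall b, B b -> f b = i -> (exists t', b `<=` N t') -> b `<=` N t.
  have [[b [Bb1 fb [t bt]]]|no] := pselect (exists b, [/\ B b, f b = i & exists t', b `<=` N t']).
    exists t => b' Bb' fb' _; rewrite (_ : b' = b) //.
    by apply: finj; rewrite ?inE // fb'.
  by exists t0 => b Bb1 fb ex; exfalso; apply: no; exists b.
have [s sP] := choice pick; exists s => p.
have [t tp] := cN p; have oNt : nbhs p (N t) by exact: open_nbhs_nbhs.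
have [b [Bb1 bp] bN] := Bb p _ oNt; exists (f b).
by apply: (sP (f b) b Bb1 erefl); first by exists t.
Qed.

(** The i-th local profile curve is placed around the parameter 3 i of the common
    one. *)
Lemma revolution_from_profiles (y : S -> 'rV[R]_3) (ctr : 'rV[R]_3) (Q : 'M[R]_3) :
  Q *m Q^T = 1%:M ->
  (forall p, exists N r h, N p /\ local_profile y ctr Q N r h) ->
  surface_of_revolution y.
Proof.
move=> QQ loc.
pose good (D : set S * ((R -> R) * (R -> R))) := local_profile y ctr Q D.1 D.2.1 D.2.2.
have good0 : good (set0, (fun=> 0, fun=> 0)).
  by split; [exact: open0|exact: smooth_cst|exact: smooth_cst|move=> sg p' []].
have [D DP] : exists D : nat -> {D | good D}, forall p, exists i, (sval (D i)).1 p.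
  apply: (lindelof (T := {D | good D}) (N := fun D => (sval D).1) (exist _ _ good0)) => [[D []]|p] //.
  have [N [r [h [Np gN]]]] := loc p; have {}gN : good (N, (r, h)) by exact: gN.
  by exists (exist _ _ gN).
have gD i : good (sval (D i)) by case: (D i).
have [r sr rE] := concatenation (f := fun i => (sval (D i)).2.1) (fun i => let: And4 _ s _ _ := gD i in s).
have [h sh hE] := concatenation (f := fun i => (sval (D i)).2.2) (fun i => let: And4 _ _ s _ := gD i in s).
exists ctr, Q, setT, r, h; split=> //.
  by split; [exact: openT|move=> u v _ _ w _].
move=> p; have [i pi] := DP p; have [_ _ _ H] := gD i.
have [d [cd dp dE]] := H (3 * i%:R) p pi; exists d; split=> // q iq.
have [q1 ->] := dE q iq; split=> //.
by rewrite -(rE i _ q1) -(hE i _ q1) (addrC (3 * _)) subrK.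
Qed.
End Revolution.

(** * The parallel surface *)

Section Conclusion.
Variables (R : realType) (S : smooth_surface R) (x n : S -> 'rV[R]_3).
Variables (F : set (chart R S)) (a b c : R).
Hypothesis im : immersed_surface x n.
Hypothesis lw : linear_weingarten_with x n a b c.
Hypothesis FF : curvature_line_foliation x n F.
Hypothesis circ : forall d, F d -> forall q, cimg d q -> in_circle (x @` plaque d q).
Hypothesis ntub : ~ tubular x n.

Lemma disc_neq0 : b ^+ 2 - a * c != 0.
Proof. by apply/eqP => d0; apply: ntub; left; exists a, b, c. Qed.

Let numb : ~ totally_umbilic x n.
Proof. by move=> tu; apply: ntub; right. Qed.

Lemma offset_revolution t : surface_of_revolution (offset x n t).
Proof.
have [ctr [ax [ax1 axF]]] := global_axis im lw FF circ disc_neq0 numb.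
have [e1 [e2 [e11 e22 [e12 e1a e2a]]]] := orthonormal_completion ax1.
have [Q [QQ QE]] := frame_matrix e11 e22 ax1 e12 e1a e2a.
apply: (revolution_from_profiles (ctr := ctr) QQ) => p.
have [d Fd dp] := F_cover FF p; have [I [J [oI oJ E]]] := F_box FF Fd.
have axU q : box I J q -> dot (pd (dir2 R) (x \o cinv d) q) ax = 0 /\
    dot ((x \o cinv d) q - ctr) (pd (dir2 R) (x \o cinv d) q) = 0.
  by rewrite -E; exact: (axF d Fd q).
have [r [h [w [smooth_rhw vr vh wP yE]]]] := F_rot im FF Fd oI oJ E t ax1 axU.
exact: (rotation_charts (F_coordinates FF Fd) oI oJ E dp (And3 e11 e22 ax1) (And3 e12 e1a e2a)
  QE smooth_rhw vr vh wP yE).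
Qed.

Let curv := curvatures_exist im lw FF circ disc_neq0 numb.

Lemma curvatures_at d q : atlas d -> cimg d q -> exists k l, [/\ k != l,
  a * (k * l) + b * (k + l) + c = 0 &
  char_poly (shape (x \o cinv d) (n \o cinv d) q) = ('X - k%:P) * ('X - l%:P)].
Proof.
move=> ad iq; have [k [l [kl e H]]] := curv (cinv d q); exists k, l; split=> //.
by have := H d (atlas_coordinates ad) (cinv_dom iq); rewrite (cinvK iq).
Qed.

(** For c = 0 the Weingarten relation is k + l + 2 t k l = 0, and its left-hand
    side is the numerator of the mean curvature of x - t n. The surface is regular:
    1 + t k = 0 and this relation would imply k = l. *)
Lemma parallel_minimal : c = 0 ->
  (forall p, immersed_at (offset x n (a / (2 * b))) p) /\ minimal (offset x n (a / (2 * b))) n.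
Proof.
move=> c0; have b0 : b != 0.
  by apply: contraNN disc_neq0 => /eqP ->; rewrite c0 expr0n mulr0 subrr.
set t := a / (2 * b).
have rel k l : a * (k * l) + b * (k + l) + c = 0 -> k + l + 2 * t * (k * l) = 0.
  rewrite c0 addr0 => e; apply: (mulfI b0); rewrite mulr0 -[RHS]e /t; field.
  by rewrite b0.
split=> [p d ad dp|d ad q iq imq].
  have [k [l [kl /rel e cp]]] := curvatures_at ad (cmap_img dp).
  apply/(offset_immersion t im (atlas_coordinates ad) (cmap_img dp) cp).
  apply: contraNN kl; rewrite mulf_eq0 => /orP[]/eqP z; apply/eqP.
    have : t * k = -1 by lra.
    by move=> z'; have : k + l + 2 * (t * k) * l = 0 by [rewrite -[RHS]e; ring]; rewrite z'; lra.
  have : t * l = -1 by lra.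
  by move=> z'; have : k + l + 2 * (t * l) * k = 0 by [rewrite -[RHS]e; ring]; rewrite z'; lra.
have [k [l [kl /rel e cp]]] := curvatures_at ad iq.
have [_ ->] := offset_curvatures im (atlas_coordinates ad) iq cp imq.
by rewrite e !mul0r.
Qed.

(** For t = b / c the Weingarten relation yields
    (1 + t k) (1 + t l) = (b^2 - a c) / c^2 k l. So x - t n is singular exactly
    where k l = 0, and elsewhere k l cancels from its Gauss curvature. *)
Lemma parallel_constant_curvature : c != 0 ->
  generically_immersed (offset x n (b / c)) /\
  constant_gauss_curvature (offset x n (b / c)) n (c ^+ 2 / (b ^+ 2 - a * c)).
Proof.
move=> c0; set t := b / c.
have rel k l : a * (k * l) + b * (k + l) + c = 0 ->
    (1 + t * k) * (1 + t * l) = (b ^+ 2 - a * c) / c ^+ 2 * (k * l).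
  move=> e; have -> : (1 + t * k) * (1 + t * l) =
      (b ^+ 2 - a * c) / c ^+ 2 * (k * l) + (a * (k * l) + b * (k + l) + c) / c.
    by rewrite /t; field.
  by rewrite e mul0r addr0.
split=> [A [p Ap] oA|d ad q iq imq]; last first.
  have [k [l [kl /rel e cp]]] := curvatures_at ad iq.
  have := (proj1 (offset_immersion t im (atlas_coordinates ad) iq cp)) imq.
  have [-> _] := offset_curvatures im (atlas_coordinates ad) iq cp imq.
  rewrite e !mulf_eq0 !negb_or => /andP[_ /andP[k0 l0]].
  field; rewrite ?k0 ?l0 ?c0 ?disc_neq0 //.
apply: contrapT => none; apply: ntub.
apply: (nowhere_flat im lw FF circ disc_neq0 numb c0 oA Ap) => p' Ap'.
have [k [l [kl /rel e cp]]] := curv p'; exists k, l; split; last first.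
  by have [d ad dp] := atlas_cover p'; exists d; have cd := atlas_coordinates ad; split=> //; exact: cp.
apply/eqP; apply/negPn/negP => kl0; apply: none; exists p'; split; [by []|move=> d ad dp].
have cd := atlas_coordinates ad.
apply/(offset_immersion t im cd (cmap_img dp) (cp d cd dp)).
by rewrite e (mulf_neq0 (mulf_neq0 disc_neq0 _) kl0) // invr_neq0 // expf_neq0.
Qed.
End Conclusion.

Theorem corollary3p1 (R : realType) (S : smooth_surface R)
    (x n : S -> 'rV[R]_3) :
  immersed_surface x n ->
  linear_weingarten x n ->
  channel x n ->
  tubular x n \/
  exists (y : S -> 'rV[R]_3) (t : R),
    [/\ front y n, generically_immersed y, x = parallel_surface y n t,
        surface_of_revolution y &
        minimal y n \/ exists K : R, K <> 0 /\ constant_gauss_curvature y n K].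
Proof.
move=> im [a [b [c lw]]] [F [FF arcs lines]].
have [tub|ntub] := pselect (tubular x n); [by left|right].
have circ d : F d -> forall q, cimg d q -> in_circle (x @` plaque d q).
  move=> Fd q iq; have [//|line] := arcs d Fd q iq.
  by exfalso; apply: ntub; apply: lines; exists d, q.
have back t : x = parallel_surface (offset x n t) n t.
  by apply/funext => p; rewrite /parallel_surface /offset subrK.
have [c0|c0] := eqVneq c 0.
  have [imm H0] := parallel_minimal im lw FF circ ntub c0.
  exists (offset x n (a / (2 * b))), (a / (2 * b)); split=> //.
  - exact: offset_front.
  - by move=> A [p Ap] _; exists p; split=> //; exact: imm.
  - exact: (offset_revolution im lw FF circ ntub).
  - by left.
have [gen cK] := parallel_constant_curvature im lw FF circ ntub c0.
exists (offset x n (b / c)), (b / c); split=> //.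
- exact: offset_front.
- exact: (offset_revolution im lw FF circ ntub).
- right; exists (c ^+ 2 / (b ^+ 2 - a * c)); split=> //; apply/eqP.
  by rewrite (mulf_neq0 _ (invr_neq0 (disc_neq0 lw ntub))) // expf_neq0.
Qed.
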